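(* Let $c \in \mathbb{Z}$ with neither $-c$ nor $-(c+1)$ a square in $\mathbb{Z}$. Let $L_c$ be the splitting field over $\mathbb{Q}$ of $(x^2+c)^2+c$, and write $2\mathcal{O}_{L_c} = \prod_{i=1}^g \mathfrak{p}_i^e$ with common residue degree $f$. Then: $(e,f,g) = (8,1,1)$ if and only if $c \equiv 1 \pmod 4$, or $c = 2^{2k+1}m$ with $k \geq 1$ and $m$ odd; $(e,f,g) = (4,2,1)$ if and only if one of: $c \equiv 2 \pmod 8$; $c \equiv 3 \pmod{16}$; $c \equiv 4$ or $12 \pmod{32}$; $c = 4^k(8r \pm 3)$ with $k \geq 2$, $r \in \mathbb{Z}$; $(e,f,g) = (4,1,2)$ if and only if one of: $c \equiv 6 \pmod 8$; $c \equiv 23$ or $28 \pmod{32}$; $c \equiv 16 \pmod{128}$; $c = 4^{2k}(8r+1)$ with $k \geq 2$, $r \in \mathbb{Z}$; $c = 4^{2k-1}(8r+7)$ with $k\geq 2$, $r \in \mathbb{Z}$; $c = -1 + 2^k(4r+1)$ with $k \geq 4$, $r \in \mathbb{Z}$; $(e,f,g) = (2,2,2)$ if and only if one of: $c \equiv 11 \pmod{16}$; $c \equiv 39$ or $52 \pmod{64}$; $c \equiv 240 \pmod{256}$; $c = -1 + 4^k(64r+24)$ with $k \geq 1$, $r \in \mathbb{Z}$; $c = -1 + 4^k(8r+3)$ with $k \geq 2$, $r \in \mathbb{Z}$; $c = 4^{2k-1}(16r+9)$ with $k \geq 2$, $r \in \mathbb{Z}$; $c = 4^{2k}(16r+7)$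 with $k \geq 2$, $r \in \mathbb{Z}$; $(e,f,g) = (2,1,4)$ if and only if one of: $c \equiv 7$ or $20 \pmod{64}$; $c \equiv 112 \pmod{256}$; $c = -1 + 4^k(64r-8)$ with $k \geq 1$, $r \in \mathbb{Z}$; $c = -1 + 4^k(8r+7)$ with $k \geq 2$, $r \in \mathbb{Z}$; $c = 4^{2k-1}(16r+1)$ with $k \geq 2$, $r \in \mathbb{Z}$; $c = 4^{2k}(16r+15)$ with $k \geq 2$, $r \in \mathbb{Z}$; and these are the only possibilities for $(e,f,g)$.
   Context: $\mathcal{O}_{L_c}$ is the ring of integers of $L_c$. Since $L_c/\mathbb{Q}$ is Galois, the primes $\mathfrak{p}_1,\dots,\mathfrak{p}_g$ of $\mathcal{O}_{L_c}$ above $2$ (distinct) have a common ramification index $e$ and a common residue degree $f = [\mathcal{O}_{L_c}/\mathfrak{p}_i : \mathbb{Z}/2\mathbb{Z}]$, with $efg = [L_c:\mathbb{Q}]$. *)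

(* Defs.v *)
From mathcomp Require Import all_boot all_order all_algebra all_field.
Set Implicit Arguments. Unset Strict Implicit. Unset Printing Implicit Defensive.
Import Order.TTheory GRing.Theory Num.Theory.
Local Open Scope ring_scope.

Definition fc (c : int) : {poly algC} :=
  ('X ^+ 2 + (c%:~R)%:P) ^+ 2 + (c%:~R)%:P.

(* L_c: the splitting field of f_c over Q, realized inside algC as the
   smallest subfield of algC containing all roots of f_c. *)
Definition subfieldP (S : algC -> Prop) : Prop :=
  S 1 /\ (forall x y, S x -> S y -> S (x - y)) /\
  (forall x y, S x -> S y -> S (x * y)) /\ (forall x, S x -> S x^-1).

Definition Lc (c : int) (x : algC) : Prop :=
  forall S, subfieldP S -> (forall r, root (fc c) r -> S r) -> S x.

Definition OL (c : int) (x : algC) : Prop := Lc c x /\ x \in Aint.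

Definition is_ideal (c : int) (I : algC -> Prop) : Prop :=
  (forall x, I x -> OL c x) /\ I 0 /\
  (forall x y, I x -> I y -> I (x + y)) /\
  (forall a x, OL c a -> I x -> I (a * x)).

Definition prime_ideal (c : int) (P : algC -> Prop) : Prop :=
  is_ideal c P /\ ~ P 1 /\
  (forall a b, OL c a -> OL c b -> P (a * b) -> P a \/ P b).

Definition prime_above2 (c : int) (P : algC -> Prop) : Prop :=
  prime_ideal c P /\ P 2.

Definition idprod (I J : algC -> Prop) (x : algC) : Prop :=
  exists n (a b : 'I_n -> algC),
    (forall i, I (a i) /\ J (b i)) /\ x = \sum_(i < n) a i * b i.

Fixpoint idpow (c : int) (P : algC -> Prop) (n : nat) : algC -> Prop :=
  match n with
  | 0 => OL c
  | n'.+1 => idprod (idpow c P n') P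
  end.

Definition ram_index (c : int) (P : algC -> Prop) (e : nat) : Prop :=
  idpow c P e 2 /\ ~ idpow c P e.+1 2.

(* residue degree: O_L/P has an F_2-basis of size f
   (O_L/P is an F_2-vector space since 2 \in P) *)
Definition res_degree (c : int) (P : algC -> Prop) (f : nat) : Prop :=
  exists b : 'I_f -> algC,
    (forall i, OL c (b i)) /\
    (forall eps : 'I_f -> bool,
        P (\sum_(i < f) (eps i)%:R * b i) -> forall i, eps i = false) /\
    (forall x, OL c x -> exists eps : 'I_f -> bool,
        P (x - \sum_(i < f) (eps i)%:R * b i)).

Definition decomp2 (c : int) (e f g : nat) : Prop :=
  exists Ps : 'I_g -> (algC -> Prop),
    (forall i, prime_above2 c (Ps i)) /\
    (forall i j, (forall x, Ps i x <-> Ps j x) -> i = j) /\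
    (forall P, prime_above2 c P -> exists i, forall x, P x <-> Ps i x) /\
    (forall i, ram_index c (Ps i) e /\ res_degree c (Ps i) f).

(* Main.v *)
(** Put a = - c.  Then L_c = Q(s, t, al) with s^2 = a, t^2 = a - 1 and al^2 = s (s + 1), a tower of
    three quadratic extensions of Q.  The primes of O_L above 2 are the centers of the valuations
    of algC extending the 2-adic one; these exist by Chevalley's maximality argument and, at each
    step K < K(theta), an extension of v to K(theta) is unique up to conjugation.  So each step is
    of exactly one of three kinds: ramified (a new value appears), inert (a root of w^2 + w + 1
    appears in the residue field) or split (v differs from its conjugate), and it doubles e, f or g
    respectively.  The kind is read off v (d - q^2) - 2 v q for a sufficiently good approximation q
    of theta = sqrt d in K: the step is split if this is > 2, inert if it is 2 and K has residue
    field F_2, and ramified if its half is not a value of K.  The classes of c in the statement are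
    treated one by one with an explicit q at each step; since they exhaust all c and (e, f, g) is
    unique, each implication is an equivalence. *)
From HB Require Import structures.
Require Import Defs.
From mathcomp Require Import all_boot all_order all_algebra all_field.
From mathcomp Require Import boolp classical_sets.
From mathcomp Require Import zify ring lra.
Set Implicit Arguments. Unset Strict Implicit. Unset Printing Implicit Defensive.
Import Order.TTheory GRing.Theory Num.Theory.
Local Open Scope ring_scope.

(** Valuations are functions on all of [algC] with rational values. Rational values suffice because
    every nonzero element is algebraic over the rationals, so that some positive power of it is a
    unit times a power of 2; the normalisation [v 2 = 1] then turns equivalence of extensions into
    equality. Working on all of [algC] lets conjugations act by composition, and the type of a field
    in the tower is stated for every valuation at once, so that it passes up the tower without a
    prime ever being chosen. The obstacle is the third radicand [s (s + 1)]. When the first step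
    splits, [s] is 2-adically close to an integer, but whether [s] or [- s] is close to a given one
    depends on the valuation. The product of [s (s + 1)] with its conjugate [- s (- s + 1)] is
    [(s t)^2], so both have the same square class over [Q(s, t)] and the sign may be fixed
    separately for each valuation. When the first two steps both ramify, integers, [s] and [t] are
    too coarse as approximations; there the error [z = t - u] of the second step, of value 3/4,
    serves as the approximation in the third. *)

(** * Valuations above 2 and subrings of [algC] *)

Record valuation (v : algC -> rat) : Prop := Valuation {
  valM : forall x y, x != 0 -> y != 0 -> v (x * y) = v x + v y;
  valD_ge : forall x y r, x != 0 -> y != 0 -> x + y != 0 ->
    r <= v x -> r <= v y -> r <= v (x + y);
  val2 : v 2 = 1 }.

Definition subringP (S : algC -> Prop) : Prop :=
  S 1 /\ (forall x y, S x -> S y -> S (x - y)) /\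
  (forall x y, S x -> S y -> S (x * y)).

Section Subring.
Variables (S : algC -> Prop) (ringS : subringP S).

Lemma subring1 : S 1. Proof. by case: ringS. Qed.
Lemma subringB x y : S x -> S y -> S (x - y).
Proof. by case: ringS => _ []; auto. Qed.
Lemma subringM x y : S x -> S y -> S (x * y).
Proof. by case: ringS => _ []; auto. Qed.
Lemma subring0 : S 0.
Proof. by rewrite -(subrr 1); apply: subringB; exact: subring1. Qed.
Lemma subringN x : S x -> S (- x).
Proof. by rewrite -sub0r; apply: subringB; exact: subring0. Qed.
Lemma subringD x y : S x -> S y -> S (x + y).
Proof. by move=> Sx Sy; rewrite -[y]opprK; apply/subringB/subringN. Qed.
Lemma subringX x n : S x -> S (x ^+ n).
Proof.
by move=> Sx; elim: n => [|n IHn]; rewrite ?expr0 ?exprS; [exact: subring1|exact: subringM].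
Qed.
Lemma subring_nat n : S n%:R.
Proof.
elim: n => [|n IHn]; first exact: subring0.
by rewrite mulrS; apply: subringD => //; exact: subring1.
Qed.
Lemma subring_int (n : int) : S n%:~R.
Proof. by case: n => n; rewrite ?NegzE ?mulrNz; [|apply: subringN]; exact: subring_nat. Qed.
Lemma subring_sum (I : finType) (P : pred I) (F : I -> algC) :
  (forall i, P i -> S (F i)) -> S (\sum_(i | P i) F i).
Proof. by move=> SF; apply: big_ind => //; [exact: subring0|exact: subringD]. Qed.
Lemma subring_horner (p : {poly algC}) x : (forall i, S p`_i) -> S x -> S p.[x].
Proof.
move=> Sp Sx; rewrite horner_coef; apply: subring_sum => i _.
by apply: subringM => //; apply: subringX.
Qed.
End Subring.

Lemma subfield_subring S : subfieldP S -> subringP S.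
Proof. by case=> S1 [SB [SM _]]. Qed.

(** * Chevalley's theorem *)

Section Chevalley.

(** Maximality under the single constraint that 2 stays a nonunit replaces maximality for domination
    of local rings. *)
Definition maximal_avoiding_half (V : algC -> Prop) :=
  [/\ subringP V, ~ V 2^-1 &
    forall S, subringP S -> (forall x, V x -> S x) -> ~ S 2^-1 -> forall x, S x -> V x].

Lemma exists_maximal_avoiding_half (R : algC -> Prop) :
  subringP R -> ~ R 2^-1 ->
  exists V, maximal_avoiding_half V /\ forall x, R x -> V x.
Proof.
move=> ringR Rn2.
pose P (S : set algC) := S = set0 \/ [/\ subringP S, (R `<=` S)%classic & ~ S 2^-1].
have [] := @Zorn_bigcup algC P.
  move=> F FP Ftot.
  have [[S [FS S0]]|Fempty] := pselect (exists S, F S /\ S <> set0); last first.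
    left; apply/seteqP; split=> // x [S FS Sx]; case: Fempty; exists S; split=> //.
    by move=> S0; rewrite S0 in Sx.
  right; have bigS X x y : F X -> X x -> X y -> [/\ subringP X, (R `<=` X)%classic & ~ X 2^-1].
    by move=> FX Xx _; case: (FP _ FX) => // X0; rewrite X0 in Xx.
  have pair x y : (\bigcup_(X in F) X)%classic x -> (\bigcup_(X in F) X)%classic y ->
      exists X, [/\ F X, X x & X y].
    move=> [X FX Xx] [Y FY Yy]; case: (Ftot _ _ FX FY) => sub.
      by exists Y; split=> //; apply: sub.
    by exists X; split=> //; apply: sub.
  have [//|[ringS RS _]] := FP _ FS.
  split; last by move=> [X FX X2]; case: (bigS X _ _ FX X2 X2).
    split; first by exists S => //; by apply: subring1.
    split=> x y Ux Uy; case: (pair x y Ux Uy) => X [FX Xx Xy]; exists X => //;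
    case: (bigS _ _ _ FX Xx Xy) => ringX _ _; [by apply: subringB|by apply: subringM].
  by move=> x Rx; exists S => //; apply: RS.
move=> V [[V0|[ringV RV Vn2]] maxV].
  case: (maxV R); last by right; split.
  split; first by rewrite V0; exact: sub0set.
  by move=> /(_ 1 (subring1 ringR)); rewrite V0.
exists V; split=> //; split=> // S ringS VS Sn2 x Sx; apply: contrapT => Vnx.
case: (maxV S); last by right; split=> // y Ry; apply/VS/RV.
by split=> // sub; apply/Vnx/sub.
Qed.

Section ValuationRing.
Variables (V : algC -> Prop) (maxV : maximal_avoiding_half V).

Let ringV : subringP V. Proof. by case: maxV. Qed.
Let Vn2 : ~ V 2^-1. Proof. by case: maxV. Qed.

Lemma V_1B2_neq0 b : V b -> 1 - 2 * b != 0.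
Proof.
move=> Vb; rewrite subr_eq0; apply/eqP => b2; apply: Vn2.
by have -> : 2^-1 = b by rewrite -[b](mulKf (_ : 2 != 0)) ?pnatr_eq0 // -b2 mulr1.
Qed.

(** Adjoining the inverse of [u] keeps the ring free of 1/2, because every [u ^+ k] is again of the
    form [1 - 2 b']: if [u ^+ k / 2] were in [V], so would be [1/2 = u ^+ k / 2 + b']. Maximality
    then puts the inverse into [V]. *)
Lemma V_unit_1B2 b : V b -> V (1 - 2 * b)^-1.
Proof.
move=> Vb; set u := 1 - 2 * b.
have ukE k : exists b', V b' /\ u ^+ k = 1 - 2 * b'.
  elim: k => [|k [b' [Vb' uk]]]; first by exists 0; split; [by apply: subring0|rewrite expr0; ring].
  exists (b' + b - 2 * b * b'); split; last by rewrite exprS uk /u; ring.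
  by do ?[apply: subringB|apply: subringD|apply: subringM] => //; by apply: subring1.
have Vu : V u.
  apply: subringB => //; first by apply: subring1.
  by apply: subringM => //; apply: subring_nat.
case: maxV => _ _ /(_ (fun y => exists k, V (y * u ^+ k))); apply.
- split; first by exists 0; rewrite mul1r; by apply: subring1.
  split=> x y [k Vx] [l Vy]; exists (k + l)%N; rewrite exprD.
    have -> : (x - y) * (u ^+ k * u ^+ l) = (x * u ^+ k) * u ^+ l - (y * u ^+ l) * u ^+ k by ring.
    by apply: subringB => //; apply: subringM => //; apply: subringX.
  have -> : (x * y) * (u ^+ k * u ^+ l) = (x * u ^+ k) * (y * u ^+ l) by ring.
  by apply: subringM.
- by move=> x Vx; exists 0; rewrite mulr1.
- move=> [k]; have [b' [Vb' ->]] := ukE k => V2; apply: Vn2.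
  have -> : (2^-1 : algC) = 2^-1 * (1 - 2 * b') + b' by field.
  by apply: subringD.
- by exists 1; rewrite expr1 mulVf ?V_1B2_neq0 //; by apply: subring1.
Qed.

Let low n x y := exists a : nat -> algC,
  (forall i, V (a i)) /\ y = \sum_(i < n) 2 * a i * x ^+ i.

Let lowD n x y z : low n x y -> low n x z -> low n x (y + z).
Proof.
move=> [a [Va ->]] [b [Vb ->]]; exists (fun i => a i + b i); split=> [i|]; first by apply: subringD.
by rewrite -big_split; apply: eq_bigr => i _ /=; ring.
Qed.

Let lowZ n x y c : V c -> low n x y -> low n x (c * y).
Proof.
move=> Vc [a [Va ->]]; exists (fun i => c * a i); split=> [i|]; first by apply: subringM.
by rewrite mulr_sumr; apply: eq_bigr => i _ /=; ring.
Qed.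

Let low_exp n x c j : (j < n)%N -> V c -> low n x (2 * c * x ^+ j).
Proof.
move=> jn Vc; exists (fun i => if i == j then c else 0); split.
  by move=> i; case: ifP => _ //; by apply: subring0.
rewrite (bigD1 (Ordinal jn)) //= eqxx big1 ?addr0 // => i /negPf ij.
by rewrite -val_eqE /= in ij; rewrite ij mulr0 mul0r.
Qed.

(* Two shortest relations [1 = \sum 2 a_i x^i] and [1 = \sum 2 r_j x^-j]: the longer one can be shortened. *)
Let low_incompat N n m x : (n + m <= N)%N -> x != 0 -> low n x 1 -> low m x^-1 1 -> False.
Proof.
have low0 y : ~ low 0 y 1 by move=> [a [_ /eqP]]; rewrite big_ord0 oner_eq0.
elim: N n m x => [|N IHN] n m x; first by case: n => // _ _ /low0.
wlog le_mn : n m x / (m <= n)%N.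
  move=> wlg nm x0 rn rm; case: (leqP m n) => mn; first by apply: (wlg n m x).
  by apply: (wlg m n x^-1) => //; rewrite ?invr_eq0 ?invrK 1?addnC // ltnW.
case: n m le_mn => [|n] [|m] // le_mn nm x0; try by [move=> /low0|move=> _ /low0].
move=> [a [Va aE]] lowr; have [r [Vr rE]] := lowr.
(* Moving the constant term of the relation for [x^-1] to the left and multiplying by [x ^+ n / u]
   expresses [x ^+ n] through lower powers of [x]; substituting this into the relation for [x]
   removes its top term. *)
set u := 1 - 2 * r 0%N; have Vu : V u^-1 by apply: V_unit_1B2.
have u0 : u != 0 by apply: V_1B2_neq0.
have lowxn : low n x (x ^+ n).
  rewrite -(mulKf u0 (x ^+ n)); apply: lowZ => //.
  have -> : u = \sum_(j < m) 2 * r j.+1 * x^-1 ^+ j.+1.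
    rewrite /u; apply/eqP; rewrite subr_eq; apply/eqP; apply: (etrans rE); rewrite big_ord_recl /= expr0 mulr1 addrC; congr (_ + _).
  rewrite mulr_suml; apply: big_ind => [||j _]; last 1 first.
  - have jn : (j < n)%N by apply: leq_trans (ltn_ord j) _.
    have -> : 2 * r j.+1 * x^-1 ^+ j.+1 * x ^+ n = 2 * r j.+1 * x ^+ (n - j.+1).
      by rewrite -mulrA exprVn [_^-1 * _]mulrC expfB_cond // (negPf x0) add0n.
    by apply: low_exp => //; lia.
  - exists (fun=> 0); split=> [_|]; first by apply: subring0.
    by rewrite big1 // => i _; rewrite mulr0 mul0r.
  - by move=> y z; exact: lowD.
apply: (IHN n m.+1 x) => //.
rewrite aE big_ord_recr /=; apply: lowD; first by exists a.
by apply: lowZ => //; apply: subringM => //; by apply: subring_nat.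
Qed.

(** If [y] is not in [V], then [V[y]] contains 1/2 by maximality, that is [1 = 2 p(y)] with [p] over
    [V]. Such relations for both [x] and [x^-1] are incompatible. *)
Lemma valuation_ring x : V x \/ V x^-1.
Proof.
have [->|x0] := eqVneq x 0; first by left; by apply: subring0.
apply: contrapT => /not_orP[Vnx Vnxi].
have short y : ~ V y -> exists n, low n y 1.
  move=> Vny; apply: contrapT => nlow; apply: Vny.
  case: maxV => _ _ /(_ (fun z => exists p : {poly algC}, (forall i, V p`_i) /\ z = p.[y])); apply.
  - split; first by exists 1; split=> [i|]; rewrite ?hornerC // coefC;
      case: ifP => _; [by apply: subring1|by apply: subring0].
    split=> _ _ [p [Vp ->]] [q [Vq ->]].
      by exists (p - q); split=> [i|]; rewrite ?hornerD ?hornerN // coefB; by apply: subringB.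
    exists (p * q); split=> [i|]; rewrite ?hornerM // coefM.
    by apply: subring_sum => // j _; apply: subringM.
  - move=> z Vz; exists z%:P; split=> [i|]; rewrite ?hornerC // coefC.
    by case: ifP => _ //; by apply: subring0.
  - move=> [p [Vp pE]]; apply: nlow; exists (size p), (fun i => p`_i); split=> //.
    have E1 : 1 = 2 * p.[y] by rewrite -pE mulfV // pnatr_eq0.
    apply: (etrans E1); rewrite horner_coef mulr_sumr; apply: eq_bigr => i _; by rewrite mulrA.
  - exists 'X; split=> [i|]; rewrite ?hornerX // coefX.
    by apply: subring_nat.
have [n lown] := short _ Vnx; have [m lowm] := short _ Vnxi.
exact: (low_incompat (leqnn (n + m))) lown lowm.
Qed.

End ValuationRing.
End Chevalley.

(** * The rational valuation attached to a maximal subring *)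

(** The primitive part of an integer multiple of the minimal polynomial works: its content is 1, so
    its coefficients are not all even. *)
Lemma exists_primitive_int_poly (x : algC) :
  exists p : {poly int}, \sum_(i < size p) (p`_i)%:~R * x ^+ i = 0 /\
    exists i : 'I_(size p), ~~ (2 %| p`_i)%Z.
Proof.
have [p [pE mon_p] _] := minCpolyP x; have px : root (map_poly ratr p) x by rewrite -pE root_minCpoly.
have [q [a a0 qE]] := rat_poly_scale p.
have q0 : q != 0.
  by apply: contraTneq mon_p => q0; rewrite qE q0 map_poly0 scaler0 monicE lead_coef0 eq_sym oner_eq0.
exists (zprimitive q); split.
  have rx : root (map_poly intr (zprimitive q)) x.
    move: px; rewrite qE -mul_polyC rmorphM rootM /= map_polyC /= rootC fmorph_eq0 invr_eq0 intr_eq0 (negPf a0) /=.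
    rewrite -map_poly_comp /= (eq_map_poly (fun z : int => rmorph_int (@ratr algC) z)).
    by rewrite {1}[q]zpolyEprim -mul_polyC rmorphM rootM /= map_polyC /= rootC intr_eq0 zcontents_eq0 (negPf q0).
  move: rx; rewrite /root horner_coef size_map_poly_id0 ?intr_eq0 ?lead_coef_eq0 ?zprimitive_eq0 // => /eqP rx.
  by rewrite -[RHS]rx; apply: eq_bigr => i _; rewrite coef_map.
apply: contrapT => neven.
have : (2 %| zcontents (zprimitive q))%Z.
  rewrite dvdz_contents; apply/polyOverP => i.
  have [ip|ip] := ltnP i (size (zprimitive q)); last by rewrite nth_default ?dvdz0.
  by apply/negPn/negP => odd_i; apply: neven; exists (Ordinal ip).
by rewrite zcontents_primitive q0.
Qed.

Section ValuationOfRing.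
Variables (V : algC -> Prop) (maxV : maximal_avoiding_half V).

Let ringV : subringP V. Proof. by case: maxV. Qed.
Let Vn2 : ~ V 2^-1. Proof. by case: maxV. Qed.

Let unitV x := V x /\ V x^-1.

Let unitVM x y : unitV x -> unitV y -> unitV (x * y).
Proof. by move=> [? ?] [? ?]; split; rewrite ?invfM; apply: subringM. Qed.

Let unitVV x : unitV x -> unitV x^-1.
Proof. by move=> [? ?]; split; rewrite ?invrK. Qed.

Let unitVX x n : unitV x -> unitV (x ^+ n).
Proof. by move=> [? ?]; split; rewrite -?exprVn; apply: subringX. Qed.

Let unitV_odd (m : int) : ~~ (2 %| m)%Z -> unitV m%:~R.
Proof.
move=> odd_m; split; first by apply: subring_int.
have -> : m = 1 - 2 * - (m %/ 2)%Z by lia.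
rewrite intrB intrM; apply: (V_unit_1B2 maxV); by apply: subring_int.
Qed.

Let unitV_2X (i : int) : unitV (2 ^ i) -> i = 0.
Proof.
case: i => [[|n]|n] //; rewrite /unitV /exprz ?invrK; move=> [Vp Vi]; case: Vn2.
  have -> : 2^-1 = 2 ^+ n * (2 ^+ n.+1)^-1 :> algC.
    by rewrite exprSr invfM mulVKf // expf_neq0 ?pnatr_eq0.
  by apply: subringM => //; apply: subringX => //; apply: subring_nat.
have -> : 2^-1 = 2 ^+ n * (2 ^+ n.+1)^-1 :> algC.
  by rewrite exprSr invfM mulVKf // expf_neq0 ?pnatr_eq0.
by apply: subringM => //; apply: subringX => //; apply: subring_nat.
Qed.

Let int_2part (m : int) : m != 0 -> exists i : nat, unitV (m%:~R * 2 ^ (- i%:Z)).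
Proof.
elim/ltn_ind: {m}`|m|%N {-2}m (erefl `|m|%N) => n IHn m mn m0.
have [m2|/unitV_odd um] := boolP (2 %| m)%Z; last first.
  by exists 0%N; rewrite oppr0 expr0z mulr1.
have [q mE] : exists q, m = q * 2 by exists (m %/ 2)%Z; lia.
have [i ui] : exists i : nat, unitV (q%:~R * 2 ^ (- i%:Z)).
  by apply: (IHn `|q|%N) => //; lia.
rewrite mE.
exists i.+1; rewrite intrM (_ : - (i.+1)%:Z = - i%:Z - 1); last by lia.
rewrite expfzDr ?pnatr_eq0 // [2 ^ -1]/exprz.
rewrite mulrACA; apply: unitVM => //; rewrite mulfV ?pnatr_eq0 //.
by split; rewrite ?invr1; apply: subring1.
Qed.

Let tot x := valuation_ring maxV x.

(** The maximal ideal as the set of nonunits; zero is listed apart because [0^-1 = 0] lies in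
    [V]. *)
Let maxid x := x = 0 \/ V x /\ ~ V x^-1.
Let maxidD x y : maxid x -> maxid y -> maxid (x + y).
Proof.
move=> [->|]; first by rewrite add0r.
move=> Mx [->|My]; first by rewrite addr0; right.
have [->|xy0] := eqVneq (x + y) 0; [by left|right].
split; first by apply: subringD; case: Mx; case: My.
wlog Vyx : x y Mx My xy0 / V (x / y).
  move=> wlg; case: (tot (x / y)) => [|Vxy]; first exact: wlg.
  by rewrite addrC; apply: wlg; rewrite 1?addrC // -invf_div.
have y0 : y != 0 by apply/eqP => y0; case: My; rewrite y0 invr0 => _; apply; apply: subring0.
move=> Vi; case: My => _; apply.
have -> : y^-1 = (x / y + 1) * (x + y)^-1.
  by field; rewrite xy0 y0.
by apply: subringM => //; apply: subringD => //; apply: subring1.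
Qed.

(** Divisibility in a valuation ring is total, so a finite family has a member of least value. *)
Let exists_dividing_all n (F : 'I_n -> algC) : (exists i, F i != 0) ->
  exists j, F j != 0 /\ forall i, V (F i / F j).
Proof.
move=> [i0 Fi0].
suff H (s : seq 'I_n) : exists j, F j != 0 /\ forall i, i \in s -> V (F i / F j).
  have [j [Fj H']] := H (enum 'I_n); exists j; split=> // i.
  by apply: H'; rewrite mem_enum.
elim: s => [|i s [j [Fj IHs]]]; first by exists i0.
have [Fi|Fi] := eqVneq (F i) 0.
  exists j; split=> // k; rewrite inE => /orP[/eqP->|/IHs//].
  by rewrite Fi mul0r; apply: subring0.
case: (tot (F i / F j)); rewrite ?invf_div => Vji.
  by exists j; split=> // k; rewrite inE => /orP[/eqP->|/IHs].
exists i; split=> // k; rewrite inE => /orP[/eqP->|/IHs Vkj].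
  by rewrite mulfV //; apply: subring1.
have -> : F k / F i = (F k / F j) * (F j / F i) by rewrite mulrA divfK.
by apply: subringM => //; apply: Vkj.
Qed.

(** In a vanishing sum of terms [a_i x^i] the least value is attained at two indices [i < j];
    otherwise, after division by the least term, -1 would be a sum of nonunits. Comparing these two
    terms makes [x ^+ (j - i)] a unit times a power of 2, the integers [a_i] and [a_j] being units
    times powers of 2. *)
Let exists_exponent x : x != 0 -> exists (k : nat) (i : int), (0 < k)%N /\ unitV (x ^+ k * 2 ^ (- i)).
Proof.
move=> x0; have [p [aE a0]] := exists_primitive_int_poly x.
set n := size p in aE a0; pose a i := p`_i.
pose F (i : 'I_n) := (a i)%:~R * x ^+ i.
have F_eq0 i : (F i == 0) = (a i == 0).
  by rewrite mulf_eq0 intr_eq0 expf_eq0 (negPf x0) andbF orbF.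
have [|j [Fj Vj]] := @exists_dividing_all _ F.
  by case: a0 => i ai; exists i; rewrite F_eq0; apply: contraNneq ai; rewrite /a => ->; rewrite dvdz0.
have [i [ij Fi Vji]] : exists i, [/\ i != j, F i != 0 & V (F j / F i)].
  apply: contrapT => nex.
  have : maxid (-1).
    have -> : -1 = \sum_(i < n | i != j) F i / F j.
      apply: (mulIf Fj); rewrite -mulr_suml divfK // mulN1r.
      have : \sum_i F i = 0 by [].
      by rewrite (bigD1 j) //= addrC => /eqP; rewrite addr_eq0 => /eqP ->.
    apply: big_ind => [||i ij]; [by left|exact: maxidD|].
    have [Fi|Fi] := eqVneq (F i) 0; first by left; rewrite Fi mul0r.
    by right; split=> //; rewrite invf_div => Vji; apply: nex; exists i.
  case=> [/eqP|[]]; first by rewrite oppr_eq0 oner_eq0.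
  by rewrite invrN invr1.
have uij : unitV (F i / F j) by split; rewrite ?invf_div.
have ai : a i != 0 by rewrite -F_eq0.
have aj : a j != 0 by rewrite -F_eq0.
clear Vji Vj Fi Fj; wlog lt_ij : i j ij ai aj uij / (i < j)%N.
  move=> wlg; case: (ltngtP i j) => [|ji|/val_inj/eqP]; last by rewrite (negPf ij).
    exact: (wlg i j).
  by apply: (wlg j i) => //; rewrite 1?eq_sym // -invf_div; apply: unitVV.
have [k uk] := int_2part ai; have [l ul] := int_2part aj.
exists (j - i)%N, (k%:Z - l%:Z); split; first by rewrite subn_gt0.
have -> : x ^+ (j - i) * 2 ^ (- (k%:Z - l%:Z)) =
  (F i / F j)^-1 * (((a i)%:~R * 2 ^ (- k%:Z)) * ((a j)%:~R * 2 ^ (- l%:Z))^-1).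
  rewrite opprB expfzDr ?pnatr_eq0 // -(invr_expz 2 l%:Z) invfM invrK /F.
  have -> : x ^+ j = x ^+ (j - i) * x ^+ i by rewrite -exprD subnK // ltnW.
  have xi : x ^+ i != 0 by rewrite expf_neq0.
  field; by rewrite xi !intr_eq0 ai aj expf_neq0 ?pnatr_eq0.
by apply: unitVM; [apply: unitVV|apply: unitVM => //; apply: unitVV].
Qed.

Let pow2M (i : int) (n : nat) : (2 ^ i) ^+ n = 2 ^ (i * n%:Z) :> algC.
Proof. by rewrite exprnP exprz_exp. Qed.

Let val_spec x r := x <> 0 -> exists (k : nat) (i : int),
  [/\ (0 < k)%N, unitV (x ^+ k * 2 ^ (- i)) & r = i%:~R / k%:R :> rat].

Let val_exists x : exists r, val_spec x r.
Proof.
have [->|x0] := eqVneq x 0; first by exists 0.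
by have [k [i [k0 u]]] := exists_exponent x0; exists (i%:~R / k%:R) => _; exists k, i.
Qed.

Let v x := sval (cid (val_exists x)).

(** The value does not depend on the chosen exponent: two choices differ by a power of 2 that is a
    unit, hence by [2 ^ 0]. *)
Let v_unit x (k : nat) (i : int) : x != 0 -> (0 < k)%N ->
  unitV (x ^+ k * 2 ^ (- i)) -> v x = i%:~R / k%:R.
Proof.
move=> x0 k0 ui; rewrite /v; case: cid => r /= /(_ (elimN eqP x0))[l [j [l0 uj ->]]].
have /unitV_2X : unitV (2 ^ (j * k%:Z - i * l%:Z)).
  have -> : 2 ^ (j * k%:Z - i * l%:Z) = (x ^+ k * 2 ^ (- i)) ^+ l * ((x ^+ l * 2 ^ (- j)) ^+ k)^-1 :> algC.
    rewrite !exprMn -!exprM mulnC invfM mulrACA mulfV ?expf_neq0 // mul1r.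
    rewrite !pow2M invr_expz -expfzDr ?pnatr_eq0 //; congr (_ ^ _); ring.
  by apply: unitVM; [apply: unitVX|apply/unitVV/unitVX].
move=> /eqP; rewrite subr_eq0 => /eqP /(congr1 (fun z : int => z%:~R : rat)).
by rewrite !intrM => jk; apply/eqP; rewrite eqr_div ?pnatr_eq0 -?lt0n //; apply/eqP.
Qed.

Let v_exists x : x != 0 -> exists (k : nat) (i : int),
  [/\ (0 < k)%N, unitV (x ^+ k * 2 ^ (- i)) & v x = i%:~R / k%:R :> rat].
Proof.
move=> x0; have [k [i [k0 u]]] := exists_exponent x0; exists k, i; split=> //.
exact: v_unit.
Qed.

Let vM x y : x != 0 -> y != 0 -> v (x * y) = v x + v y.
Proof.
move=> x0 y0; have [k [i [k0 ui ->]]] := v_exists x0; have [l [j [l0 uj ->]]] := v_exists y0.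
rewrite (@v_unit _ (k * l) (i * l%:Z + j * k%:Z)) ?mulf_neq0 ?muln_gt0 ?k0 //.
  rewrite natrM intrD !intrM; field; by rewrite !pnatr_eq0 -!lt0n k0 l0.
have -> : (x * y) ^+ (k * l) * 2 ^ (- (i * l%:Z + j * k%:Z)) =
  (x ^+ k * 2 ^ (- i)) ^+ l * (y ^+ l * 2 ^ (- j)) ^+ k.
  rewrite !exprMn -!exprM [(l * k)%N]mulnC mulrACA !pow2M -expfzDr ?pnatr_eq0 //.
  by congr (_ * _ ^ _); ring.
by apply: unitVM; apply: unitVX.
Qed.

Let v_ge0 x : x != 0 -> (0 <= v x) <-> V x.
Proof.
move=> x0; have [k [i [k0 ui ->]]] := v_exists x0.
have xiE : x ^+ k = (x ^+ k * 2 ^ (- i)) * 2 ^ i by rewrite -invr_expz mulfVK // expfz_neq0 ?pnatr_eq0.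
rewrite pmulr_lge0 ?invr_gt0 ?ltr0n // ler0z; split=> [i0|Vx].
  case: (tot x) => // Vi.
  (* A valuation ring is integrally closed: when [x^-1] is in [V], so is [x], because [x ^+ k]
     is. *)
  have -> : x = x ^+ k * x^-1 ^+ k.-1.
    by case: k k0 {ui xiE} => // k _; rewrite exprVn exprS mulfK ?expf_neq0.
  apply: subringM => //; last by apply: subringX.
  rewrite xiE; apply: subringM => //; first by case: ui.
  by case: i i0 {ui xiE} => // n _; apply: subringX => //; apply: subring_nat.
rewrite leNgt; apply/negP => i0; case: Vn2.
have : V (2 ^ i).
  have -> : 2 ^ i = (x ^+ k * 2 ^ (- i))^-1 * x ^+ k.
    by rewrite invfM mulrAC mulVf ?expf_neq0 // mul1r -invr_expz invrK.
  by apply: subringM => //; [case: ui|apply: subringX].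
case: i i0 {ui xiE} => // n _; rewrite /exprz => V2.
have -> : 2^-1 = 2 ^+ n * (2 ^+ n.+1)^-1 :> algC.
  by rewrite exprSr invfM mulVKf // expf_neq0 ?pnatr_eq0.
by apply: subringM => //; apply: subringX => //; apply: subring_nat.
Qed.

Lemma valuation_of_ring : exists w, valuation w /\ forall x, V x <-> (x = 0 \/ 0 <= w x).
Proof.
exists v; split; last first.
  move=> x; split=> [Vx|[->|]]; last 1 first.
  - have [->|x0] := eqVneq x 0; [by move=> _; apply: subring0|by move/(v_ge0 x0)].
  - by have [->|x0] := eqVneq x 0; [left|right; apply/v_ge0].
  - by apply: subring0.
split=> //.
  move=> x y r x0 y0; wlog le_xy : x y x0 y0 / v x <= v y.
    move=> wlg xy0 rx ry; case: (leP (v x) (v y)) => [|/ltW] le_; first exact: wlg.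
    by rewrite addrC; apply: wlg => //; rewrite addrC.
  move=> xy0 rx _; apply: le_trans rx _.
  have vyx : v (y / x) = v y - v x.
    by have := @vM (y / x) x; rewrite divfK // => ->; rewrite ?addrK // mulf_neq0 ?invr_eq0.
  have Vyx : V (1 + y / x).
    apply: subringD => //; first by apply: subring1.
    by apply/v_ge0; rewrite ?mulf_neq0 ?invr_eq0 // vyx subr_ge0.
  have xyE : x + y = (1 + y / x) * x by rewrite mulrDl mul1r divfK.
  have z0 : 1 + y / x != 0 by apply: contraNneq xy0 => z0; rewrite xyE z0 mul0r.
  by rewrite xyE vM // lerDr; apply/v_ge0.
rewrite (@v_unit _ 1 1) ?pnatr_eq0 //.
by rewrite expr1 /exprz mulfV ?pnatr_eq0 //; split; rewrite ?invr1; apply: subring1.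
Qed.

End ValuationOfRing.

Lemma exists_valuation_dominating (R : algC -> Prop) :
  subringP R -> ~ R 2^-1 ->
  exists v, valuation v /\ forall x, R x -> x = 0 \/ 0 <= v x.
Proof.
move=> ringR Rn2; have [V [maxV RV]] := exists_maximal_avoiding_half ringR Rn2.
have [v [vv vV]] := valuation_of_ring maxV; exists v; split=> // x Rx.
by apply/vV/RV.
Qed.

(** * Calculus of valuations *)

(* [v 0] is a junk value, so valuation inequalities go through these three predicates. *)
Definition vge (v : algC -> rat) r x := (x == 0) || (r <= v x).
Definition vgt (v : algC -> rat) r x := (x == 0) || (r < v x).
Definition veq (v : algC -> rat) r x := (x != 0) && (v x == r).

Section ValuationCalculus.
Variables (v : algC -> rat) (vv : valuation v).

Lemma val1 : v 1 = 0.
Proof. by have := valM vv (oner_neq0 _) (oner_neq0 _); rewrite mulr1; lra. Qed.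

Lemma valN x : v (- x) = v x.
Proof.
have [->|x0] := eqVneq x 0; first by rewrite oppr0.
have n1 : -1 != 0 :> algC by rewrite oppr_eq0 oner_eq0.
have := valM vv n1 n1; rewrite mulrNN mulr1 val1 => n1E.
rewrite -mulN1r (valM vv) //; lra.
Qed.

Lemma valV x : x != 0 -> v x^-1 = - v x.
Proof. by move=> x0; have := @valM _ vv x x^-1; rewrite mulfV // val1 invr_eq0 x0 => /(_ isT isT); lra. Qed.

Lemma vge0 r : vge v r 0. Proof. by rewrite /vge eqxx. Qed.
Lemma vgt0 r : vgt v r 0. Proof. by rewrite /vgt eqxx. Qed.

Lemma veqP r x : reflect (x != 0 /\ v x = r) (veq v r x).
Proof. by apply: (iffP andP) => -[? /eqP]. Qed.

Lemma veq_val x : x != 0 -> veq v (v x) x.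
Proof. by move=> x0; apply/veqP. Qed.

Lemma vge_mono r s x : vge v s x -> r <= s -> vge v r x.
Proof. by case/orP=> [/eqP->|sx] rs; [exact: vge0|apply/orP; right; apply: le_trans sx]. Qed.

Lemma vgtW r x : vgt v r x -> vge v r x.
Proof. by case/orP=> [/eqP->|/ltW rx]; [exact: vge0|rewrite /vge rx orbT]. Qed.

Lemma vge_vgt r s x : vge v s x -> r < s -> vgt v r x.
Proof. by case/orP=> [/eqP->|sx] rs; [exact: vgt0|apply/orP; right; apply: lt_le_trans sx]. Qed.

Lemma vgtP r x : vgt v r x <-> exists2 s, vge v s x & r < s.
Proof.
split=> [|[s sx rs]]; last exact: vge_vgt rs.
case/orP=> [/eqP->|rx]; first by exists (r + 1); [exact: vge0|lra].
by exists (v x); rewrite // /vge lexx orbT.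
Qed.

Lemma veq_vge r x : veq v r x -> vge v r x.
Proof. by case/veqP=> _ <-; rewrite /vge lexx orbT. Qed.

Lemma vgeN r x : vge v r (- x) = vge v r x.
Proof. by rewrite /vge oppr_eq0 valN. Qed.

Lemma vgtN r x : vgt v r (- x) = vgt v r x.
Proof. by rewrite /vgt oppr_eq0 valN. Qed.

Lemma veqN r x : veq v r (- x) = veq v r x.
Proof. by rewrite /veq oppr_eq0 valN. Qed.

Lemma vgeD r x y : vge v r x -> vge v r y -> vge v r (x + y).
Proof.
case/orP=> [/eqP->|rx]; first by rewrite add0r.
case/orP=> [/eqP->|ry]; first by rewrite addr0 /vge rx orbT.
have [->|x0] := eqVneq x 0; first by rewrite add0r /vge ry orbT.
have [->|y0] := eqVneq y 0; first by rewrite addr0 /vge rx orbT.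
have [->|xy0] := eqVneq (x + y) 0; first exact: vge0.
by apply/orP; right; apply: (valD_ge vv).
Qed.

Lemma vgeB r x y : vge v r x -> vge v r y -> vge v r (x - y).
Proof. by move=> rx ry; apply: vgeD; rewrite ?vgeN. Qed.

Lemma vgtD r x y : vgt v r x -> vgt v r y -> vgt v r (x + y).
Proof.
move=> /vgtP[s sx rs] /vgtP[t ty rt]; apply/vgtP; exists (Num.min s t); last by rewrite lt_min rs.
by apply: vgeD; [apply: vge_mono sx _|apply: vge_mono ty _]; rewrite ge_min lexx ?orbT.
Qed.

Lemma vgtB r x y : vgt v r x -> vgt v r y -> vgt v r (x - y).
Proof. by move=> rx ry; apply: vgtD; rewrite ?vgtN. Qed.

Lemma vgeM r s x y : vge v r x -> vge v s y -> vge v (r + s) (x * y).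
Proof.
case/orP=> [/eqP->|rx]; first by rewrite mul0r vge0.
case/orP=> [/eqP->|ry]; first by rewrite mulr0 vge0.
have [->|x0] := eqVneq x 0; first by rewrite mul0r vge0.
have [->|y0] := eqVneq y 0; first by rewrite mulr0 vge0.
by apply/orP; right; rewrite (valM vv) // lerD.
Qed.

Lemma vgtM r s x y : vgt v r x -> vge v s y -> vgt v (r + s) (x * y).
Proof.
by move=> /vgtP[t tx rt] sy; apply/vgtP; exists (t + s); [exact: vgeM|lra].
Qed.

Lemma veqM r s x y : veq v r x -> veq v s y -> veq v (r + s) (x * y).
Proof. by move=> /veqP[x0 <-] /veqP[y0 <-]; apply/veqP; rewrite mulf_neq0 // (valM vv). Qed.

Lemma veqV r x : veq v r x -> veq v (- r) x^-1.
Proof. by move=> /veqP[x0 <-]; apply/veqP; rewrite invr_eq0 valV. Qed.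

Lemma veq1 : veq v 0 1. Proof. by apply/veqP; rewrite oner_eq0 val1. Qed.

Lemma veqX r x n : veq v r x -> veq v (r * n%:R) (x ^+ n).
Proof.
move=> rx; elim: n => [|n IHn]; first by rewrite mulr0 expr0 veq1.
by rewrite exprS mulrS mulrDr mulr1; exact: veqM.
Qed.

Lemma vgeX r x n : vge v r x -> vge v (r * n%:R) (x ^+ n).
Proof.
move=> rx; elim: n => [|n IHn]; first by rewrite mulr0 expr0 veq_vge ?veq1.
by rewrite exprS mulrS mulrDr mulr1; exact: vgeM.
Qed.

Lemma veqD r x y : veq v r x -> vgt v r y -> veq v r (x + y).
Proof.
move=> /veqP[x0 rx] ry; have [xy0|xy0] := eqVneq (x + y) 0.
  move: ry; rewrite -(addKr x y) xy0 addr0 vgtN => /orP[|]; first by rewrite (negPf x0).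
  by rewrite rx ltxx.
apply/veqP; split=> //; apply/eqP; rewrite eq_le; apply/andP; split; last first.
  have : vge v r (x + y) by apply: vgeD (vgtW ry); rewrite /vge rx lexx orbT.
  by rewrite /vge (negPf xy0).
rewrite leNgt; apply/negP => rxy; have : vgt v r (x + y - y).
  by apply: vgtB ry; rewrite /vgt rxy orbT.
by rewrite addrK /vgt (negPf x0) rx ltxx.
Qed.

Lemma veq_uniq r s x : veq v r x -> veq v s x -> r = s.
Proof. by move=> /veqP[_ <-] /veqP[_ <-]. Qed.

Lemma veq_nvgt r x : veq v r x -> ~~ vgt v r x.
Proof. by move=> /veqP[x0 <-]; rewrite /vgt (negPf x0) ltxx. Qed.

Lemma vge_cases r x : vge v r x -> veq v r x \/ vgt v r x.
Proof.
rewrite /vge /veq /vgt; case: eqVneq => //= _; first by right.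
by rewrite le_eqVlt eq_sym => /orP.
Qed.

Lemma veq_2 : veq v 1 2. Proof. by apply/veqP; rewrite pnatr_eq0 (val2 vv). Qed.

Lemma vge_nat n : vge v 0 n%:R.
Proof.
elim: n => [|n IHn]; first exact: vge0.
by rewrite mulrS; apply: vgeD IHn; rewrite veq_vge ?veq1.
Qed.

Lemma vge_int (m : int) : vge v 0 m%:~R.
Proof. by case: m => n; rewrite ?NegzE ?mulrNz ?vgeN; exact: vge_nat. Qed.

Lemma veq_odd (m : int) : ~~ (2 %| m)%Z -> veq v 0 m%:~R.
Proof.
move=> odd_m; have -> : m = 1 + 2 * (m %/ 2)%Z by lia.
rewrite intrD intrM; apply: veqD; first exact: veq1.
apply: (@vge_vgt 0 (1 + 0)); last lra.
by apply: vgeM; [exact/veq_vge/veq_2|exact: vge_int].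
Qed.

Lemma vge_dvdz k (m : int) : (2 ^+ k %| m)%Z -> vge v k%:R m%:~R.
Proof.
case/dvdzP=> q ->; rewrite intrM mulrC rmorphXn /=.
apply: vge_mono (vgeM (vgeX k (veq_vge veq_2)) (vge_int q)) _; lra.
Qed.

Lemma vge_divr r s x y : veq v s y -> vge v r x -> vge v (r - s) (x / y).
Proof. by move=> sy rx; apply: vgeM rx _; apply/veq_vge/veqV. Qed.

Lemma veq_sqrt r x : veq v r (x ^+ 2) -> veq v (r / 2) x.
Proof.
move=> /veqP[]; rewrite expf_eq0 /= => x0; rewrite expr2 (valM vv) // => <-.
by apply/veqP; split=> //; lra.
Qed.

End ValuationCalculus.

(** * Quadratic extensions *)

Lemma subfieldV K x : subfieldP K -> K x -> K x^-1.
Proof. by case=> _ [_ [_]]; apply. Qed.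

Lemma subfield_div K x y : subfieldP K -> K x -> K y -> K (x / y).
Proof.
by move=> fK Kx Ky; apply: (subringM (subfield_subring fK)) => //; apply: subfieldV.
Qed.

(** Meant for [theta ^+ 2] in [K], where these sums already form a field. *)
Definition adjoin (K : algC -> Prop) (theta x : algC) : Prop :=
  exists p q, [/\ K p, K q & x = p + q * theta].

Definition agree (K : algC -> Prop) (v w : algC -> rat) : Prop :=
  forall x, K x -> x != 0 -> v x = w x.

Definition residue_basis (K : algC -> Prop) (v : algC -> rat) (f : nat) : Prop :=
  exists b : 'I_f -> algC,
    [/\ forall i, K (b i) /\ vge v 0 (b i),
      forall eps : 'I_f -> bool, vgt v 0 (\sum_i (eps i)%:R * b i) -> forall i, eps i = false &
      forall x, K x -> vge v 0 x -> exists eps : 'I_f -> bool, vgt v 0 (x - \sum_i (eps i)%:R * b i)].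

(** The first two fields say that the value group of [K] is [(1/e) Z]; since [v 2 = 1], this makes
    [e] the ramification index. *)
Record local_type (K : algC -> Prop) (v : algC -> rat) (e f : nat) : Prop := LocalType {
  local_val : forall x, K x -> x != 0 -> exists m : int, v x * e%:R = m%:~R;
  local_unif : exists x, [/\ K x, x != 0 & v x * e%:R = 1];
  local_res : residue_basis K v f }.

(** A place of [K] above 2 is a class of valuations of [algC] under agreement on [K]. Asking for the
    local type at every valuation makes [e] and [f] common to all places, which is the form that
    each quadratic step can inherit. *)
Definition total_type K e f g : Prop :=
  (forall v, valuation v -> local_type K v e f) /\
  exists vs : 'I_g -> (algC -> rat),
    [/\ forall i, valuation (vs i),
      forall i j, agree K (vs i) (vs j) -> i = j &
      forall w, valuation w -> exists i, agree K (vs i) w].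

(** Conjugations are taken as endomorphisms of the whole of [algC], so that composing with one gives
    again a valuation of the same kind. *)
Lemma valuation_comp (v : algC -> rat) (tau : {rmorphism algC -> algC}) :
  valuation v -> valuation (v \o tau).
Proof.
move=> vv; split=> [x y x0 y0|x y r x0 y0 xy0|]; rewrite /= ?rmorph_nat.
- by rewrite rmorphM (valM vv) ?fmorph_eq0.
- by rewrite rmorphD; apply: (valD_ge vv); rewrite -?rmorphD fmorph_eq0.
- exact: val2 vv.
Qed.

Lemma residue_F2 K v : valuation v -> subfieldP K -> residue_basis K v 1 ->
  forall x, K x -> vge v 0 x -> vgt v 0 x \/ vgt v 0 (x - 1).
Proof.
move=> vv fK [b [_ _ bspan]] x Kx x0.
have K1 := subring1 (subfield_subring fK).
have [eps] := bspan _ Kx x0; have [eps1] := bspan _ K1 (veq_vge (veq1 vv)).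
rewrite !big_ord1; case: (eps1 ord0) => /=; last first.
  by rewrite mul0r subr0 => /(negP (veq_nvgt (veq1 vv))).
rewrite mul1r => m1; case: (eps ord0); last by rewrite mul0r subr0; left.
rewrite mul1r => mx; right; have -> : x - 1 = (x - b ord0) - (1 - b ord0) by ring.
exact: vgtB.
Qed.

Section QuadraticStep.
Variables (K : algC -> Prop) (theta : algC) (tau : {rmorphism algC -> algC}).
Hypotheses (fK : subfieldP K) (Kth2 : K (theta ^+ 2)) (th0 : theta != 0).
Hypotheses (tauK : forall x, K x -> tau x = x) (tau_theta : tau theta = - theta).

Let rK := subfield_subring fK.
Let K' := adjoin K theta.

Lemma adjoin_base x : K x -> K' x.
Proof. by move=> Kx; exists x, 0; rewrite mul0r addr0; split=> //; apply: subring0. Qed.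

Lemma adjoin_gen : K' theta.
Proof. by exists 0, 1; rewrite mul1r add0r; split=> //; [apply: subring0|apply: subring1]. Qed.

Lemma adjoin_conj p q : K p -> K q -> tau (p + q * theta) = p - q * theta.
Proof. by move=> Kp Kq; rewrite rmorphD rmorphM (tauK Kp) (tauK Kq) tau_theta mulrN. Qed.

Lemma adjoin_tau x : K' x -> K' (tau x).
Proof.
move=> [p [q [Kp Kq ->]]]; rewrite adjoin_conj //; exists p, (- q).
by split=> //; [apply: subringN|rewrite mulNr].
Qed.

Lemma adjoin_tauK x : K' x -> tau (tau x) = x.
Proof.
by move=> [p [q [Kp Kq ->]]]; rewrite adjoin_conj // -mulNr adjoin_conj ?mulNr ?opprK //; apply: subringN.
Qed.

Lemma adjoin_trace x : K' x -> K (x + tau x).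
Proof.
move=> [p [q [Kp Kq ->]]]; rewrite adjoin_conj //.
by have -> : p + q * theta + (p - q * theta) = p + p; [ring|apply: subringD].
Qed.

Lemma adjoin_norm x : K' x -> K (x * tau x).
Proof.
move=> [p [q [Kp Kq ->]]]; rewrite adjoin_conj //.
have -> : (p + q * theta) * (p - q * theta) = p * p - q * q * theta ^+ 2 by ring.
by apply: subringB => //; repeat (apply: subringM => //).
Qed.

Lemma adjoin_subfield : subfieldP K'.
Proof.
split; first by apply/adjoin_base; apply: subring1.
have K'B x y : K' x -> K' y -> K' (x - y).
  move=> [p [q [Kp Kq ->]]] [p' [q' [Kp' Kq' ->]]]; exists (p - p'), (q - q').
  by split; [apply: subringB|apply: subringB|ring].
have K'M x y : K' x -> K' y -> K' (x * y).
  move=> [p [q [Kp Kq ->]]] [p' [q' [Kp' Kq' ->]]].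
  exists (p * p' + q * q' * theta ^+ 2), (p * q' + q * p').
  by split; [| |ring]; apply: subringD => //; repeat (apply: subringM => //).
split=> //; split=> // x K'x; have [->|x0] := eqVneq x 0.
  by rewrite invr0; apply/adjoin_base; apply: subring0.
have -> : x^-1 = tau x * (x * tau x)^-1 by rewrite invfM mulrCA mulfV ?mulr1 // fmorph_eq0.
apply: K'M; first exact: adjoin_tau.
by apply: adjoin_base; apply: subfieldV => //; apply: adjoin_norm.
Qed.

Let rK' := subfield_subring adjoin_subfield.

(** Any element of [K'] outside [K] may replace [theta] in the basis; the ramified and inert steps
    use one whose value or residue is new. *)
Lemma adjoin_decomp x z : K' x -> ~ K x -> K' z -> exists p q, [/\ K p, K q & z = p + q * x].
Proof.
move=> [p [q [Kp Kq ->]]] nKx [p' [q' [Kp' Kq' ->]]].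
have q0 : q != 0 by apply/eqP => q0; apply: nKx; rewrite q0 mul0r addr0.
exists (p' - p * (q' / q)), (q' / q); split; last by field.
- by apply: subringB => //; apply: subringM => //; apply: subfield_div.
- exact: subfield_div.
Qed.

(* Trace and norm determine the unordered pair of values of a conjugate pair (Newton polygon of a quadratic). *)
Lemma agree_pointwise v w z : valuation v -> valuation w -> agree K v w ->
  K' z -> z != 0 -> w z = v z \/ w z = v (tau z).
Proof.
move=> vv vw vwK K'z z0; have tz0 : tau z != 0 by rewrite fmorph_eq0.
have nE : v z + v (tau z) = w z + w (tau z).
  rewrite -(valM vv) // -(valM vw) // vwK ?mulf_neq0 //; exact: adjoin_norm.
have KT := adjoin_trace K'z.
(* If the smaller of two values is attained only once, it is the value of the sum, which lies in
   [K]; a valuation agreeing on [K] cannot then have both values larger. *)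
have small u u' r x y : valuation u -> valuation u' -> agree K u u' -> K (x + y) ->
    x != 0 -> y != 0 -> u x < r -> u x < u y -> u' x >= r -> u' y >= r -> False.
  move=> vu vu' uu' Kxy x0 y0 xr xy rx ry.
  have : veq u (u x) (x + y) by apply: (veqD vu); rewrite /vgt ?xy ?orbT // veq_val.
  move=> /veqP[xy0 uxy]; have : vge u' r (x + y).
    by apply: vgeD; rewrite /vge ?rx ?ry ?orbT.
  by rewrite /vge (negPf xy0) -uu' // uxy leNgt xr.
have Ksym : K (tau z + z) by rewrite addrC.
have wvK : agree K w v by move=> x Kx x0; rewrite vwK.
have r_lt (a b c : rat) : c < a -> c < b -> c < Num.min a b by move=> ? ?; rewrite lt_min; apply/andP.
have r_l (a b : rat) : Num.min a b <= a by rewrite ge_min lexx.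
have r_r (a b : rat) : Num.min a b <= b by rewrite ge_min lexx orbT.
case: (ltgtP (w z) (v z)) => [lt_wv|lt_vw|->]; [right|right|by left].
- have [lt_v|lt_v|] := ltgtP (w z) (v (tau z)) => //.
    by case: (small w v (Num.min (v z) (v (tau z))) z (tau z)) => //; [apply: r_lt|lra].
  by case: (small v w (Num.min (w z) (w (tau z))) (tau z) z) => //; [apply: r_lt; lra|lra].
- have [lt_v|lt_v|] := ltgtP (w z) (v (tau z)) => //.
    by case: (small v w (Num.min (w z) (w (tau z))) z (tau z)) => //; [apply: r_lt; lra|lra].
  by case: (small w v (Num.min (v z) (v (tau z))) (tau z) z) => //; [apply: r_lt; lra|lra].
Qed.

(* A group is not the union of two proper subgroups. *)
Lemma agree_adjoin v w : valuation v -> valuation w -> agree K v w ->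
  agree K' v w \/ agree K' (v \o tau) w.
Proof.
move=> vv vw vwK; apply: contrapT => /not_orP[].
move=> /existsNP[x /not_implyP[K'x /not_implyP[x0 /eqP vx]]].
move=> /existsNP[y /not_implyP[K'y /not_implyP[y0 /eqP vy]]].
have ty0 : tau y != 0 by rewrite fmorph_eq0.
have tx0 : tau x != 0 by rewrite fmorph_eq0.
have [wx|wx] := agree_pointwise vv vw vwK K'x x0; first by rewrite wx eqxx in vx.
have [wy|wy] := agree_pointwise vv vw vwK K'y y0; last by rewrite wy eqxx in vy.
have xy0 := mulf_neq0 x0 y0; have K'xy := subringM rK' K'x K'y.
move: vx vy; rewrite /= wx wy => /eqP vx /eqP vy.
by case: (agree_pointwise vv vw vwK K'xy xy0); rewrite ?rmorphM !(valM vv) // (valM vw) // wx wy; lra.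
Qed.

Section Split.
Variables (v : algC -> rat) (vv : valuation v) (x : algC).
Hypotheses (K'x : K' x) (vx : v (tau x) != v x) (x0 : x != 0).

(** Weak approximation by a trace. From [v (tau x) != v x] comes [u] with [v u > 0] and
    [tau u = u^-1]; then [c = 1 / (1 + u ^+ n)] is close to 1 while [tau c = u ^+ n * c] is close to
    0, so the trace of [z c], an element of [K], is close to [z]. *)
Lemma split_approx z : K' z -> z != 0 -> exists2 z', K z' & vgt v (v z) (z - z').
Proof.
move=> K'z z0; have tx0 : tau x != 0 by rewrite fmorph_eq0.
have [u [K'u u0 vu tu]] : exists u, [/\ K' u, u != 0, 0 < v u & tau u = u^-1].
  have aux y : K' y -> y != 0 -> v (tau y) < v y ->
      exists u, [/\ K' u, u != 0, 0 < v u & tau u = u^-1].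
    move=> K'y y0 vy; have ty0 : tau y != 0 by rewrite fmorph_eq0.
    exists (y / tau y); split.
    - by apply: (subfield_div adjoin_subfield) => //; apply: adjoin_tau.
    - by rewrite mulf_neq0 ?invr_eq0.
    - by rewrite (valM vv) ?invr_eq0 // (valV vv) //; lra.
    - by rewrite rmorphM fmorphV adjoin_tauK // invf_div.
  case: (ltgtP (v (tau x)) (v x)) => [|lt_x|/eqP]; last by rewrite (negPf vx).
    exact: aux.
  by apply: (aux (tau x)) => //; rewrite ?adjoin_tauK //; apply: adjoin_tau.
have tz0 : tau z != 0 by rewrite fmorph_eq0.
(* The exponent makes the conjugate term [tau z * u ^+ n * c] of value beyond [v z]. *)
have [n n0 lt_n] : exists2 n : nat, (0 < n)%N & v z < v (tau z) + v u * n%:R.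
  exists (Num.bound `|(v z - v (tau z)) / v u|).+1 => //.
  have lt_b := archi_boundP (normr_ge0 ((v z - v (tau z)) / v u)).
  move: (Num.bound _) lt_b => k lt_b; have : (v z - v (tau z)) / v u < k.+1%:R.
    by apply: le_lt_trans (ler_norm _) (lt_trans lt_b _); rewrite ltr_nat.
  by rewrite ltr_pdivrMr // mulrC; lra.
have vun : veq v (v u * n%:R) (u ^+ n) by apply: veqX; rewrite // veq_val.
have un_gt0 : 0 < v u * n%:R by rewrite mulr_gt0 ?ltr0n.
have v1u : veq v 0 (1 + u ^+ n).
  by apply: veqD => //; [exact: veq1|apply: vge_vgt (veq_vge vun) _].
have [u1 _] := veqP _ _ _ v1u.
pose c := (1 + u ^+ n)^-1.
have K'c : K' c.
  by apply: (subfieldV adjoin_subfield); apply: subringD => //; [apply: subring1|apply: subringX].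
have tcE : tau c = u ^+ n * c.
  rewrite /c fmorphV rmorphD rmorph1 rmorphXn tu exprVn; field.
  by rewrite expf_neq0 // u1.
have vc : veq v 0 c by rewrite /c -[0]oppr0; apply: veqV.
exists (z * c + tau (z * c)).
  by apply: adjoin_trace; apply: subringM.
rewrite rmorphM tcE.
have -> : z - (z * c + tau z * (u ^+ n * c)) = z * (u ^+ n * c) - tau z * (u ^+ n * c).
  have : c * (1 + u ^+ n) = 1 by rewrite /c mulVf.
  move=> cE; rewrite opprD addrA; congr (_ - _); rewrite -{1}[z]mulr1 -cE; ring.
have vunc := veqM vv vun vc; rewrite addr0 in vunc.
apply: vgtB => //.
  by apply: (vge_vgt (veq_vge (veqM vv (veq_val _ z0) vunc))); lra.
by apply: (vge_vgt (veq_vge (veqM vv (veq_val _ tz0) vunc))).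
Qed.

Lemma split_val z : K' z -> z != 0 -> exists z', [/\ K z', z' != 0 & v z' = v z].
Proof.
move=> K'z z0; have [z' Kz' zz'] := split_approx K'z z0; exists z'.
have : veq v (v z) (z - (z - z')) by apply: (veqD vv); [exact: veq_val|rewrite (vgtN vv)].
by rewrite opprB addrC subrK => /veqP[z'0 ->].
Qed.

(** [K] is dense in [K'] at [v], so every value and every residue class of [K'] is already taken on
    [K]. *)
Lemma split_local e f : local_type K v e f -> local_type K' v e f.
Proof.
move=> [valK unifK [b [b1 b2 b3]]]; split.
- move=> z K'z z0; have [z' [Kz' z'0 <-]] := split_val K'z z0; exact: valK.
- have [y [Ky y0 vy]] := unifK; exists y; split=> //; exact: adjoin_base.
exists b; split=> // [i|z K'z z0]; first by have [] := b1 i; split=> //; exact: adjoin_base.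
have [->|zn0] := eqVneq z 0.
  exists (fun=> false); rewrite big1 ?subr0 ?vgt0 // => i _; exact: mul0r.
have [z' Kz' zz'] := split_approx K'z zn0.
have vz : 0 <= v z by move: z0; rewrite /vge (negPf zn0).
have {}zz' : vgt v 0 (z - z').
  by move/vgtP: zz' => [s ss zs]; apply: vge_vgt ss _; lra.
have z'0 : vge v 0 z'.
  have -> : z' = z - (z - z') by ring.
  by apply: vgeB => //; apply: vgtW.
have [eps H] := b3 _ Kz' z'0; exists eps.
by rewrite -(subrKA z'); apply: vgtD.
Qed.

End Split.

(** If [v] differed from [v \o tau], density would give an element of [K] with the new value [v x].
    So they agree, and [2 v x] is the value of the norm of [x]: [v x] is half of an odd multiple of
    [1/e]. Hence [p] and [q x] never have equal values, [v (p + q x)] is the smaller one, and no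
    residue class is new. *)
Lemma ramified_local v e f x : valuation v -> local_type K v e f ->
  K' x -> x != 0 -> (forall m : int, v x * e%:R != m%:~R) ->
  local_type K' v (2 * e) f /\ agree K' v (v \o tau).
Proof.
move=> vv lK K'x x0 vx; have [valK unifK [b [b1 b2 b3]]] := lK.
have tauv z : K' z -> z != 0 -> v (tau z) = v z.
  move=> K'z z0; apply/eqP; apply: contrapT => /negP vz.
  have [x' [Kx' x'0 vx']] := split_val vv K'z vz z0 K'x x0.
  have [m] := valK _ Kx' x'0; rewrite vx' => /eqP; rewrite (negPf (vx m)) //.
split; last by move=> z K'z z0; rewrite /= tauv.
have nKx : ~ K x by move=> /valK/(_ x0)[m /eqP]; rewrite (negPf (vx m)).
have [m mE] : exists m : int, (2 * v x) * e%:R = m%:~R.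
  have := valK _ (adjoin_norm K'x); rewrite mulf_neq0 ?fmorph_eq0 // => /(_ isT)[m].
  by rewrite (valM vv) ?fmorph_eq0 // tauv // => mE; exists m; rewrite -mE; ring.
have odd_m : ~~ (2 %| m)%Z.
  apply/negP => /dvdzP[q mq]; case/negP: (vx q); apply/eqP.
  by move: mE; rewrite mq intrM; lra.
have e0 : e%:R != 0 :> rat.
  by have [y [_ _ ye]] := unifK; apply: contra_eq_neq ye => ->; rewrite mulr0 eq_sym oner_eq0.
have sumv p q : K p -> K q -> p != 0 -> q != 0 -> v p != v (q * x).
  move=> Kp Kq p0 q0; apply/eqP; rewrite (valM vv) // => pq.
  have [i iE] := valK _ Kp p0; have [j jE] := valK _ Kq q0.
  by case/negP: (vx (i - j)); rewrite intrB -iE -jE pq; apply/eqP; ring.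
have decomp z : K' z -> z != 0 -> exists p q, [/\ K p, K q, z = p + q * x &
    (p != 0 /\ veq v (v p) z /\ vgt v (v z) (q * x)) \/ (q != 0 /\ veq v (v q + v x) z /\ vgt v (v z) p)].
  move=> K'z z0; have [p [q [Kp Kq zE]]] := adjoin_decomp K'x nKx K'z.
  exists p, q; split=> //.
  have [p0|p0] := eqVneq p 0.
    have q0 : q != 0 by apply: contra_neq z0 => q0; rewrite zE p0 q0 mul0r addr0.
    right; rewrite p0 vgt0 zE p0 add0r -(valM vv) //; split=> //; split=> //.
    by rewrite veq_val // mulf_neq0.
  have [q0|q0] := eqVneq q 0.
    by left; rewrite q0 mul0r vgt0 zE q0 mul0r addr0 veq_val.
  have qx0 := mulf_neq0 q0 x0.
  have := sumv _ _ Kp Kq p0 q0; case: ltgtP => // lt_pq _.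
    have vz : veq v (v p) z by rewrite zE; apply: (veqD vv); [exact: veq_val|rewrite /vgt lt_pq orbT].
    by left; split=> //; split=> //; rewrite /vgt (proj2 (veqP _ _ _ vz)) lt_pq orbT.
  have vz : veq v (v (q * x)) z.
    by rewrite zE addrC; apply: (veqD vv); [exact: veq_val|rewrite /vgt lt_pq orbT].
  by right; split=> //; rewrite -(valM vv) //; split=> //; rewrite /vgt (proj2 (veqP _ _ _ vz)) lt_pq orbT.
split.
- move=> z K'z z0; have [p [q [Kp Kq zE [[p0 [/veqP[_ ->] _]]|[q0 [/veqP[_ ->] _]]]]]] := decomp _ K'z z0.
    by have [i iE] := valK _ Kp p0; exists (2 * i); rewrite intrM -iE natrM; ring.
  by have [i iE] := valK _ Kq q0; exists (2 * i + m); rewrite intrD intrM -iE -mE natrM; ring.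
(* With [v x = (2 n + 1) / (2 e)] and [v y = 1 / e], the product [x * y ^ (- n)] has value
   [1 / (2 e)]. *)
- have [y [Ky y0 vy]] := unifK; pose n := ((m - 1) %/ 2)%Z.
  have mn : m = 2 * n + 1 by rewrite /n; lia.
  have vXz i : v (y ^ i) * e%:R = i%:~R.
    case: i => k; rewrite ?NegzE ?mulrNz /exprz ?(valV vv) ?expf_neq0 //.
      by have /veqP[_ ->] := veqX vv k (veq_val v y0); rewrite -mulrA [_%:R * _]mulrC mulrA vy mul1r.
    have /veqP[_ ->] := veqX vv k.+1 (veq_val v y0).
    by rewrite mulNr -mulrA [_%:R * _]mulrC mulrA vy mul1r.
  exists (x * y ^ (- n)); split.
  + apply: subringM => //; apply: adjoin_base; case: (- n) => k; rewrite /exprz; last apply: (subfieldV fK);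
      by apply: subringX.
  + by rewrite mulf_neq0 // expfz_neq0.
  + rewrite (valM vv) ?expfz_neq0 // mulrDl natrM.
    have := vXz (- n); move: mE; rewrite mn intrD intrM mulrNz => mE nE.
    have -> : v x * (2 * e%:R) + v (y ^ (- n)) * (2 * e%:R) = 2 * v x * e%:R + 2 * (v (y ^ (- n)) * e%:R) by ring.
    by rewrite mE nE; lra.
exists b; split=> // [i|z K'z z0]; first by have [] := b1 i; split=> //; exact: adjoin_base.
have [->|zn0] := eqVneq z 0.
  exists (fun=> false); rewrite big1 ?subr0 ?vgt0 // => i _; exact: mul0r.
have vz : 0 <= v z by move: z0; rewrite /vge (negPf zn0).
have [p [q [Kp Kq zE pq]]] := decomp _ K'z zn0.
have qx : vgt v 0 (q * x) /\ vge v 0 p.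
  case: pq => [[p0 [/veqP[_ pz] /vgtP[s ss zs]]]|[q0 [/veqP[_ qz] /vgtP[s ss zs]]]].
    by split; [apply: vge_vgt ss _; lra|rewrite /vge -pz vz orbT].
  split; last by apply: vge_mono ss _; lra.
  rewrite /vgt (valM vv) // -qz lt_neqAle vz andbT; apply/orP; right.
  have [j jE] := valK _ Kq q0; apply/eqP => vz0; case/negP: (vx (- j)).
  by rewrite mulrNz -jE; rewrite -mulNr; apply/eqP; congr (_ * _); lra.
have [eps H] := b3 _ Kp (proj2 qx); exists eps.
by rewrite zE addrAC; apply: vgtD => //; exact: (proj1 qx).
Qed.

(** Since [X^2 + X + 1] has no root in F_2, no element of [K] is congruent to [w]. This excludes
    [v != v \o tau], by density, and makes 1 and [w] independent over the residue field. *)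
Lemma inert_local v e w : valuation v -> local_type K v e 1 ->
  K' w -> vge v 0 w -> vgt v 0 (w ^+ 2 + w + 1) ->
  local_type K' v e 2 /\ agree K' v (v \o tau).
Proof.
move=> vv lK K'w w0 ww; have [valK unifK rb] := lK.
have F2 := residue_F2 vv fK rb.
have v2 : vgt v 0 2 by apply: (vge_vgt (veq_vge (veq_2 vv))).
have nKw z : K z -> ~ vgt v 0 (w - z).
  move=> Kz wz.
  have z0 : vge v 0 z.
    by have -> : z = w - (w - z); [ring|apply: vgeB => //; apply: vgtW].
  have zz : vgt v 0 (z ^+ 2 + z + 1).
    have -> : z ^+ 2 + z + 1 = (w ^+ 2 + w + 1) - (w - z) * (w + z + 1) by ring.
    apply: vgtB => //; rewrite -[0]addr0; apply: vgtM => //.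
    by do ?[apply: vgeD => //]; rewrite veq_vge ?veq1.
  case: (F2 _ Kz z0) => mz; apply: (negP (veq_nvgt (veq1 vv))).
    have -> : 1 = (z ^+ 2 + z + 1) - z * (z + 1) by ring.
    apply: vgtB => //; rewrite -[0]addr0; apply: vgtM => //.
    by apply: vgeD => //; rewrite veq_vge ?veq1.
  have -> : 1 = (z ^+ 2 + z + 1) - (z - 1) * (z + 2) - 2 by ring.
  apply: vgtB => //; apply: vgtB => //; rewrite -[0]addr0; apply: vgtM => //.
  by apply: vgeD => //; exact: vgtW.
have tauv z : K' z -> z != 0 -> v (tau z) = v z.
  move=> K'z z0; apply/eqP; apply: contrapT => /negP vz.
  have wn0 : w != 0.
    by apply/eqP => wE; apply: (nKw 0); [apply: subring0|rewrite wE subrr vgt0].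
  have [w' Kw' ww'] := split_approx vv K'z vz z0 K'w wn0.
  apply: (nKw _ Kw'); move/vgtP: ww' => [s ss lt_s]; apply: vge_vgt ss _.
  by move: w0; rewrite /vge (negPf wn0) /=; lra.
split; last by move=> z K'z z0; rewrite /= tauv.
have nKw' : ~ K w by move=> Kw; apply: (nKw _ Kw); rewrite subrr vgt0.
have w1 : veq v 0 w.
  case: (vge_cases w0) => // mw; case: (nKw 0); first by apply: subring0.
  by rewrite subr0.
have vw1 z : K z -> vge v 0 z -> veq v 0 (z + w).
  move=> Kz z0; case: (vge_cases (vgeD vv z0 w0)) => // mw.
  by case: (nKw (- z)); [apply: subringN|rewrite opprK addrC].
(* [v (p + q w) = min (v p) (v q)] *)
have sumv r p q : K p -> K q -> vge v r (p + q * w) -> vge v r p /\ vge v r q.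
  move=> Kp Kq pq; have [q0|q0] := eqVneq q 0.
    by rewrite q0 mul0r addr0 in pq; rewrite q0 vge0.
  suff rq : vge v r q.
    split=> //; have -> : p = (p + q * w) - q * w by ring.
    by apply: vgeB => //; rewrite -[r]addr0; apply: vgeM.
  have [pq0|pq0] := boolP (vge v 0 (p / q)).
    have vpqw := vw1 _ (subfield_div fK Kp Kq) pq0; have [pqw0 _] := veqP _ _ _ vpqw.
    have pqE : p + q * w = q * (p / q + w) by rewrite mulrDr [q * (p / q)]mulrC divfK.
    by have := vge_divr vv vpqw pq; rewrite subr0 pqE mulfK.
  move: pq0; rewrite /vge negb_or => /andP[pq0 vpq].
  have p0 : p != 0 by apply: contra_neq pq0 => ->; rewrite mul0r.
  rewrite (valM vv) ?invr_eq0 // (valV vv) // -ltNge in vpq.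
  have lt_pq : v p < v q by lra.
  have vz : veq v (v p) (p + q * w).
    apply: (veqD vv); rewrite ?veq_val //; apply: (vge_vgt (veq_vge (veqM vv (veq_val v q0) w1))); lra.
  apply/orP; right; move/veqP: vz => [z0 zE]; move: pq; rewrite /vge (negPf z0) zE /=; lra.
split.
- move=> z K'z z0; have [p [q [Kp Kq zE]]] := adjoin_decomp K'w nKw' K'z.
  have [vp vq] := sumv (v z) p q Kp Kq ltac:(by rewrite -zE /vge lexx orbT).
  have [p1|p1] := vge_cases vp.
    by move/veqP: p1 => [p0 <-]; exact: valK.
  have [q1|q1] := vge_cases vq.
    by move/veqP: q1 => [q0 <-]; exact: valK.
  case/negP: (veq_nvgt (veq_val v z0)); rewrite {2}zE; apply: vgtD => //.
  by rewrite -[v z]addr0; apply: vgtM.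
- by have [y [Ky y0 vy]] := unifK; exists y; split=> //; exact: adjoin_base.
have K1 : K 1 by apply: subring1.
have sumE (eps : 'I_2 -> bool) : \sum_i (eps i)%:R * (if val i == 0%N then 1 else w) =
    (eps ord0)%:R + (eps ord_max)%:R * w.
  by rewrite big_ord_recl big_ord1 /= mulr1 (_ : lift _ _ = ord_max) //; apply: val_inj.
exists (fun i => if val i == 0%N then 1 else w); split.
- move=> i; case: ifP => _; split=> //; [exact: adjoin_base|exact/veq_vge/veq1].
- move=> eps; rewrite sumE => meps i.
  have : eps ord0 = false /\ eps ord_max = false.
    move: meps; case: (eps ord0); case: (eps ord_max) => //; rewrite ?mul1r ?mul0r ?addr0 ?add0r.
    + by move=> m1w; case/negP: (veq_nvgt (vw1 1 K1 (veq_vge (veq1 vv)))).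
    + by move/(negP (veq_nvgt (veq1 vv))).
    + by move/(negP (veq_nvgt w1)).
  by case: i => [[|[|//]] i2] [e0 e1]; [rewrite -e0|rewrite -e1]; congr (eps _); apply: val_inj.
move=> z K'z z0; have [p [q [Kp Kq zE]]] := adjoin_decomp K'w nKw' K'z.
rewrite zE in z0; have [vp vq] := sumv _ _ _ Kp Kq z0.
have bit x : K x -> vge v 0 x -> exists e : bool, vgt v 0 (x - e%:R).
  by move=> Kx x0; case: (F2 _ Kx x0) => mx; [exists false; rewrite subr0|exists true].
have [e0 m0] := bit _ Kp vp; have [e1 m1] := bit _ Kq vq.
exists (fun i => if val i == 0%N then e0 else e1); rewrite sumE /= zE.
have -> : p + q * w - (e0%:R + e1%:R * w) = (p - e0%:R) + (q - e1%:R) * w by ring.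
by apply: vgtD => //; rewrite -[0]addr0; apply: vgtM.
Qed.

Let same_places e f e' f' g : total_type K e f g ->
  (forall v, valuation v -> local_type K' v e' f' /\ agree K' v (v \o tau)) ->
  total_type K' e' f' g.
Proof.
move=> [lK [vs [vvs inj_vs all_vs]]] H; split; first by move=> v /H[].
exists vs; split=> // [i j ij|w vw].
  by apply: inj_vs => x Kx; apply: ij; apply: adjoin_base.
have [i viw] := all_vs _ vw; exists i.
case: (agree_adjoin (vvs i) vw viw) => // wi x K'x x0.
by rewrite (proj2 (H _ (vvs i))) // wi.
Qed.

Lemma total_ramified e f g : total_type K e f g ->
  (forall v, valuation v -> exists x, [/\ K' x, x != 0 & forall m : int, v x * e%:R != m%:~R]) ->
  total_type K' (2 * e) f g.
Proof.
move=> tK H; apply: same_places (tK) _ => v vv; have [x [K'x x0 vx]] := H _ vv.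
exact: (ramified_local vv (proj1 tK _ vv) K'x).
Qed.

Lemma total_inert e g : total_type K e 1 g ->
  (forall v, valuation v -> exists w, [/\ K' w, vge v 0 w & vgt v 0 (w ^+ 2 + w + 1)]) ->
  total_type K' e 2 g.
Proof.
move=> tK H; apply: same_places (tK) _ => v vv; have [x [K'x x0 vx]] := H _ vv.
exact: (inert_local vv (proj1 tK _ vv) K'x).
Qed.

Lemma total_split e f g : total_type K e f g ->
  (forall v, valuation v -> exists x, [/\ K' x, x != 0 & v (tau x) != v x]) ->
  total_type K' e f (g + g).
Proof.
move=> [lK [vs [vvs inj_vs all_vs]]] H; split.
  by move=> v vv; have [x [K'x x0 vx]] := H _ vv; apply: (split_local vv K'x) => //; exact: lK.
have restr (v w : algC -> rat) : agree K' v w -> agree K v w.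
  by move=> vw x Kx; apply: vw; apply: adjoin_base.
have restr_tau (v w : algC -> rat) : agree K (v \o tau) w -> agree K v w.
  by move=> vw x Kx x0; rewrite -vw //= tauK.
(* The two halves of ['I_(g + g)] carry the given places and their conjugates. *)
pose ws (i : 'I_(g + g)) := match split i with inl j => vs j | inr j => vs j \o tau end.
have neq_tau i : ~ agree K' (vs i) (vs i \o tau).
  by have [x [K'x x0 /eqP vx]] := H _ (vvs i); move=> /(_ x K'x x0)/esym.
exists ws; split.
- by move=> i; rewrite /ws; case: split => j //; exact: valuation_comp.
- move=> i j; rewrite -[i]splitK -[j]splitK /ws !unsplitK.
  case: (split i) (split j) => k [] l kl; congr unsplit.
  + by congr inl; apply/inj_vs/restr.
  + have kl' : k = l.
      by apply: inj_vs => x Kx x0; have := restr _ _ kl x Kx x0; rewrite /= tauK.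
    by rewrite kl' in kl; case: (neq_tau l).
  + have kl' : k = l by apply/inj_vs/restr_tau/restr.
    by rewrite kl' in kl; case: (neq_tau l) => x K'x x0; rewrite kl.
  + by congr inr; apply/inj_vs/restr_tau => x Kx x0; rewrite (restr _ _ kl x Kx x0) /= tauK.
- move=> w vw; have [i iw] := all_vs _ vw.
  case: (agree_adjoin (vvs i) vw iw) => aw.
    by exists (unsplit (inl i)); rewrite /ws unsplitK.
  by exists (unsplit (inr i)); rewrite /ws unsplitK.
Qed.

End QuadraticStep.

(** * Valuations and primes of the ring of integers *)

Lemma Lc_subfield c : subfieldP (Lc c).
Proof.
split; first by move=> S fS _; exact: subring1 (subfield_subring fS).
split; first by move=> x y Lx Ly S fS rS; apply: (subringB (subfield_subring fS)); [exact: Lx|exact: Ly].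
split; first by move=> x y Lx Ly S fS rS; apply: (subringM (subfield_subring fS)); [exact: Lx|exact: Ly].
by move=> x Lx S fS rS; apply: (subfieldV fS); exact: Lx.
Qed.

Lemma OL_subring c : subringP (OL c).
Proof.
have rL := subfield_subring (Lc_subfield c).
split; first by split; [apply: subring1|exact: Aint1].
by split=> x y [Lx Ax] [Ly Ay]; split; rewrite ?rpredB ?rpredM //; [apply: (subringB rL)|apply: (subringM rL)].
Qed.

Lemma AintP x : x \in Aint -> integralOver (intr : int -> algC) x.
Proof.
rewrite unfold_in => /floorpP[p pE]; exists p; last by rewrite -pE root_minCpoly.
have := minCpoly_monic x; rewrite pE !monicE lead_coef_map_inj //; last exact: intr_inj.
by rewrite (eqr_int _ _ 1).
Qed.

Lemma integral_Aint x : integralOver (intr : int -> algC) x -> x \in Aint.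
Proof.
case=> p mon_p px; apply: (root_monic_Aint px); first exact: monic_map.
by apply/polyOverP => i; rewrite coef_map /= intr_int.
Qed.

Lemma root_monic_over_Aint n (a : nat -> algC) x : (forall i, a i \in Aint) ->
  x ^+ n + \sum_(i < n) a i * x ^+ i = 0 -> x \in Aint.
Proof.
move=> Aa xE; apply: integral_Aint; pose p := 'X^n + \poly_(i < n) a i.
have size_p : (size (\poly_(i < n) a i) < size ('X^n : {poly algC}))%N.
  by rewrite size_polyXn ltnS size_poly.
apply: (@integral_root_monic _ _ intr _ p).
- by rewrite monicE lead_coefDl // lead_coefXn.
- by rewrite rootE hornerD hornerXn horner_poly xE.
- apply/integral_poly => i; apply/AintP; rewrite coefD coefXn coef_poly.
  apply: rpredD; first by case: eqP => _; rewrite ?Aint0 ?Aint1.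
  by case: ifP => _; rewrite ?Aa ?Aint0.
Qed.

Section Integers.
Variables (c : int) (v : algC -> rat) (vv : valuation v).

Let rL := subfield_subring (Lc_subfield c).
Let rO := OL_subring c.

(** If [v x < 0], all lower terms of a monic integral relation would have value above that of the
    leading term. *)
Lemma vge_Aint x : x \in Aint -> vge v 0 x.
Proof.
move=> /AintP[p mon_p /eqP px]; rewrite /vge; case: eqVneq => //= x0; rewrite leNgt; apply/negP => vx.
have [n pn] : exists n, size p = n.+1.
  by exists (size p).-1; rewrite prednK // lt0n size_poly_eq0 monic_neq0.
have nE : x ^+ n = - \sum_(i < n) (p`_i)%:~R * x ^+ i.
  have pn1 : p`_n = 1 by rewrite -(monicP mon_p) lead_coefE pn.
  move: px; rewrite horner_coef size_map_poly_id0 ?(monicP mon_p) ?oner_eq0 // pn big_ord_recr /=.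
  rewrite coef_map pn1 /= mul1r => /eqP; rewrite addrC addr_eq0 => /eqP ->.
  by congr (- _); apply: eq_bigr => i _; rewrite coef_map.
have vn := veqX vv n (veq_val v x0).
suff : vgt v (v x * n%:R) (x ^+ n) by apply/negP/veq_nvgt.
rewrite nE vgtN //; apply: (big_ind (fun y => vgt v (v x * n%:R) y)) => [|y z|i _]; [exact: vgt0|by apply: vgtD|].
apply: (vge_vgt (vgeM vv (vge_int vv _) (vgeX vv i (veq_vge (veq_val v x0))))).
by rewrite add0r ltr_nM2l // ltr_nat.
Qed.

Lemma vge_OL x : OL c x -> vge v 0 x.
Proof. by case=> _ /vge_Aint. Qed.

(** Multiplying the relation by [h ^+ m] gives a monic one for [h x]. *)
Lemma Aint_mul_lead m (a : nat -> int) h x : h \in Aint ->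
  h * x ^+ m.+1 + \sum_(i < m.+1) (a i)%:~R * x ^+ i = 0 -> h * x \in Aint.
Proof.
move=> Ah hE; apply: (@root_monic_over_Aint m.+1 (fun i => (a i)%:~R * h ^+ (m - i))).
  by move=> i; rewrite rpredM ?rpredX // Aint_int.
have -> : (h * x) ^+ m.+1 + \sum_(i < m.+1) (a i)%:~R * h ^+ (m - i) * (h * x) ^+ i =
    h ^+ m * (h * x ^+ m.+1 + \sum_(i < m.+1) (a i)%:~R * x ^+ i).
  rewrite mulrDr mulrA -exprSr -exprMn mulr_sumr; congr (_ + _); apply: eq_bigr => i _.
  have -> : h ^+ m = h ^+ (m - i) * h ^+ i by rewrite -exprD subnK // -ltnS.
  by rewrite exprMn; ring.
by rewrite hE mulr0.
Qed.

(* Kaplansky's argument: the partial Horner values [h] of a primitive relation satisfied by [x]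
   are integral together with [h * x], and they are not all in the maximal ideal. *)
Lemma exists_unit_denominator x : Lc c x -> vge v 0 x ->
  exists s, [/\ OL c s, veq v 0 s & OL c (s * x)].
Proof.
move=> Lx x0; have [p [pE [i0 odd_i]]] := exists_primitive_int_poly x.
have Oint (m : int) : OL c m%:~R by split; [apply: (subring_int rL)|exact: Aint_int].
(* Invariant: the relation is collapsed to degree [m] with leading coefficient [h], and either [h]
   is already a unit or an odd coefficient is still to be absorbed. It starts with [h = 0] above the
   top degree. *)
suff H m : forall h, OL c h -> h * x ^+ m + \sum_(i < m) (p`_i)%:~R * x ^+ i = 0 ->
    veq v 0 h \/ (exists i, (i < m)%N /\ ~~ (2 %| p`_i)%Z) ->
    exists s, [/\ OL c s, veq v 0 s & OL c (s * x)].
  apply: (H (size p) 0); rewrite ?mul0r ?add0r //; first exact: (Oint 0).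
  by right; exists i0; split.
elim: m => [|m IHm] h Oh hE.
  by move: hE; rewrite big_ord0 addr0 expr0 mulr1 => -> [/veqP[/eqP]|[i []]].
have Ohx : OL c (h * x).
  by split; [apply: (subringM rL) => //; case: Oh|apply: (Aint_mul_lead _ hE); case: Oh].
case: (vge_cases (vge_OL Oh)) => [uh _|mh]; first by exists h.
move=> odd_or; apply: (IHm (h * x + (p`_m)%:~R)).
- by apply: subringD.
- by apply: (etrans _ hE); rewrite big_ord_recr exprS /=; ring.
- case: odd_or => [uh|[i [im odd_pi]]]; first by rewrite (negPf (veq_nvgt uh)) in mh.
  move: im; rewrite ltnS leq_eqVlt => /orP[/eqP im|im]; last by right; exists i.
  left; rewrite addrC; apply: (veqD vv); first by apply: (veq_odd vv); rewrite -im.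
  by rewrite -[0]addr0; apply: vgtM.
Qed.

(** The centre of [v] on the ring of integers. *)
Definition vprime x := OL c x /\ vgt v 0 x.

Lemma vprime_ideal : is_ideal c vprime.
Proof.
split; first by move=> x [].
split; first by split; [apply: subring0|exact: vgt0].
split=> [x y [Ox mx] [Oy my]|a x Oa [Ox mx]]; split.
- by apply: subringD.
- by apply: vgtD.
- by apply: subringM.
- by rewrite mulrC -[0]addr0; apply: vgtM => //; by apply: vge_OL.
Qed.

Lemma vprime_prime : prime_above2 c vprime.
Proof.
split; last first.
  by split; [apply: (subring_nat rO 2)|apply: (vge_vgt (veq_vge (veq_2 vv)))].
split; first exact: vprime_ideal.
split; first by move=> [_ /(negP (veq_nvgt (veq1 vv)))].
move=> a b Oa Ob [_ mab].
case: (vge_cases (vge_OL Oa)) => [ua|]; last by left.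
case: (vge_cases (vge_OL Ob)) => [ub|]; last by right.
have := veqM vv ua ub; rewrite addr0 => /veq_nvgt; by rewrite mab.
Qed.

Variables (e f : nat) (lL : local_type (Lc c) v e f).

(** There are at most [2 ^ f] residue classes, so two powers of [x] coincide modulo the maximal
    ideal. This yields inverses modulo the centre as powers, which stay inside the ring of
    integers. *)
Lemma unit_power x : Lc c x -> veq v 0 x -> exists2 n, (0 < n)%N & vgt v 0 (x ^+ n - 1).
Proof.
move=> Lx ux; have [_ _ [b [b1 b2 b3]]] := lL.
have uX n : veq v 0 (x ^+ n) by have := veqX vv n ux; rewrite mul0r.
have /choice[eps epsP] : forall n : 'I_(2 ^ f).+1, exists eps : {ffun 'I_f -> bool},
    vgt v 0 (x ^+ n - \sum_i (eps i)%:R * b i).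
  move=> n; have [|eps H] := b3 (x ^+ n) _ (veq_vge (uX n)); first by apply: (subringX rL).
  by exists [ffun i => eps i]; under eq_bigr do rewrite ffunE.
have : ~~ injectiveb eps.
  apply/negP => /injectiveP inj_eps; have := max_card (mem (codom eps)).
  by rewrite card_codom // card_ord card_ffun card_bool card_ord ltnn.
rewrite /injectiveb /dinjectiveb => /injectivePn[i [j ij eij]].
wlog lt_ij : i j ij eij / (i < j)%N.
  move=> wlg; case: (ltngtP i j) => [|ji|/val_inj/eqP]; last by rewrite (negPf ij).
    exact: (wlg i j).
  by apply: (wlg j i); rewrite // eq_sym.
exists (j - i)%N; first by rewrite subn_gt0.
have : vgt v 0 (x ^+ j - x ^+ i).
  have -> : x ^+ j - x ^+ i = (x ^+ j - \sum_k (eps j k)%:R * b k) - (x ^+ i - \sum_k (eps i k)%:R * b k).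
    by rewrite eij; ring.
  by apply: vgtB.
have [xi0 _] := veqP _ _ _ (uX i).
rewrite -(subnK (ltnW lt_ij)) exprD addnK -{2}[x ^+ i]mul1r -mulrBl => H.
have := vgtM vv H (veq_vge (veqV vv (uX i))).
by rewrite mulfK // oppr0 addr0.
Qed.

End Integers.

(** * Ideal powers and residue degrees *)

Section Ideals.
Variable c : int.

Let rO := OL_subring c.

Lemma OL_ideal : is_ideal c (OL c).
Proof.
split=> //; split; first by apply: (subring0 rO).
by split=> *; [apply: (subringD rO)|apply: (subringM rO)].
Qed.

Lemma ideal_sum I (J : finType) (P : pred J) (F : J -> algC) : is_ideal c I ->
  (forall j, P j -> I (F j)) -> I (\sum_(j | P j) F j).
Proof. by move=> [_ [I0 [ID _]]] IF; apply: big_ind => //. Qed.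

Lemma ideal_mulr I a x : is_ideal c I -> OL c a -> I x -> I (x * a).
Proof. by move=> [_ [_ [_ IM]]] Oa Ix; rewrite mulrC; apply: IM. Qed.

Lemma ideal_opp I x : is_ideal c I -> I x -> I (- x).
Proof.
by move=> [_ [_ [_ IM]]] Ix; rewrite -mulN1r; apply: IM => //; apply: (subring_int rO (-1)).
Qed.

Lemma idprod_ideal I J : is_ideal c I -> is_ideal c J -> is_ideal c (idprod I J).
Proof.
move=> iI iJ; have [IO [I0 [ID IM]]] := iI; have [JO [J0 [JD JM]]] := iJ.
split.
  move=> _ [n [a [b [ab ->]]]]; apply: (ideal_sum OL_ideal) => i _.
  by have [Ia Jb] := ab i; apply: (subringM rO); [apply: IO|apply: JO].
split; first by exists 0%N, (fun=> 0), (fun=> 0); split=> [[]//|]; rewrite big_ord0.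
split=> [_ _ [n [a [b [ab ->]]]] [m [a' [b' [ab' ->]]]]|r _ Or [n [a [b [ab ->]]]]].
  exists (n + m)%N, (fun i => match split i with inl j => a j | inr j => a' j end),
    (fun i => match split i with inl j => b j | inr j => b' j end); split.
    by move=> i; case: split.
  rewrite big_split_ord /=; congr (_ + _); apply: eq_bigr => i _.
    by rewrite (unsplitK (inl i)).
  by rewrite (unsplitK (inr i)).
exists n, (fun i => r * a i), b; split=> [i|]; first by have [Ia Jb] := ab i; split=> //; apply: IM.
by rewrite mulr_sumr; apply: eq_bigr => i _; rewrite mulrA.
Qed.

Lemma idprodM (I J : algC -> Prop) x y : I x -> J y -> idprod I J (x * y).
Proof. by move=> Ix Jy; exists 1%N, (fun=> x), (fun=> y); split; rewrite ?big_ord1. Qed.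

Lemma idpow_ideal P n : is_ideal c P -> is_ideal c (idpow c P n).
Proof. by move=> iP; elim: n => [|n IHn]; [exact: OL_ideal|exact: idprod_ideal]. Qed.

Lemma idpow_le P m n x : is_ideal c P -> (m <= n)%N -> idpow c P n x -> idpow c P m x.
Proof.
move=> iP /subnK <-; elim: (n - m)%N x => [//|k IHk] x [l [a [b [ab ->]]]].
apply: IHk; apply: (ideal_sum (idpow_ideal _ iP)) => i _; have [Ia Pb] := ab i.
by apply: (ideal_mulr (idpow_ideal _ iP)) => //; case: iP => PO _; apply: PO.
Qed.

Lemma ram_index_uniq P e e' : is_ideal c P -> ram_index c P e -> ram_index c P e' -> e = e'.
Proof.
move=> iP; wlog le_e : e e' / (e <= e')%N.
  move=> wlg re re'; case: (leqP e e') => [|/ltnW] le_e; first exact: wlg.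
  by apply/esym/wlg.
move=> [_ n2] [p2 _]; apply/eqP; rewrite eqn_leq le_e leqNgt; apply/negP => lt_e.
by apply/n2/(idpow_le iP lt_e).
Qed.

(** A count: sending a bit vector to the bits that express its combination in the other basis is
    injective, whence [2 ^ g <= 2 ^ g']. *)
Lemma res_degree_uniq P f f' : is_ideal c P -> P 2 -> res_degree c P f -> res_degree c P f' -> f = f'.
Proof.
move=> iP P2; have [PO [P0 [PD PM]]] := iP.
suff le_res g g' : res_degree c P g -> res_degree c P g' -> (g <= g')%N.
  by move=> rf rf'; apply/eqP; rewrite eqn_leq !le_res.
move=> [b [Ob [bfree _]]] [b' [_ [_ bspan]]].
pose lin k (B : 'I_k -> algC) (eps : {ffun 'I_k -> bool}) := \sum_i (eps i)%:R * B i.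
have /choice[phi phiP] : forall eps : {ffun 'I_g -> bool}, exists eps' : {ffun 'I_g' -> bool},
    P (lin _ b eps - lin _ b' eps').
  move=> eps; have [|eps' H] := bspan (lin _ b eps).
    by apply: (ideal_sum OL_ideal) => i _; apply: (subringM rO) => //; apply: (subring_nat rO).
  by exists [ffun i => eps' i]; rewrite /lin; under [X in _ - X]eq_bigr do rewrite ffunE.
suff inj_phi : injective phi.
  have := leq_card _ inj_phi; rewrite !card_ffun !card_bool !card_ord.
  by rewrite leq_exp2l.
move=> eps1 eps2 e12; apply/ffunP => i.
have P12 : P (lin _ b eps1 - lin _ b eps2).
  have -> : lin _ b eps1 - lin _ b eps2 =
      (lin _ b eps1 - lin _ b' (phi eps1)) + - (lin _ b eps2 - lin _ b' (phi eps2)).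
    by rewrite e12; ring.
  by apply: PD => //; apply: ideal_opp.
(* Freeness speaks of combinations with bits only; the difference of two bits is their exclusive or,
   up to a multiple of 2, which lies in [P]. *)
have /bfree/(_ i) : P (\sum_i (eps1 i (+) eps2 i)%:R * b i).
  have -> : \sum_i (eps1 i (+) eps2 i)%:R * b i =
      (lin _ b eps1 - lin _ b eps2) + \sum_i (~~ eps1 i && eps2 i)%:R * b i * 2.
    rewrite /lin -sumrB -big_split /=; apply: eq_bigr => j _.
    by case: (eps1 j); case: (eps2 j) => /=; ring.
  apply: PD => //; apply: (ideal_sum iP) => j _; apply: PM => //.
  by apply: (subringM rO) => //; apply: (subring_nat rO).
by case: (eps1 i); case: (eps2 i).
Qed.

(** [0 < g] supplies a prime at which the two values of [e] and of [f] can be compared. *)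
Lemma decomp2_uniq e f g e' f' g' : (0 < g)%N ->
  decomp2 c e f g -> decomp2 c e' f' g' -> [/\ e = e', f = f' & g = g'].
Proof.
move=> g0 [Ps [P1 [P2 [P3 P4]]]] [Qs [Q1 [Q2 [Q3 Q4]]]].
have le_g k k' (Rs : 'I_k -> algC -> Prop) (Ss : 'I_k' -> algC -> Prop) :
    (forall i, prime_above2 c (Rs i)) -> (forall i j, (forall x, Rs i x <-> Rs j x) -> i = j) ->
    (forall P, prime_above2 c P -> exists i, forall x, P x <-> Ss i x) -> (k <= k')%N.
  move=> R1 R2 S3.
  have /choice[phi phiP] : forall i, exists j, forall x, Rs i x <-> Ss j x.
    by move=> i; apply: S3.
  rewrite -[k]card_ord -[k']card_ord; apply: (@leq_card _ _ phi) => i j ij.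
  by apply: R2 => x; rewrite (phiP i) ij; apply: iff_sym.
have gg' : g = g' by apply/eqP; rewrite eqn_leq (le_g _ _ Ps Qs) ?(le_g _ _ Qs Ps).
have [j PQ] := Q3 _ (P1 (Ordinal g0)).
have {}PQ : Ps (Ordinal g0) = Qs j by apply/funext => x; apply/propext.
have [[iP _] p2] := P1 (Ordinal g0); have [re rf] := P4 (Ordinal g0).
have [re' rf'] := Q4 j; rewrite -PQ in re' rf'.
by split=> //; [exact: ram_index_uniq re re'|exact: res_degree_uniq rf rf'].
Qed.

Section Place.
Variables (v : algC -> rat) (vv : valuation v) (e f : nat) (lL : local_type (Lc c) v e f).

Let rL := subfield_subring (Lc_subfield c).
Let P := vprime c v.
Let iP : is_ideal c P := vprime_ideal c vv.

Let e_gt0 : 0 < e%:R :> rat.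
Proof.
case: (posnP e) => [e0|]; last by rewrite ltr0n.
by have [y [_ _ /eqP]] := local_unif lL; rewrite e0 mulr0 eq_sym oner_eq0.
Qed.

(** An element of [P] has a positive value in [(1/e) Z], hence one of at least [1/e]. *)
Let idpow_vge n x : idpow c P n x -> vge v (n%:R / e%:R) x.
Proof.
elim: n x => [|n IHn] x; first by rewrite mul0r; exact: vge_OL.
move=> [k [a [b [ab ->]]]]; apply: (big_ind (vge v (n.+1%:R / e%:R))).
- exact: vge0.
- by move=> y z; apply: vgeD.
move=> i _; have [/IHn va [[Lb _] mb]] := ab i.
have vb : vge v (1 / e%:R) (b i).
  move: mb; rewrite /vgt /vge; case: eqVneq => //= b0 b_gt0.
  have [m mE] := local_val lL Lb b0.
  have m0 : 0 < m%:~R :> rat by rewrite -mE mulr_gt0.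
  by rewrite ler_pdivrMr // mE ler1z; move: m0; rewrite ltr0z; lia.
by have := vgeM vv va vb; rewrite -mulrDl -natr1.
Qed.

(* Elements of [OL] outside [P] are invertible modulo every power of [P]. *)
Let idpow_localize n s x : OL c s -> veq v 0 s -> OL c x -> idpow c P n (s * x) -> idpow c P n x.
Proof.
move=> Os us Ox sx; have [k k0 sk] := unit_power vv lL (proj1 Os) us.
suff H j : (j <= n)%N -> idpow c P j x by apply: H.
elim: j => [//|j IHj] jn; have {IHj} xj := IHj (ltnW jn).
have Osk l : OL c (s ^+ l) by apply: (subringX rO).
(* The first term lies in the n-th power of [P], being a multiple of [s x]; the second gains one
   factor of [P] over the power known to contain [x]. *)
have -> : x = s ^+ k * x + - (x * (s ^+ k - 1)) by ring.
have [_ [_ [ID IM]]] := idpow_ideal j.+1 iP; apply: ID.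
  case: k k0 {sk} => // k _; rewrite exprSr -mulrA; apply: IM => //.
  exact: (idpow_le iP jn).
apply: (ideal_opp (idpow_ideal j.+1 iP)); apply: idprodM => //; split=> //.
by apply: (subringB rO) => //; apply: (subring1 rO).
Qed.

(** For an integral uniformizer [p] the quotient [x / p ^+ n] is [v]-integral, so some unit [t]
    brings it into the ring of integers; [t x] is then in the power of [P], and localisation removes
    [t]. *)
Let vge_idpow n x : OL c x -> vge v (n%:R / e%:R) x -> idpow c P n x.
Proof.
have [pi [Lpi pi0 vpi]] := local_unif lL.
have vpiE : v pi = 1 / e%:R := canRL (mulfK (lt0r_neq0 e_gt0)) vpi.
have pi_ge0 : vge v 0 pi by rewrite /vge vpiE divr_ge0 ?ltW ?orbT.
have [s [Os us Ospi]] := exists_unit_denominator vv Lpi pi_ge0.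
have vp : veq v (1 / e%:R) (s * pi).
  by have := veqM vv us (veq_val v pi0); rewrite add0r vpiE.
have [p0 _] := veqP _ _ _ vp.
have Pn k : idpow c P k ((s * pi) ^+ k).
  elim: k => [|k IHk]; first by rewrite expr0; apply: (subring1 rO).
  rewrite exprSr; apply: idprodM => //; split=> //.
  by apply: (vge_vgt (veq_vge vp)); rewrite divr_gt0.
move=> Ox vx; have vpn := veqX vv n vp.
have Ly : Lc c (x / (s * pi) ^+ n).
  apply: (subfield_div (Lc_subfield c)); first by case: Ox.
  by apply: (subringX rL); case: Ospi.
have y0 : vge v 0 (x / (s * pi) ^+ n).
  have := vge_divr vv vpn vx; by rewrite (_ : _ - _ = 0) //; ring.
have [t [Ot ut Oty]] := exists_unit_denominator vv Ly y0.
apply: (idpow_localize Ot ut Ox).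
have -> : t * x = t * (x / (s * pi) ^+ n) * (s * pi) ^+ n by rewrite -mulrA divfK // expf_neq0.
by have [_ [_ [_ IM]]] := idpow_ideal n iP; apply: IM.
Qed.

Lemma vprime_ram_index : ram_index c P e.
Proof.
split; first by apply: vge_idpow; [apply: (subring_nat rO)|rewrite divff ?gt_eqF // veq_vge ?veq_2].
move/idpow_vge; rewrite /vge pnatr_eq0 /= (val2 vv) ler_pdivrMr // mul1r ler_nat.
by rewrite ltnn.
Qed.

(** A residue basis of the field is moved into the ring of integers: [s b] is integral for a unit
    [s], and [s ^+ n * b] is congruent to [b] once [s ^+ n] is congruent to 1. *)
Lemma vprime_res_degree : res_degree c P f.
Proof.
have [b [b1 b2 b3]] := local_res lL.
have /choice[b' b'P] : forall i, exists b', OL c b' /\ vgt v 0 (b i - b').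
  move=> i; have [Lb b0] := b1 i.
  have [s [Os us Osb]] := exists_unit_denominator vv Lb b0.
  have [n n0 sn] := unit_power vv lL (proj1 Os) us.
  exists (s ^+ n * b i); split.
    case: n n0 {sn} => // n _; rewrite exprSr -mulrA.
    by apply: (subringM rO) => //; apply: (subringX rO).
  have -> : b i - s ^+ n * b i = - ((s ^+ n - 1) * b i) by ring.
  by rewrite vgtN // -[0]addr0; apply: vgtM.
have OB (eps : 'I_f -> bool) : OL c (\sum_i (eps i)%:R * b' i).
  apply: (ideal_sum OL_ideal) => i _; apply: (subringM rO); first by apply: (subring_nat rO).
  by have [] := b'P i.
have bb' (eps : 'I_f -> bool) : vgt v 0 (\sum_i (eps i)%:R * b i - \sum_i (eps i)%:R * b' i).
  rewrite -sumrB; apply: (big_ind (vgt v 0)); [exact: vgt0|by move=> y z; apply: vgtD|].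
  move=> i _; rewrite -mulrBr mulrC -[0]addr0; apply: vgtM => //; last by apply: vge_nat.
  by have [] := b'P i.
exists b'; split; first by move=> i; have [] := b'P i.
split.
  move=> eps [_ meps]; apply: b2; rewrite -(subrK (\sum_i (eps i)%:R * b' i) (\sum_i _)).
  exact: vgtD.
move=> x Ox; have [|eps H] := b3 x (proj1 Ox); first exact: vge_OL Ox.
exists eps; split; first by apply: (subringB rO).
by rewrite -(subrKA (\sum_i (eps i)%:R * b i)); apply: vgtD.
Qed.

End Place.

(** Chevalley's theorem for the localisation at [Q] gives [v] with centre inside [Q]. If some [x] in
    [Q] were a [v]-unit, [x ^+ n - 1] would lie in the centre for some [n > 0], hence in [Q], and so
    would 1. *)
Lemma prime_is_vprime Q e f : (forall v, valuation v -> local_type (Lc c) v e f) ->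
  prime_above2 c Q -> exists2 v, valuation v & forall x, Q x <-> vprime c v x.
Proof.
move=> lL [[iQ [Q1 Qprime]] Q2]; have [QO [Q0 [QD QM]]] := iQ.
pose R y := exists a s, [/\ OL c a, OL c s, ~ Q s & y = a / s].
have nQM s t : OL c s -> OL c t -> ~ Q s -> ~ Q t -> ~ Q (s * t).
  by move=> Os Ot Qs Qt /Qprime[].
have nQ0 s : ~ Q s -> s != 0 by move=> Qs; apply/eqP => s0; apply: Qs; rewrite s0.
have O1 := subring1 rO.
have [||v [vv Rv]] := @exists_valuation_dominating R.
- split; first by exists 1, 1; rewrite divr1.
  split=> _ _ [a [s [Oa Os Qs ->]]] [b [t [Ob Ot Qt ->]]].
    exists (a * t - b * s), (s * t); split; [| |exact: nQM|].
    + by apply: (subringB rO); apply: (subringM rO).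
    + exact: (subringM rO).
    + by field; rewrite !nQ0.
  exists (a * b), (s * t); split; [exact: (subringM rO)|exact: (subringM rO)|exact: nQM|].
  by rewrite invfM mulrACA.
- move=> [a [s [Oa Os Qs aE]]]; apply: (Qs); have -> : s = a * 2.
    have a2 : a = 2^-1 * s by rewrite aE divfK ?nQ0.
    by rewrite a2 mulrAC mulVf ?mul1r ?pnatr_eq0.
  exact: QM.
have vge_R y : R y -> vge v 0 y by move=> /Rv[->|]; rewrite /vge ?eqxx // => ->; rewrite orbT.
have Qunit s : OL c s -> ~ Q s -> veq v 0 s.
  move=> Os Qs; case: (vge_cases (vge_OL vv Os)) => // ms.
  have si : vge v 0 s^-1 by apply: vge_R; exists 1, s; rewrite mul1r.
  by have := vgtM vv ms si; rewrite addr0 mulfV ?nQ0 // => /(negP (veq_nvgt (veq1 vv))).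
have vQ x : vprime c v x -> Q x.
  by move=> [Ox mx]; apply: contrapT => /(Qunit _ Ox)/veq_nvgt; rewrite mx.
exists v => // x; split=> [Qx|]; last exact: vQ.
have Ox := QO _ Qx; split=> //; case: (vge_cases (vge_OL vv Ox)) => // ux.
have [n n0 xn] := unit_power vv (lL _ vv) (proj1 Ox) ux.
case: Q1; have -> : 1 = x ^+ n + - (x ^+ n - 1) by ring.
apply: QD; last first.
  apply: (ideal_opp iQ); apply: vQ; split=> //; apply: (subringB rO) => //; exact: (subringX rO).
case: n n0 {xn} => // n _; rewrite exprSr; apply: QM => //; exact: (subringX rO).
Qed.

(** The centre determines which integers are units, and fractions with unit denominators then
    determine the valuation ring. For [v x = m / e] the quotient [x ^+ e / 2 ^ m] is a unit for both
    valuations, which forces [w x]. *)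
Lemma vprime_inj v w e f : valuation v -> valuation w -> local_type (Lc c) v e f ->
  (forall x, vprime c v x <-> vprime c w x) -> agree (Lc c) v w.
Proof.
move=> vv vw lL PP.
have unitP u u' s : valuation u -> valuation u' -> (forall x, vprime c u' x -> vprime c u x) ->
    OL c s -> veq u 0 s -> veq u' 0 s.
  move=> vu vu' uu' Os us; case: (vge_cases (vge_OL vu' Os)) => // ms.
  have [_] : vprime c u s by apply: uu'.
  by rewrite (negPf (veq_nvgt us)).
have ge0 u u' x : valuation u -> valuation u' -> (forall x, vprime c u' x -> vprime c u x) ->
    Lc c x -> vge u 0 x -> vge u' 0 x.
  move=> vu vu' uu' Lx x0; have [s [Os us Osx]] := exists_unit_denominator vu Lx x0.
  have us' := unitP _ _ _ vu vu' uu' Os us; have [s0 _] := veqP _ _ _ us'.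
  by have := vge_divr vu' us' (vge_OL vu' Osx); rewrite subr0 mulrC mulKf.
have eq0 x : Lc c x -> veq v 0 x -> veq w 0 x.
  move=> Lx ux; have [x0 _] := veqP _ _ _ ux.
  have x_ge : vge w 0 x by apply: (ge0 v) => //; [move=> y /PP|exact: veq_vge].
  have xi_ge : vge w 0 x^-1.
    apply: (ge0 v) => //; [by move=> y /PP|exact: (subfieldV (Lc_subfield c))|].
    by apply: veq_vge; rewrite -[0]oppr0; apply: veqV.
  apply/veqP; split=> //; move: x_ge xi_ge; rewrite /vge invr_eq0 (negPf x0) /= (valV vw) //; lra.
move=> x Lx x0; have [m mE] := local_val lL Lx x0.
have rL := subfield_subring (Lc_subfield c).
have v2m u : valuation u -> veq u m%:~R (2 ^ m).
  move=> vu; case: m {mE} => n; rewrite ?NegzE ?mulrNz /exprz; last apply: (veqV vu).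
    by have := veqX vu n (veq_2 vu); rewrite mul1r.
  by have := veqX vu n.+1 (veq_2 vu); rewrite mul1r.
have L2m : Lc c (2 ^ m).
  case: m {mE v2m} => n; rewrite /exprz; last apply: (subfieldV (Lc_subfield c));
    by apply: (subringX rL); apply: (subring_nat rL).
have /(eq0 _ (subfield_div (Lc_subfield c) (subringX rL e Lx) L2m)) : veq v 0 (x ^+ e / 2 ^ m).
  by have := veqM vv (veqX vv e (veq_val v x0)) (veqV vv (v2m _ vv)); rewrite mE subrr.
move=> /(veq_uniq (veqM vw (veqX vw e (veq_val w x0)) (veqV vw (v2m _ vw)))) => wE.
have [y [_ _ ye]] := local_unif lL.
have e0 : e%:R != 0 :> rat by apply: contra_eq_neq ye => ->; rewrite mulr0 eq_sym oner_eq0.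
by apply: (mulIf e0); rewrite mE; lra.
Qed.

Lemma decomp2_of_total e f g : total_type (Lc c) e f g -> decomp2 c e f g.
Proof.
move=> [lL [vs [vvs inj_vs all_vs]]]; exists (fun i => vprime c (vs i)); split.
  by move=> i; exact: vprime_prime.
split; first by move=> i j ij; apply/inj_vs/(vprime_inj _ _ (lL _ (vvs i))).
split=> [P primeP|i]; last first.
  by split; [exact: vprime_ram_index (lL _ _)|exact: vprime_res_degree (lL _ _)].
have [w vw Pw] := prime_is_vprime lL primeP; have [i iw] := all_vs _ vw; exists i => x.
rewrite Pw /vprime /vgt; split=> -[Ox mx]; split=> //; move: mx; case: eqVneq => //= x0;
  by rewrite iw //; case: Ox.
Qed.

End Ideals.

(** * Conjugations *)

Lemma subfield_ratr K (a : rat) : subfieldP K -> K (ratr a).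
Proof.
move=> fK; have rK := subfield_subring fK.
by rewrite /ratr; apply: subfield_div => //; apply: (subring_int rK).
Qed.

Lemma subfield_adjoin_seq (K : algC -> Prop) (Q : fieldExtType rat) (QC : {rmorphism Q -> algC})
    (zs : seq Q) : subfieldP K -> (forall z, z \in zs -> K (QC z)) ->
  forall y, y \in <<1 & zs>>%VS -> K (QC y).
Proof.
move=> fK; have rK := subfield_subring fK.
elim/last_ind: zs => [|zs z IHzs] Kzs y.
  rewrite adjoin_nil subfield_closed => /vlineP[a ->].
  by rewrite alg_num_field fmorph_rat; exact: subfield_ratr.
rewrite adjoin_rcons => /Fadjoin_polyP[p /polyOverP Ep ->].
rewrite -horner_map; apply: (subring_horner rK); last first.
  by apply: Kzs; rewrite mem_rcons mem_head.
move=> i; rewrite coef_map; apply: IHzs => // w zs_w.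
by apply: Kzs; rewrite mem_rcons inE zs_w orbT.
Qed.

(** A finite list of generators places everything in a number field [Q] with subfield [E] generated
    by the list. There [X^2 - theta^2] is the minimal polynomial of [theta] over [E], and the
    resulting automorphism of [Q] extends to [algC]. The hypothesis on all subfields [S] expresses
    that [theta ^+ 2] lies in [E]. *)
Lemma exists_conjugation (K : algC -> Prop) (gens : seq algC) (theta : algC) :
  subfieldP K -> (forall z, z \in gens -> K z) ->
  (forall S, subfieldP S -> (forall z, z \in gens -> S z) -> S (theta ^+ 2)) -> ~ K theta ->
  exists nu : {rmorphism algC -> algC}, (forall z, z \in gens -> nu z = z) /\ nu theta = - theta.
Proof.
move=> fK Kgens gens_th2 nKth.
have [Q [QC [zs zsE genQ]]] := num_field_exists (rcons gens theta).
case/lastP: zs zsE genQ => [|zs th]; first by case: gens {Kgens gens_th2}.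
rewrite map_rcons => /rcons_inj[gensE thE]; rewrite adjoin_rcons => genQ.
pose E := <<1 & zs>>%AS.
have EK y : y \in E -> K (QC y).
  by apply: subfield_adjoin_seq => // z zs_z; apply: Kgens; rewrite -gensE map_f.
have nEth : th \notin E by apply/negP => /EK; rewrite thE.
have Eth2 : th ^+ 2 \in E.
  pose S y := exists2 x, x \in E & QC x = y.
  have [|z|x Ex] := gens_th2 S.
  - split; first by exists 1; rewrite ?mem1v ?rmorph1.
    split; first by move=> _ _ [x Ex <-] [y Ey <-]; exists (x - y); rewrite ?rpredB ?rmorphB.
    split; first by move=> _ _ [x Ex <-] [y Ey <-]; exists (x * y); rewrite ?rpredM ?rmorphM.
    by move=> _ [x Ex <-]; exists x^-1; rewrite ?rpredV ?fmorphV.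
  - by rewrite -gensE => /mapP[x zs_x ->]; exists x => //; apply: seqv_sub_adjoin.
  - by rewrite -thE -rmorphXn => /fmorph_inj <-.
have root_min : root (map_poly (\1%VF : 'End(Q)) (minPoly E th)) (- th).
  rewrite (kHom_poly_id (kHom1 E E)) ?minPolyOver //.
  pose p : {poly Q} := 'X^2 - (th ^+ 2)%:P.
  have Ep : p \is a polyOver E by rewrite rpredB ?rpredX ?polyOverX ?polyOverC.
  have size_p : size p = 3 by rewrite size_XnsubC.
  have rp x : root p x = (x ^+ 2 == th ^+ 2).
    by rewrite rootE !hornerE subr_eq0.
  have dvd : minPoly E th %| p by apply: minPoly_dvdp; rewrite // rp.
  have : minPoly E th %= p.
    rewrite -dvdp_size_eqp // eqn_leq dvdp_leq -?size_poly_gt0 ?size_p //=.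
    have := root_size_gt1 (monic_neq0 (monic_minPoly E th)) (root_minPoly E th).
    by have := adjoin_deg_eq1 E th; rewrite (negPf nEth) size_minPoly; case: adjoin_degree => [|[]].
  by move/eqp_root => ->; rewrite rp sqrrN.
pose phi := kHomExtend E \1 th (- th).
have homE : kHom 1 E (\1%VF : 'End(Q)) by rewrite kHom1.
have phim : monoid_morphism phi.
  by apply/kHom_monoid_morphism; rewrite -genQ; apply: (kHomExtendP (sub1v _) homE).
pose phimM := GRing.isMonoidMorphism.Build _ _ phi phim.
pose phiRM : {rmorphism _ -> _} := HB.pack (fun_of_lfun phi) phimM.
have [nu Dnu] := extend_algC_subfield_aut QC phiRM.
exists nu; split=> [z|].
  rewrite -gensE => /mapP[x zs_x ->]; rewrite -Dnu /= /phi kHomExtend_id ?id_lfunE //.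
  exact: seqv_sub_adjoin.
by rewrite -thE -Dnu /= /phi (kHomExtend_val homE) ?rmorphN.
Qed.

(** * The tower *)

Definition rational (x : algC) : Prop := x \in Crat.

Lemma rational_subfield : subfieldP rational.
Proof.
split; first exact: rpred1.
split; first by move=> x y Qx Qy; apply: rpredB.
split; first by move=> x y Qx Qy; apply: rpredM.
by move=> x Qx; rewrite /rational rpredV.
Qed.

Lemma rational_int (m : int) : rational m%:~R.
Proof. exact: rpred_int. Qed.

Lemma int_odd_part (m : int) : m != 0 -> exists (i : nat) (n : int), ~~ (2 %| n)%Z /\ m = 2 ^+ i * n.
Proof.
elim/ltn_ind: {m}`|m|%N {-2}m (erefl `|m|%N) => k IHk m mk m0.
have [m2|m2] := boolP (2 %| m)%Z; last by exists 0%N, m; rewrite expr0 mul1r.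
have [q mE] : exists q, m = 2 * q by exists (m %/ 2)%Z; lia.
have [i [n [odd_n qE]]] : exists (i : nat) (n : int), ~~ (2 %| n)%Z /\ q = 2 ^+ i * n.
  by apply: (IHk `|q|%N) => //; lia.
by exists i.+1, n; split=> //; rewrite mE qE exprS mulrA.
Qed.

Lemma rational_odd_part x : rational x -> x != 0 -> exists (i : int) (m n : int),
  [/\ ~~ (2 %| m)%Z, ~~ (2 %| n)%Z & x = 2 ^ i * (m%:~R / n%:~R)].
Proof.
move=> /CratP[q ->]; rewrite fmorph_eq0 /ratr => q0.
have [|i [m [odd_m mE]]] := @int_odd_part (numq q); first by rewrite numq_eq0.
have [|j [n [odd_n nE]]] := @int_odd_part (denq q); first exact: denq_neq0.
exists (i%:Z - j%:Z), m, n; split=> //; rewrite mE nE !intrM !rmorphXn /=.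
rewrite expfzDr ?pnatr_eq0 // -invr_expz -!exprnP invfM; ring.
Qed.

Lemma veq_2X v (i : int) : valuation v -> veq v i%:~R (2 ^ i).
Proof.
move=> vv; case: i => n; rewrite ?NegzE ?mulrNz /exprz; last apply: (veqV vv).
  by have := veqX vv n (veq_2 vv); rewrite mul1r.
by have := veqX vv n.+1 (veq_2 vv); rewrite mul1r.
Qed.

Lemma veq_odd_part v (i m n : int) : valuation v -> ~~ (2 %| m)%Z -> ~~ (2 %| n)%Z ->
  veq v i%:~R (2 ^ i * (m%:~R / n%:~R)).
Proof.
move=> vv odd_m odd_n.
have := veqM vv (veq_2X i vv) (veqM vv (veq_odd vv odd_m) (veqV vv (veq_odd vv odd_n))).
by rewrite oppr0 !addr0.
Qed.

Lemma rational_local v : valuation v -> local_type rational v 1 1.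
Proof.
move=> vv; split.
- move=> x Qx x0; have [i [m [n [odd_m odd_n ->]]]] := rational_odd_part Qx x0.
  by exists i; rewrite mulr1; have /veqP[_ ->] := veq_odd_part i vv odd_m odd_n.
- exists 2; rewrite pnatr_eq0 mulr1 (val2 vv); split=> //; exact: (rational_int 2).
exists (fun=> 1); split.
- by move=> i; split; [exact: (rational_int 1)|exact: (veq_vge (veq1 vv))].
- move=> eps; rewrite big_ord1 => meps i; rewrite [i]ord1.
  by move: meps; case: (eps ord0) => //; rewrite mulr1 (negPf (veq_nvgt (veq1 vv))).
move=> x Qx x0; suff [mx|mx] : vgt v 0 x \/ vgt v 0 (x - 1).
- by exists (fun=> false); rewrite big_ord1 mul0r subr0.
- by exists (fun=> true); rewrite big_ord1 mulr1.
have [xE|xn0] := eqVneq x 0; first by left; rewrite xE vgt0.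
have [i [m [n [odd_m odd_n xE]]]] := rational_odd_part Qx xn0.
have vx := veq_odd_part i vv odd_m odd_n; rewrite -xE in vx.
case: (vge_cases x0) => [ux|]; last by left.
have i0 : i = 0 by apply/eqP; rewrite -(intr_eq0 rat); apply/eqP/(veq_uniq vx ux).
have vn := veq_odd vv odd_n; have [n0 _] := veqP _ _ _ vn.
right; have -> : x - 1 = (m - n)%:~R * n%:~R^-1.
  by rewrite xE i0 expr0z mul1r intrB mulrBl mulfV.
rewrite -[0]addr0; apply: vgtM => //; last by apply: veq_vge; rewrite -[0]oppr0; exact: veqV.
by apply: (vge_vgt (@vge_dvdz _ vv 1 _ _)) => //; lia.
Qed.

(** Existence is Chevalley's theorem for the integers; uniqueness holds because [v 2 = 1] fixes the
    value of [2 ^ i] times a quotient of odd integers. *)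
Lemma rational_total : total_type rational 1 1 1.
Proof.
split; first exact: rational_local.
have [v [vv _]] : exists v, valuation v /\ forall x, x \is a Num.int -> x = 0 \/ 0 <= v x.
  apply: (@exists_valuation_dominating (fun x => x \is a Num.int)).
    split; first exact: rpred1.
    by split=> x y Zx Zy; [exact: rpredB|exact: rpredM].
  move=> /intrP[m mE]; have : (1 : int)%:~R = (2 * m)%:~R :> algC.
    by rewrite intrM -mE mulfV // pnatr_eq0.
  by move/intr_inj; lia.
exists (fun=> v); split=> // [i j _|w vw]; first by rewrite [i]ord1 [j]ord1.
exists ord0 => x Qx x0; have [i [m [n [odd_m odd_n xE]]]] := rational_odd_part Qx x0.
have /veqP[_] := veq_odd_part i vv odd_m odd_n.
by have /veqP[_] := veq_odd_part i vw odd_m odd_n; rewrite -xE => -> ->.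
Qed.

(* For [theta ^ 2 = d], these say how [v] behaves in [K(theta) / K] through a good approximation [q]
   of [k theta] in [K]: put [y = k theta / q - 1], so that [y (y + 2) = (k^2 d - q^2) / q^2]. *)
Definition ramified_at (K : algC -> Prop) (v : algC -> rat) (e : nat) (d : algC) : Prop :=
  (exists r n, [/\ veq v r d, ~~ (2 %| n)%Z & r * e%:R = n%:~R]) \/
  (exists k q rq r n, [/\ K k, K q, k != 0 & veq v rq q] /\
     [/\ veq v r (k ^+ 2 * d - q ^+ 2), r < 2 + 2 * rq, ~~ (2 %| n)%Z & (r - 2 * rq) * e%:R = n%:~R]).

Definition inert_at (K : algC -> Prop) (v : algC -> rat) (d : algC) : Prop :=
  exists k q rq, [/\ K k, K q, k != 0, veq v rq q & veq v (2 + 2 * rq) (k ^+ 2 * d - q ^+ 2)].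

Definition split_at (K : algC -> Prop) (v : algC -> rat) (d : algC) : Prop :=
  exists k q rq, [/\ K k, K q, k != 0, veq v rq q & vgt v (2 + 2 * rq) (k ^+ 2 * d - q ^+ 2)].

Section Approximation.
Variables (K : algC -> Prop) (theta : algC) (tau : {rmorphism algC -> algC}).
Hypotheses (fK : subfieldP K) (Kth2 : K (theta ^+ 2)) (th0 : theta != 0).
Hypotheses (tauK : forall x, K x -> tau x = x) (tau_theta : tau theta = - theta).
Variables (v : algC -> rat) (vv : valuation v).

Let K' := adjoin K theta.
Let fK' : subfieldP K' := adjoin_subfield fK Kth2 tauK tau_theta.
Let rK' := subfield_subring fK'.

Let approx_mem k q : K k -> K q -> K' (k * theta / q - 1).
Proof.
move=> Kk Kq; apply: (subringB rK'); last by apply: (subring1 rK').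
apply: (subfield_div fK'); last exact: (adjoin_base _ fK).
by apply: (subringM rK'); [exact: (adjoin_base _ fK)|exact: (adjoin_gen _ fK)].
Qed.

Let approx_eq k q : q != 0 -> let y := k * theta / q - 1 in
  y * (y + 2) = (k ^+ 2 * theta ^+ 2 - q ^+ 2) / q ^+ 2.
Proof. by move=> q0 /=; field. Qed.

(** Here [y (y + 2)] has value below 2, which forces [v y < 1] and [v (y + 2) = v y]. So [v y] is
    half of an odd multiple of [1/e]. *)
Lemma ramified_atP e : ramified_at K v e (theta ^+ 2) ->
  exists x, [/\ K' x, x != 0 & forall m : int, v x * e%:R != m%:~R].
Proof.
have odd_half (r : rat) n m : ~~ (2 %| n)%Z -> r * e%:R = n%:~R -> r / 2 * e%:R != m%:~R.
  move=> odd_n rn; apply/eqP => rm; case/negP: odd_n; suff -> : n = 2 * m by lia.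
  by apply: (@intr_inj rat); rewrite intrM -rn -rm; field.
move=> [[r [n [vd odd_n rn]]]|[k [q [rq [r [n [[Kk Kq k0 vq] [vd r2 odd_n rn]]]]]]]].
  exists theta; split=> // [|m]; first exact: (adjoin_gen _ fK).
  by have /veqP[_ ->] := veq_sqrt vv vd; exact: odd_half rn.
have [q0 _] := veqP _ _ _ vq; have K'y := approx_mem Kk Kq.
have yE := approx_eq k q0; move: yE K'y; set y := k * theta / q - 1 => yE K'y.
have vyE : veq v (r - 2 * rq) (y * (y + 2)).
  by rewrite yE; have := veqM vv vd (veqV vv (veqX vv 2 vq)); rewrite mulr_natr mulr2n [2 * rq]mulr_natl.
have [yy0 _] := veqP _ _ _ vyE; move: (yy0); rewrite mulf_eq0 negb_or => /andP[y0 y20].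
have vy1 : v y < 1.
  rewrite ltNge; apply/negP => y1; have vy : vge v 1 y by rewrite /vge y1 orbT.
  have := vgeM vv vy (vgeD vv vy (veq_vge (veq_2 vv))).
  by rewrite /vge (negPf yy0) /= (proj2 (veqP _ _ _ vyE)); lra.
have vy : veq v (v y + v y) (y * (y + 2)).
  apply: veqM => //; first exact: veq_val; apply: veqD => //; first exact: veq_val.
  exact: (vge_vgt (veq_vge (veq_2 vv))).
exists y; split=> // m; have -> : v y = (r - 2 * rq) / 2 by have := veq_uniq vy vyE; lra.
exact: odd_half rn.
Qed.

(** With [w = y / 2] the element [w^2 + w = y (y + 2) / 4] is a unit of [K]; over the residue field
    F_2 it is congruent to 1. *)
Lemma inert_atP : residue_basis K v 1 -> inert_at K v (theta ^+ 2) ->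
  exists w, [/\ K' w, vge v 0 w & vgt v 0 (w ^+ 2 + w + 1)].
Proof.
move=> rK [k [q [rq [Kk Kq k0 vq vd]]]].
have [q0 _] := veqP _ _ _ vq; have K'y := approx_mem Kk Kq.
have yE := approx_eq k q0; move: yE K'y; set y := k * theta / q - 1 => yE K'y.
have vD : veq v 0 ((k ^+ 2 * theta ^+ 2 - q ^+ 2) / q ^+ 2 / 2 ^+ 2).
  have := veqM vv (veqM vv vd (veqV vv (veqX vv 2 vq))) (veqV vv (veqX vv 2 (veq_2 vv))).
  by congr veq; ring.
have KD : K ((k ^+ 2 * theta ^+ 2 - q ^+ 2) / q ^+ 2 / 2 ^+ 2).
  have rK0 := subfield_subring fK.
  apply: (subfield_div fK); last by apply: (subringX rK0); apply: (subring_nat rK0).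
  apply: (subfield_div fK); last by apply: (subringX rK0).
  by apply: (subringB rK0); [apply: (subringM rK0) => //|]; apply: (subringX rK0).
move: vD KD; rewrite -yE; set D := _ / _ => vD KD.
have wE : (y / 2) ^+ 2 + y / 2 = D by rewrite /D; field.
have K'w : K' (y / 2) by apply: (subfield_div fK') => //; apply: (subring_nat rK').
exists (y / 2); split=> //.
  rewrite /vge; case: eqVneq => //= w0; rewrite leNgt; apply/negP => vw.
  have : veq v (v (y / 2) * 2) ((y / 2) ^+ 2 + y / 2).
    apply: veqD; [exact: vv|by apply: veqX; rewrite // veq_val|rewrite /vgt; apply/orP; right; lra].
  by rewrite wE => /(veq_uniq vD); lra.
rewrite wE; have [|mD] := residue_F2 vv fK rK KD (veq_vge vD).
  by rewrite (negPf (veq_nvgt vD)).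
have -> : D + 1 = (D - 1) + 2 by ring.
by apply: vgtD => //; apply: (vge_vgt (veq_vge (veq_2 vv))).
Qed.

(** Conjugation sends [y] to [- (y + 2)]. Equal values of [y] and [y + 2] would both exceed 1,
    against their difference 2 of value 1. *)
Lemma split_atP : split_at K v (theta ^+ 2) -> exists x, [/\ K' x, x != 0 & v (tau x) != v x].
Proof.
move=> [k [q [rq [Kk Kq k0 vq vd]]]].
have [q0 _] := veqP _ _ _ vq; have K'y := approx_mem Kk Kq.
have yE := approx_eq k q0; move: yE K'y; set y := k * theta / q - 1 => yE K'y.
have tauy : tau y = - (y + 2).
  by rewrite /y rmorphB rmorph1 !rmorphM fmorphV (tauK Kk) (tauK Kq) tau_theta; field.
have mD : vgt v 2 (y * (y + 2)).
  rewrite yE; have := vgtM vv vd (veq_vge (veqV vv (veqX vv 2 vq))).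
  by congr vgt; ring.
have [y0|y0] := eqVneq y 0.
  move/eqP: tauy; rewrite y0 rmorph0 add0r eq_sym oppr_eq0 pnatr_eq0 //.
exists y; split=> //; rewrite tauy valN //; apply/eqP => vyE.
have y20 : y + 2 != 0 by rewrite -oppr_eq0 -tauy fmorph_eq0.
move: mD; rewrite /vgt mulf_eq0 (negPf y0) (negPf y20) /= (valM vv) // vyE => vy.
have : vgt v 1 (y + 2 - y).
  by apply: vgtB => //; rewrite /vgt; apply/orP; right; lra.
by rewrite addrC addKr (negPf (veq_nvgt (veq_2 vv))).
Qed.

End Approximation.

Definition quadratic_extension (K : algC -> Prop) (theta : algC) : Prop :=
  [/\ subfieldP K, K (theta ^+ 2), ~ K theta &
    exists tau : {rmorphism algC -> algC}, (forall x, K x -> tau x = x) /\ tau theta = - theta].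

Section QuadraticExtension.
Variables (K : algC -> Prop) (theta : algC) (qK : quadratic_extension K theta).

Lemma quadratic_subfield : subfieldP (adjoin K theta).
Proof. by have [fK Kth2 _ [tau [tauK tau_th]]] := qK; apply: adjoin_subfield tau_th. Qed.

Lemma quadratic_gen_neq0 : theta != 0.
Proof.
by have [fK _ nK _] := qK; apply/eqP => th0; apply: nK; rewrite th0; apply: (subring0 (subfield_subring fK)).
Qed.

Lemma total_ramified_at e f g : total_type K e f g ->
  (forall v, valuation v -> ramified_at K v e (theta ^+ 2)) -> total_type (adjoin K theta) (2 * e) f g.
Proof.
have [fK Kth2 _ [tau [tauK tau_th]]] := qK => tK H.
have th0 := quadratic_gen_neq0.
apply: (total_ramified fK Kth2 th0 tauK tau_th tK) => v vv.
exact: (ramified_atP fK Kth2 th0 tauK tau_th vv (H _ vv)).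
Qed.

Lemma total_inert_at e g : total_type K e 1 g ->
  (forall v, valuation v -> inert_at K v (theta ^+ 2)) -> total_type (adjoin K theta) e 2 g.
Proof.
have [fK Kth2 _ [tau [tauK tau_th]]] := qK => tK H.
apply: (total_inert fK Kth2 tauK tau_th tK) => v vv.
exact: (inert_atP fK Kth2 tauK tau_th vv (local_res (proj1 tK _ vv)) (H _ vv)).
Qed.

Lemma total_split_at e f g : total_type K e f g ->
  (forall v, valuation v -> split_at K v (theta ^+ 2)) -> total_type (adjoin K theta) e f (g + g).
Proof.
have [fK Kth2 _ [tau [tauK tau_th]]] := qK => tK H.
apply: (total_split fK Kth2 tauK tau_th tK) => v vv.
exact: (split_atP fK Kth2 tauK tau_th vv (H _ vv)).
Qed.

(** Fixing [(p + q theta)^2] under conjugation means [4 p q theta = 0]. This reduces squares in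
    [K(theta)] to squares in [K] up to a factor [theta ^+ 2]. *)
Lemma quadratic_square x : adjoin K theta x -> K (x ^+ 2) -> K x \/ exists2 y, K y & x = y * theta.
Proof.
have [fK Kth2 _ [tau [tauK tau_th]]] := qK => -[p [q [Kp Kq ->]]] /tauK.
rewrite rmorphXn rmorphD rmorphM (tauK _ Kp) (tauK _ Kq) tau_th => E.
have : 4 * (p * q) * theta = 0.
  have -> : 4 * (p * q) * theta = (p + q * theta) ^+ 2 - (p + q * - theta) ^+ 2 by ring.
  by rewrite E subrr.
move/eqP; rewrite !mulf_eq0 pnatr_eq0 (negPf quadratic_gen_neq0) orbF /= => /orP[|] /eqP ->.
  by right; exists q; rewrite ?add0r.
by left; rewrite mul0r addr0.
Qed.

End QuadraticExtension.

Lemma rational_sqrt_int x (m : int) : rational x -> x ^+ 2 = m%:~R -> exists z : int, m = z ^+ 2.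
Proof.
move=> Qx xE; have Ax : x \in Aint.
  apply: (@root_monic_over_Aint 2 (fun i => if i == 0%N then (- m)%:~R else 0)).
    by move=> i; case: ifP => _; [exact: Aint_int|exact: Aint0].
  by rewrite big_ord_recl big_ord1 /= xE expr0 mulr1 mul0r addr0 mulrNz subrr.
have /intrP[z zE] := Cint_rat_Aint Qx Ax; exists z.
by apply: (@intr_inj algC); rewrite -xE zE rmorphXn.
Qed.

Lemma aut_rational (nu : {rmorphism algC -> algC}) x : rational x -> nu x = x.
Proof. by move=> /CratP[q ->]; exact: fmorph_rat. Qed.

Section Tower.
Variables (c : int) (s t al : algC).
Hypotheses (hc1 : ~ exists z : int, - c = z ^+ 2) (hc2 : ~ exists z : int, - (c + 1) = z ^+ 2).
Hypotheses (sE : s ^+ 2 = (- c)%:~R) (tE : t ^+ 2 = (- (c + 1))%:~R) (alE : al ^+ 2 = s * (s + 1)).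

Let a : int := - c.
Let b : int := - (c + 1).

(** [a (a - 1)] lies strictly between consecutive squares unless [a] is 0 or 1, and these are
    squares, excluded by [hc1]. *)
Let ab_nonsquare : ~ exists z : int, a * b = z ^+ 2.
Proof.
move=> [z zE]; have ba : b = a - 1 by rewrite /a /b; lia.
rewrite ba in zE; have [a0|[a1|]] : a = 0 \/ a = 1 \/ (a < 0 \/ 1 < a) by lia.
- by apply: hc1; exists 0; rewrite -/a a0.
- by apply: hc1; exists 1; rewrite -/a a1.
- have : `|z| ^+ 2 = a * (a - 1) by rewrite zE real_normK // num_real.
  have : 0 <= `|z| by []. move: `|z| => y y0 yE [a0|a1].
    have : y < - a + 1 by rewrite expr2 in yE; nia.
    by rewrite expr2 in yE; nia.
  have : y < a by rewrite expr2 in yE; nia.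
  by rewrite expr2 in yE; nia.
Qed.

Let nQs : ~ rational s.
Proof. by move=> /rational_sqrt_int/(_ sE). Qed.

Let K1 := adjoin rational s.

Lemma tower1 : quadratic_extension rational s.
Proof.
split; [exact: rational_subfield|rewrite sE; exact: rational_int|exact: nQs|].
have [|S fS _|nu [_ nu_s]] := @exists_conjugation rational [::] s rational_subfield _ _ nQs => //.
  by rewrite sE; apply: (subring_int (subfield_subring fS)).
by exists nu; split=> // x; exact: aut_rational.
Qed.

Let fK1 : subfieldP K1 := quadratic_subfield tower1.
Let K1s : K1 s := adjoin_gen _ rational_subfield.
Let K1Q x : rational x -> K1 x. Proof. exact: (adjoin_base _ rational_subfield). Qed.

(** Either [t] is rational and [b] is a square, or [t = q s] and [a b = (q a)^2]. *)
Let nK1t : ~ K1 t.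
Proof.
move=> K1t; have Qt2 : rational (t ^+ 2) by rewrite tE; exact: rational_int.
case: (quadratic_square tower1 K1t Qt2) => [Qt|[q Qq tq]].
  by apply: hc2; exact: rational_sqrt_int tE.
apply: ab_nonsquare; apply: (@rational_sqrt_int (q * a%:~R)).
  by apply: rpredM => //; exact: rational_int.
by rewrite intrM -tE tq !exprMn sE /a; ring.
Qed.

Lemma tower2 : quadratic_extension K1 t.
Proof.
have K1t2 : K1 (t ^+ 2) by rewrite tE; apply/K1Q/rational_int.
split=> //; have [|S fS _|nu [nu_s nu_t]] := @exists_conjugation K1 [:: s] t fK1 _ _ nK1t.
- by move=> z; rewrite inE => /eqP->.
- by rewrite tE; apply: (subring_int (subfield_subring fS)).
exists nu; split=> // _ [p [q [Qp Qq ->]]].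
by rewrite rmorphD rmorphM (aut_rational nu Qp) (aut_rational nu Qq) nu_s // mem_head.
Qed.

Let K2 := adjoin K1 t.
Let fK2 : subfieldP K2 := quadratic_subfield tower2.
Let K2t : K2 t := adjoin_gen _ fK1.
Let K2K1 x : K1 x -> K2 x. Proof. exact: (adjoin_base _ fK1). Qed.

Let K1d : K1 (al ^+ 2).
Proof.
have rK1 := subfield_subring fK1; rewrite alE; apply: (subringM rK1) => //.
by apply: (subringD rK1) => //; apply: (subring1 rK1).
Qed.

Let nK2al : ~ K2 al.
Proof.
have [_ _ _ [tau [tauQ tau_s]]] := tower1.
(* the norm of [s (s + 1)] from [K1] to [Q] is [a b] *)
have normE : al ^+ 2 * tau (al ^+ 2) = (a * b)%:~R.
  rewrite alE rmorphM rmorphD rmorph1 tau_s.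
  have -> : s * (s + 1) * (- s * (- s + 1)) = s ^+ 2 * (s ^+ 2 - 1) by ring.
  by rewrite sE intrM -[1]/(1%:~R) -intrB; congr (_ * _%:~R); rewrite /b; lia.
have QN x : K1 x -> rational (x * tau x).
  by move=> K1x; apply: (adjoin_norm rational_subfield _ tauQ tau_s K1x); rewrite sE; exact: rational_int.
(* Now [al] is in [K1], or it is [y t] with [y] in [K1]. Norms to the rationals make [a b] the
   square of the norm of [al], or of the norm of [y] times [b]. *)
move=> K2al; case: (quadratic_square tower2 K2al K1d) => [K1al|[y K1y aly]]; apply: ab_nonsquare.
  by apply: (rational_sqrt_int (QN _ K1al)); rewrite -normE rmorphXn; ring.
apply: (@rational_sqrt_int (y * tau y * b%:~R)).
  by apply: rpredM; [exact: QN|exact: rational_int].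
have al2E : al ^+ 2 = y ^+ 2 * b%:~R by rewrite aly exprMn tE.
have -> : (a * b)%:~R = (y ^+ 2 * b%:~R) * (tau y ^+ 2 * b%:~R).
  by rewrite -normE al2E [tau _]rmorphM (tauQ _ (rational_int _)) rmorphXn.
ring.
Qed.

Lemma tower3 : quadratic_extension K2 al.
Proof.
split=> //; first exact: K2K1.
have [|S fS gS|nu [nu_st nu_al]] := @exists_conjugation K2 [:: s; t] al fK2 _ _ nK2al.
- by move=> z; rewrite !inE => /orP[] /eqP-> //; exact: K2K1.
- have rS := subfield_subring fS; rewrite alE; apply: (subringM rS); first by apply: gS; rewrite mem_head.
  by apply: (subringD rS); [apply: gS; rewrite mem_head|apply: (subring1 rS)].
have nu_K1 x : K1 x -> nu x = x.
  move=> [p [q [Qp Qq ->]]].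
  by rewrite rmorphD rmorphM (aut_rational nu Qp) (aut_rational nu Qq) nu_st // mem_head.
exists nu; split=> // _ [p [q [K1p K1q ->]]].
by rewrite rmorphD rmorphM (nu_K1 _ K1p) (nu_K1 _ K1q) nu_st // !inE eqxx orbT.
Qed.

Let s0 : s != 0. Proof. exact: quadratic_gen_neq0 tower1. Qed.
Let al0 : al != 0. Proof. exact: quadratic_gen_neq0 tower3. Qed.

(** With [c = - s ^+ 2] the polynomial is [(x^2 - s (s + 1)) (x^2 - s (s - 1))]. Its roots are [al],
    [be = s t / al] and their negatives; conversely [s = al ^+ 2 - s ^+ 2] and [t = be * al / s]. *)
Lemma tower_Lc : adjoin K2 al = Lc c.
Proof.
have fK3 := quadratic_subfield tower3; have rK3 := subfield_subring fK3.
have cE : c%:~R = - s ^+ 2 :> algC by rewrite sE mulrNz opprK.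
pose be := s * t / al.
have beE : be ^+ 2 = s * (s - 1).
  have s1 : s + 1 != 0 by move: al0; rewrite -sqrf_eq0 alE mulf_eq0 negb_or => /andP[].
  rewrite !exprMn exprVn alE tE (_ : (- (c + 1))%:~R = s ^+ 2 - 1); first by field; rewrite s1 s0.
  by rewrite sE -[1]/(1%:~R) -intrB; congr (_%:~R); lia.
have rootE r : root (fc c) r = (r ^+ 2 == al ^+ 2) || (r ^+ 2 == be ^+ 2).
  rewrite rootE /fc !(hornerD, horner_exp, hornerX, hornerC) cE alE beE.
  have -> : (r ^+ 2 + - s ^+ 2) ^+ 2 + - s ^+ 2 = (r ^+ 2 - s * (s + 1)) * (r ^+ 2 - s * (s - 1)) by ring.
  by rewrite mulf_eq0 !subr_eq0.
have K3al : adjoin K2 al al by exact: (adjoin_gen _ fK2).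
have K3be : adjoin K2 al be.
  apply: (subfield_div fK3) => //; apply: (adjoin_base _ fK2).
  by apply: (subringM (subfield_subring fK2)) => //; exact: K2K1.
apply/funext => x; apply/propext; split=> [|Lx]; last first.
  apply: Lx => // r; rewrite rootE !eqf_sqr -orbA.
  by case/or4P => /eqP-> //; apply: (subringN rK3).
move=> K3x S fS rS; have rS' := subfield_subring fS.
have Sal : S al by apply: rS; rewrite rootE eqxx.
have Sbe : S be by apply: rS; rewrite rootE eqxx orbT.
have Ss : S s.
  have -> : s = al ^+ 2 - s ^+ 2 by rewrite alE; ring.
  apply: (subringB rS'); first by apply: (subringX rS').
  by rewrite sE; apply: (subring_int rS').
have St : S t.
  have -> : t = be * al / s by rewrite /be; field; rewrite s0 al0.
  by apply: (subfield_div fS) => //; apply: (subringM rS').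
have SQ y : rational y -> S y by move=> /CratP[q ->]; exact: subfield_ratr.
have lift (K : algC -> Prop) th y : S th -> (forall z, K z -> S z) -> adjoin K th y -> S y.
  move=> Sth KS [p [q [/KS Sp /KS Sq ->]]]; apply: (subringD rS') => //; exact: (subringM rS').
apply: (lift _ _ _ Sal _ K3x) => y; apply: (lift _ _ _ St) => z; exact: (lift _ _ _ Ss).
Qed.

End Tower.

(** * Kinds of steps and their composition along the tower *)

Inductive kind := Ram | Inert | Split.

Definition step_at (kd : kind) K v e d : Prop :=
  match kd with
  | Ram => ramified_at K v e d
  | Inert => inert_at K v d
  | Split => split_at K v d
  end.

Definition next (kd : kind) (T : nat * nat * nat) : nat * nat * nat :=
  let: (e, f, g) := T in
  match kd with Ram => (2 * e, f, g)%N | Inert => (e, 2%N, g) | Split => (e, f, (g + g)%N) end.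

Definition total_type3 K (T : nat * nat * nat) : Prop := total_type K T.1.1 T.1.2 T.2.

Lemma total_step kd K theta T : quadratic_extension K theta -> total_type3 K T ->
  (kd = Inert -> T.1.2 = 1%N) ->
  (forall v, valuation v -> step_at kd K v T.1.1 (theta ^+ 2)) ->
  total_type3 (adjoin K theta) (next kd T).
Proof.
case: T => [[e f] g]; rewrite /total_type3 /= => qK tK; case: kd => /= f1 H.
- exact: total_ramified_at.
- by rewrite f1 // in tK; exact: total_inert_at.
- exact: total_split_at.
Qed.

(** Only what the local computations use: [K1] and [K2] are any nested subfields containing [s] and
    [t], so a class is settled without unfolding the tower. *)
Record tower_context (a : int) (K1 K2 : algC -> Prop) (s t : algC) (v : algC -> rat) : Prop :=
  TowerContext {
    ctx_field1 : subfieldP K1;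
    ctx_field2 : subfieldP K2;
    ctx_s : K1 s;
    ctx_t : K2 t;
    ctx_sub : forall x, K1 x -> K2 x;
    ctx_s2 : s ^+ 2 = a%:~R;
    ctx_t2 : t ^+ 2 = a%:~R - 1;
    ctx_val : valuation v }.

Definition tower_steps (a : int) (k1 k2 k3 : kind) : Prop :=
  forall K1 K2 s t v, tower_context a K1 K2 s t v ->
  [/\ step_at k1 rational v 1 a%:~R,
      step_at k2 K1 v (next k1 (1, 1, 1)%N).1.1 (a%:~R - 1) &
      step_at k3 K2 v (next k2 (next k1 (1, 1, 1)%N)).1.1 (s * (s + 1))].

(** The inert criterion works over the residue field F_2, so an inert step must find [f = 1];
    accordingly [next] sets [f] to 2 outright. *)
Definition at_most_one_inert k1 k2 k3 : bool :=
  match k1, k2, k3 with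
  | Inert, Inert, _ | Inert, _, Inert | _, Inert, Inert => false
  | _, _, _ => true
  end.

Definition decomp_type k1 k2 k3 : nat * nat * nat := next k3 (next k2 (next k1 (1, 1, 1)%N)).

Lemma decomp2_of_steps c k1 k2 k3 :
  ~ (exists z : int, - c = z ^+ 2) -> ~ (exists z : int, - (c + 1) = z ^+ 2) ->
  at_most_one_inert k1 k2 k3 -> tower_steps (- c) k1 k2 k3 ->
  let T := decomp_type k1 k2 k3 in decomp2 c T.1.1 T.1.2 T.2.
Proof.
move=> hc1 hc2 ok H T.
pose s : algC := sqrtC (- c)%:~R; pose t : algC := sqrtC (- (c + 1))%:~R; pose al := sqrtC (s * (s + 1)).
have sE : s ^+ 2 = (- c)%:~R by rewrite sqrtCK.
have tE : t ^+ 2 = (- (c + 1))%:~R by rewrite sqrtCK.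
have alE : al ^+ 2 = s * (s + 1) by rewrite sqrtCK.
have tE' : t ^+ 2 = (- c)%:~R - 1 by rewrite tE opprD intrD mulrN1z.
have fK1 := quadratic_subfield (tower1 hc1 sE).
have ctx v (vv : valuation v) : tower_context (- c) (adjoin rational s) (adjoin (adjoin rational s) t) s t v.
  split=> //; first exact: quadratic_subfield (tower2 hc1 hc2 sE tE).
  - exact: (adjoin_gen _ rational_subfield).
  - exact: (adjoin_gen _ fK1).
  - by move=> x; exact: (adjoin_base _ fK1).
have H' v (vv : valuation v) := H _ _ s t v (ctx v vv).
apply: decomp2_of_total; rewrite -(tower_Lc hc1 hc2 sE tE alE).
have tot1 : total_type3 (adjoin rational s) (next k1 (1, 1, 1)%N).
  apply: (@total_step k1 _ _ (1, 1, 1)%N (tower1 hc1 sE) rational_total) => // v /H'[+ _ _].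
  by rewrite sE.
have tot2 : total_type3 (adjoin (adjoin rational s) t) (next k2 (next k1 (1, 1, 1)%N)).
  apply: (total_step (tower2 hc1 hc2 sE tE) tot1) => [k2E|v /H'[_ + _]].
    by move: ok; rewrite k2E; case: (k1).
  by rewrite tE'.
apply: (total_step (tower3 hc1 hc2 sE tE alE) tot2) => [k3E|v /H'[_ _ +]].
  by move: ok; rewrite k3E; case: (k1) => //; case: (k2).
by rewrite alE.
Qed.

(** * Criteria up to square factors, and values of sums and factors *)

Lemma ramifiedI_val K v e d r n : veq v r d -> ~~ (2 %| n)%Z -> r * e%:R = n%:~R -> ramified_at K v e d.
Proof. by move=> vd odd_n rn; left; exists r, n. Qed.

Section Intro.
Variables (K : algC -> Prop) (v : algC -> rat) (d P d' q : algC) (rq : rat).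

Let dE' : P != 0 -> d = P ^+ 2 * d' -> P^-1 ^+ 2 * d = d'.
Proof. by move=> P0 dE; rewrite dE exprVn mulKf // expf_neq0. Qed.

(** A square factor [P ^+ 2] of the radicand is removed by taking [k = P^-1] in the criterion; the
    approximation [q] is then one of the square root of [d']. *)
Lemma ramifiedI e r n : subfieldP K -> K P -> P != 0 -> d = P ^+ 2 * d' -> K q -> veq v rq q ->
  veq v r (d' - q ^+ 2) -> r < 2 + 2 * rq -> ~~ (2 %| n)%Z ->
  (r - 2 * rq) * e%:R = n%:~R -> ramified_at K v e d.
Proof.
move=> fK KP P0 dE Kq vq vd lt_r odd_n rn; right; exists P^-1, q, rq, r, n.
by rewrite (dE' P0 dE) invr_eq0; split=> //; split=> //; exact: subfieldV.
Qed.

Lemma inertI : subfieldP K -> K P -> P != 0 -> d = P ^+ 2 * d' -> K q -> veq v rq q ->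
  veq v (2 + 2 * rq) (d' - q ^+ 2) -> inert_at K v d.
Proof.
move=> fK KP P0 dE Kq vq vd; exists P^-1, q, rq.
by rewrite (dE' P0 dE) invr_eq0; split=> //; exact: subfieldV.
Qed.

Lemma splitI : subfieldP K -> K P -> P != 0 -> d = P ^+ 2 * d' -> K q -> veq v rq q ->
  vgt v (2 + 2 * rq) (d' - q ^+ 2) -> split_at K v d.
Proof.
move=> fK KP P0 dE Kq vq vd; exists P^-1, q, rq.
by rewrite (dE' P0 dE) invr_eq0; split=> //; exact: subfieldV.
Qed.
End Intro.

Section IntroUnscaled.
Variables (K : algC -> Prop) (v : algC -> rat) (d q : algC) (rq : rat).

Let dE : d = 1 ^+ 2 * d. Proof. by rewrite expr1n mul1r. Qed.
Let K1 : subfieldP K -> K 1. Proof. by move/subfield_subring/subring1. Qed.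

Lemma ramifiedI1 e r n : subfieldP K -> K q -> veq v rq q ->
  veq v r (d - q ^+ 2) -> r < 2 + 2 * rq -> ~~ (2 %| n)%Z ->
  (r - 2 * rq) * e%:R = n%:~R -> ramified_at K v e d.
Proof. by move=> fK; apply: (ramifiedI fK (K1 fK) (oner_neq0 _) dE). Qed.

Lemma inertI1 : subfieldP K -> K q -> veq v rq q ->
  veq v (2 + 2 * rq) (d - q ^+ 2) -> inert_at K v d.
Proof. by move=> fK; apply: (inertI fK (K1 fK) (oner_neq0 _) dE). Qed.

Lemma splitI1 : subfieldP K -> K q -> veq v rq q ->
  vgt v (2 + 2 * rq) (d - q ^+ 2) -> split_at K v d.
Proof. by move=> fK; apply: (splitI fK (K1 fK) (oner_neq0 _) dE). Qed.
End IntroUnscaled.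

Section Numerals.
Variables (v : algC -> rat) (vv : valuation v).

Lemma veq_sum r r' main rest e : e = main + rest -> veq v r main -> vge v r' rest -> r < r' -> veq v r e.
Proof. by move=> -> vm vr rr; apply: (veqD vv) => //; apply: vge_vgt rr. Qed.

Lemma veq_eq r r' x : veq v r' x -> r = r' -> veq v r x.
Proof. by move=> ? ->. Qed.

Lemma vge_num k (m : nat) : (2 ^ k %| m)%N -> vge v k%:R m%:R.
Proof.
by move=> km; have := @vge_dvdz _ vv k m%:Z; apply; rewrite dvdzE abszX.
Qed.

Lemma veq_num k (m : nat) : odd m -> veq v k%:R (2 ^ k * m)%N%:R.
Proof.
move=> odd_m; rewrite natrM natrX.
have vm : veq v 0 m%:R by apply: (@veq_odd _ vv m%:Z); rewrite dvdzE /= dvdn2 odd_m.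
by have := veqM vv (veqX vv k (veq_2 vv)) vm; rewrite mul1r addr0.
Qed.

(** The factors differ by 2. If [x - 1] had value at least 1, so would [x + 1], and the product
    value at least 2; so [v (x - 1) < 1], and both values are equal. *)
Lemma half_unit x r : veq v r ((x - 1) * (x + 1)) -> r < 2 -> veq v (r / 2) (x - 1) /\ veq v (r / 2) (x + 1).
Proof.
move=> vD r2; have [D0 _] := veqP _ _ _ vD; have xE : x + 1 = (x - 1) + 2 by ring.
have v2 := veq_2 vv.
have x0 : x - 1 != 0 by apply: contra_neq D0 => ->; rewrite mul0r.
have vx1 : v (x - 1) < 1.
  rewrite ltNge; apply/negP => x1; have vx : vge v 1 (x - 1) by rewrite /vge x1 orbT.
  have := vgeM vv vx (vgeD vv vx (veq_vge v2)).
  by rewrite -xE /vge (negPf D0) /= (proj2 (veqP _ _ _ vD)); lra.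
have vx : veq v (v (x - 1)) (x + 1).
  by rewrite xE; apply: (veqD vv); [exact: veq_val|exact: vge_vgt (veq_vge v2) _].
have vr := veq_uniq vD (veqM vv (veq_val v x0) vx).
by split; [apply: veq_eq (veq_val v x0) _|apply: veq_eq vx _]; lra.
Qed.

Lemma unit_two x : veq v 2 ((x - 1) * (x + 1)) -> veq v 1 (x - 1) /\ veq v 1 (x + 1).
Proof.
move=> vD; have [D0 _] := veqP _ _ _ vD; have xE : x + 1 = (x - 1) + 2 by ring.
have v2 := veq_2 vv; move: (D0); rewrite mulf_eq0 negb_or => /andP[x0 x10].
have vr := veq_uniq vD (veqM vv (veq_val v x0) (veq_val v x10)).
have [lt1|lt1|e1] := ltgtP (v (x - 1)) 1; last first.
- by split; [apply: veq_eq (veq_val v x0) _|apply: veq_eq (veq_val v x10) _]; lra.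
- have : veq v 1 (x + 1).
    by rewrite xE addrC; apply: (veqD vv) => //; rewrite /vgt lt1 orbT.
  move=> /veqP[_ E]; suff : (1 : rat) < 1 by rewrite ltxx.
  lra.
- have : veq v (v (x - 1)) (x + 1).
    by rewrite xE; apply: (veqD vv); [exact: veq_val|exact: vge_vgt (veq_vge v2) _].
  move=> /veqP[_ E]; suff : (1 : rat) < 1 by rewrite ltxx.
  lra.
Qed.

(** The factors differ by [2 m], of value 1. As their product has value above 2, one factor has
    value above 1 and the other exactly 1; the sign makes [y - m] the large one. *)
Lemma unit_split x m r : veq v 0 m -> vge v r ((x - m) * (x + m)) -> 2 < r ->
  exists y, [/\ y = x \/ y = - x, veq v 1 (y + m) & vge v (r - 1) (y - m)].
Proof.
move=> vm vD r2; have v2 := veqM vv (veq_2 vv) vm; rewrite addr0 in v2.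
have aux y : vgt v 1 (y - m) -> vge v r ((y - m) * (y + m)) -> veq v 1 (y + m) /\ vge v (r - 1) (y - m).
  move=> y1 yD; have vy : veq v 1 (y + m) by rewrite (_ : y + m = 2 * m + (y - m)); [exact: veqD|ring].
  split=> //; have [y10 _] := veqP _ _ _ vy.
  by have := vge_divr vv vy yD; rewrite mulfK.
have [m1|m1] := boolP (vgt v 1 (x - m)).
  by have [? ?] := aux x m1 vD; exists x; split=> //; left.
have [m2|m2] := boolP (vgt v 1 (x + m)).
  have m2' : vgt v 1 (- x - m) by rewrite -opprD vgtN.
  have [|? ?] := aux (- x) m2'; last by exists (- x); split=> //; right.
  by rewrite (_ : (- x - m) * (- x + m) = (x - m) * (x + m)) //; ring.
move: m1 m2 vD; rewrite /vgt /vge !negb_or mulf_eq0 => /andP[x0 m1] /andP[x1 m2].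
rewrite (negPf x0) (negPf x1) /= (valM vv) //; move: m1 m2; rewrite -!leNgt => ? ? ?.
suff : (1 : rat) < 1 by rewrite ltxx.
by lra.
Qed.

(* If [w] is small then [z (z + w)] is close to [z ^ 2]. *)
Lemma half_val z w r r' : veq v r (z * (z + w)) -> vge v r' w -> r / 2 < r' -> veq v (r / 2) z.
Proof.
move=> vD vw rr; have [D0 _] := veqP _ _ _ vD.
move: (D0); rewrite mulf_eq0 negb_or => /andP[z0 zw0].
have [le_zw|lt_zw] := leP r' (v z).
  have vz : vge v r' z by rewrite /vge le_zw orbT.
  have := vgeM vv vz (vgeD vv vz vw).
  rewrite /vge (negPf D0) (proj2 (veqP _ _ _ vD)) /= => ?.
  suff : r < r by rewrite ltxx.
  by lra.
have vzw : veq v (v z) (z + w) by apply: (veqD vv); [exact: veq_val|exact: vge_vgt vw lt_zw].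
have vr := veq_uniq vD (veqM vv (veq_val v z0) vzw).
by apply: veq_eq (veq_val v z0) _; lra.
Qed.

End Numerals.

(** * Kinds of the steps for each class of c *)

Ltac solve_mem fK :=
  let rK := constr:(subfield_subring fK) in
  lazymatch goal with
  | |- _ (_ + _) => apply: (subringD rK); solve_mem fK
  | |- _ (- _) => apply: (subringN rK); solve_mem fK
  | |- _ (_ * _) => apply: (subringM rK); solve_mem fK
  | |- _ (_ ^+ _) => apply: (subringX rK); solve_mem fK
  | |- _ (_^-1) => apply: (subfieldV fK); solve_mem fK
  | |- _ (_%:~R) => apply: (subring_int rK)
  | |- _ 1 => apply: (subring1 rK)
  | |- _ (_%:R) => apply: (subring_nat rK)
  | |- _ => by []
  end.

Lemma vge2 v : valuation v -> vge v 1 2.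
Proof. by move=> vv; apply: (@vge_num _ vv 1 2). Qed.
Lemma vge4 v : valuation v -> vge v 2 4.
Proof. by move=> vv; apply: (@vge_num _ vv 2 4). Qed.
Lemma vge8 v : valuation v -> vge v 3 8.
Proof. by move=> vv; apply: (@vge_num _ vv 3 8). Qed.

(* Forward declaration: [vge_prod] and [vge_tac] call each other. *)
Ltac vge_tac vv := idtac.
(* Solves [vge v ?r x], choosing [?r] from the hypotheses about the atoms of the product [x]. *)
Ltac vge_prod vv :=
  first [ by match goal with H : is_true (veq _ _ ?x) |- is_true (vge _ _ ?x) => exact: (veq_vge H) end
        | by match goal with H : is_true (vge _ _ ?x) |- is_true (vge _ _ ?x) => exact: H end
        | lazymatch goal with
          | |- is_true (vge _ _ (- _)) => rewrite (vgeN vv); vge_prod vv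
          | |- is_true (vge _ _ (_ * _)) => apply: (vgeM vv); [vge_prod vv|vge_prod vv]
          | |- is_true (vge _ _ (_ ^+ _)) => apply: (vgeX vv); vge_prod vv
          | |- is_true (vge _ _ (_ + _)) => refine (@vgeD _ vv 0 _ _ _ _); vge_tac vv
          | |- is_true (vge _ _ 2) => exact: (vge2 vv)
          | |- is_true (vge _ _ 4) => exact: (vge4 vv)
          | |- is_true (vge _ _ 8) => exact: (vge8 vv)
          | |- is_true (vge _ _ (_%:~R)) => exact: (vge_int vv)
          | |- is_true (vge _ _ 1) => exact: (vge_nat vv 1)
          | |- is_true (vge _ _ (_%:R)) => exact: (vge_nat vv)
          end ].

Ltac vge_tac vv ::=
  first [ by match goal with H : is_true (vge _ _ ?x) |- is_true (vge _ _ ?x) => apply: vge_mono H _; lra end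
        | by match goal with H : is_true (veq _ _ ?x) |- is_true (vge _ _ ?x) => apply: vge_mono (veq_vge H) _; lra end
        | lazymatch goal with
          | |- is_true (vge _ _ (_ + _)) => apply: (vgeD vv); vge_tac vv
          | |- is_true (vge _ _ (- _)) => rewrite (vgeN vv); vge_tac vv
          | |- _ => apply: vge_mono; [vge_prod vv|lra]
          end ].

Ltac veq_prod vv :=
  first [ by match goal with H : is_true (veq _ _ ?x) |- is_true (veq _ _ ?x) => exact: H end
        | lazymatch goal with
          | |- is_true (veq _ _ (- _)) => rewrite (veqN vv); veq_prod vv
          | |- is_true (veq _ _ (_ * _)) => apply: (veqM vv); [veq_prod vv|veq_prod vv]
          | |- is_true (veq _ _ (_ ^+ _)) => apply: (veqX vv); veq_prod vv
          | |- is_true (veq _ _ (_^-1)) => apply: (veqV vv); veq_prod vv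
          | |- is_true (veq _ _ 1) => exact: (veq1 vv)
          | |- is_true (veq _ _ 2) => exact: (veq_2 vv)
          | |- is_true (veq _ _ 4) => exact: (@veq_num _ vv 2 1 isT)
          | |- is_true (veq _ _ 8) => exact: (@veq_num _ vv 3 1 isT)
          end ].

Ltac veq_tac vv := apply: veq_eq; [veq_prod vv|lra].

Lemma veq_int v k (q : int) : valuation v -> ~~ (2 %| q)%Z -> veq v k%:R (2 ^+ k * q)%:~R.
Proof.
move=> vv odd_q; have vq := veq_odd vv odd_q; rewrite intrM rmorphXn /=.
by apply: veq_eq; [apply: (veqM vv); [apply: (veqX vv); exact: (veq_2 vv)|exact: vq]|lra].
Qed.

(* [veq_main vv m w r']: the valuation of the goal's expression is that of [m], the rest [w] having valuation [>= r']. *)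
Tactic Notation "veq_main" constr(vv) uconstr(m) uconstr(w) uconstr(r') :=
  refine (@veq_sum _ vv _ r' m w _ _ _ _ _); [|veq_tac vv|vge_tac vv|try lra].
Ltac vgt_tac vv r' := apply: (@vge_vgt _ _ r'); [vge_tac vv|lra].

Ltac num_tac :=
  lazymatch goal with
  | |- _ = _%:~R => lra
  | |- is_true (_ < _) => lra
  | |- is_true (~~ _) => by []
  end.

(** * Classes with [a] congruent to 2 or 3 modulo 4, or to 5 modulo 8 *)

Lemma tower_2mod8 r : tower_steps (8 * r + 2) Ram Split Ram.
Proof.
move=> K1 K2 s t v [fK1 fK2 K1s K2t K12 sE tE vv].
have va : veq v 1 (8 * r + 2)%:~R.
  by rewrite (_ : 8 * r + 2 = 2 ^+ 1 * (4 * r + 1)); [apply: veq_int => //; lia|ring].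
have vs : veq v (1 / 2) s by apply: (veq_sqrt vv); rewrite sE.
split=> /=.
- by apply: (ramifiedI_val _ (n := 1) va).
- apply: (splitI1 (q := 1) (rq := 0) fK1); [solve_mem fK1|veq_tac vv|].
  rewrite !(intrD, intrM) (_ : _ - _ = 8 * r%:~R); [vgt_tac vv (3 : rat)|ring].
- apply: (ramifiedI_val _ (r := 1 / 2) (n := 1)) => //=.
  by veq_main vv s (s ^+ 2) (1 : rat); ring.
Qed.

Lemma tower_6mod8 r : tower_steps (8 * r + 6) Ram Inert Ram.
Proof.
move=> K1 K2 s t v [fK1 fK2 K1s K2t K12 sE tE vv].
have va : veq v 1 (8 * r + 6)%:~R.
  by rewrite (_ : 8 * r + 6 = 2 ^+ 1 * (4 * r + 3)); [apply: veq_int => //; lia|ring].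
have vs : veq v (1 / 2) s by apply: (veq_sqrt vv); rewrite sE.
split=> /=.
- by apply: (ramifiedI_val _ (n := 1) va).
- apply: (inertI1 (q := 1) (rq := 0) fK1); [solve_mem fK1|veq_tac vv|].
  by rewrite !(intrD, intrM); veq_main vv (4 : algC) (8 * r%:~R : algC) (3 : rat); ring.
- apply: (ramifiedI_val _ (r := 1 / 2) (n := 1)) => //=.
  by veq_main vv s (s ^+ 2) (1 : rat); ring.
Qed.

(** As [t ^+ 2 = u ^+ 2 - 2 u], the element [u] approximates [t], and the error [z] solves
    [z (z + 2 u) = - 2 u], so its value is the new 3/4. *)
Lemma tower_3mod4 r : tower_steps (4 * r + 3) Ram Ram Ram.
Proof.
move=> K1 K2 s t v [fK1 fK2 K1s K2t K12 sE tE vv].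
have K2s := K12 _ K1s.
have aE : (4 * r + 3)%:~R = 4 * r%:~R + 3 :> algC by rewrite intrD intrM.
rewrite aE in sE tE *; move: r%:~R (vge_int vv r) aE sE tE => m vm aE sE tE.
have vb : veq v 1 (4 * m + 3 - 1) by veq_main vv (2 : algC) (4 * m) (2 : rat); ring.
have [vs1 vs] : veq v (1 / 2) (s - 1) /\ veq v (1 / 2) (s + 1).
  by apply: half_unit => //; rewrite (_ : _ * _ = 4 * m + 3 - 1) //; ring: sE.
have vs0 : veq v 0 s by veq_main vv (1 : algC) (s - 1) (1 / 2 : rat); ring.
have [u uE] : exists u, u = s + 1 by exists (s + 1).
have K2u : K2 u by rewrite uE; solve_mem fK2.
have vu : veq v (1 / 2) u by rewrite uE.
have [z zE] : exists z, z = t - u by exists (t - u).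
have vz : veq v (3 / 4) z.
  apply: (veq_eq (r' := 3 / 2 / 2)); last lra.
  apply: (half_val vv (w := 2 * u) (r' := 3 / 2)); [|vge_tac vv|lra].
  rewrite (_ : _ * _ = - (2 * u)); first by veq_tac vv.
  by rewrite zE uE; ring: sE tE.
have K2z : K2 z by rewrite zE; solve_mem fK2.
split=> /=.
- apply: (ramifiedI1 (q := 1) (rq := 0) (r := 1) (n := 1) rational_subfield); try num_tac.
  + exact: (rational_int 1).
  + by veq_tac vv.
  + by rewrite expr1n.
- apply: (ramifiedI1 (q := u) (rq := 1 / 2) (r := 3 / 2) (n := 1) fK1); try num_tac.
  + by rewrite uE; solve_mem fK1.
  + by [].
  + rewrite (_ : _ - _ = - (2 * u)); first by veq_tac vv.
    by rewrite uE; ring: sE.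
- have [u0 _] := veqP _ _ _ vu.
  (* The factor [u ^+ 2] raises the value of [s u] to 3/2, that of [z ^+ 2]. Since
     [z ^+ 2 = - 2 u - 2 u z] and, by [u ^+ 2 = 2 s + 4 (m + 1)], the sum [s u ^+ 3 + 2 u] is
     divisible by [4 u], the difference is led by [2 u z]. *)
  apply: (ramifiedI (P := u^-1) (d' := s * u ^+ 3) (q := z) (rq := 3 / 4) (r := 9 / 4) (n := 3) fK2); try num_tac.
  + by solve_mem fK2.
  + by rewrite invr_eq0.
  + by rewrite -uE; field.
  + by [].
  + by [].
  + veq_main vv (2 * u * z) (4 * (m + 1) * u * (s + 2)) (5 / 2 : rat).
    by rewrite zE uE; ring: sE tE.
Qed.

Lemma tower_13mod16 r : tower_steps (16 * r + 13) Inert Ram Ram.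
Proof.
move=> K1 K2 s t v [fK1 fK2 K1s K2t K12 sE tE vv].
have K2s := K12 _ K1s.
have aE : (16 * r + 13)%:~R = 16 * r%:~R + 13 :> algC by rewrite intrD intrM.
rewrite aE in sE tE *; move: r%:~R (vge_int vv r) aE sE tE => m vm aE sE tE.
have vb : veq v 2 (16 * m + 13 - 1) by veq_main vv (4 : algC) (8 * (2 * m + 1)) (3 : rat); ring.
have [vs1 vs] : veq v 1 (s - 1) /\ veq v 1 (s + 1).
  by apply: unit_two => //; rewrite (_ : _ * _ = 16 * m + 13 - 1) //; ring: sE.
have vs0 : veq v 0 s by veq_main vv (1 : algC) (s - 1) (1 : rat); ring.
have [tt ttD] : exists tt, tt = t / 2 by exists (t / 2).
have K2tt : K2 tt by rewrite ttD; solve_mem fK2.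
have ttE : tt ^+ 2 = 4 * m + 3 by rewrite ttD exprMn tE; field.
have vb' : veq v 1 (4 * m + 3 - 1) by veq_main vv (2 : algC) (4 * m) (2 : rat); ring.
have [vt1 vt] : veq v (1 / 2) (tt - 1) /\ veq v (1 / 2) (tt + 1).
  by apply: half_unit => //; rewrite (_ : _ * _ = 4 * m + 3 - 1) //; ring: ttE.
have vt0 : veq v 0 tt by veq_main vv (1 : algC) (tt - 1) (1 / 2 : rat); ring.
have [om omD] : exists om, om = (s + 1) / 2 by exists ((s + 1) / 2).
have K2om : K2 om by rewrite omD; solve_mem fK2.
have sO : s = 2 * om - 1 by rewrite omD; field.
have omE : om ^+ 2 = om + (4 * m + 3).
  rewrite omD (_ : ((s + 1) / 2) ^+ 2 = (s ^+ 2 + 2 * s + 1) / 4); last by field.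
  by rewrite sE; field.
have vom : veq v 0 om by rewrite omD; veq_tac vv.
have vom1 : veq v 0 (1 - om).
  rewrite (_ : 1 - om = - ((s - 1) / 2)); first by veq_tac vv.
  by rewrite omD; field.
split=> /=.
- apply: (inertI1 (q := 1) (rq := 0) rational_subfield); try num_tac.
  + exact: (rational_int 1).
  + by veq_tac vv.
  + by rewrite expr1n; apply: veq_eq vb _; lra.
- apply: (ramifiedI (P := 2) (d' := 4 * m + 3) (q := 1) (rq := 0) (r := 1) (n := 1) fK1); try num_tac.
  + by solve_mem fK1.
  + by rewrite pnatr_eq0.
  + by ring.
  + by solve_mem fK1.
  + by veq_tac vv.
  + by rewrite expr1n.
(* Modulo 4 one has [(tt + 1)^2 = 2 tt], [(1 - om)^2 = - om] and [s (s + 1) = - 2 om], so the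
   difference is [2 (tt - 1) om]. *)
- apply: (ramifiedI1 (q := (tt + 1) * (1 - om)) (rq := 1 / 2) (r := 3 / 2) (n := 1) fK2); try num_tac.
  + by solve_mem fK2.
  + by veq_tac vv.
  + veq_main vv (2 * (tt - 1) * om) (4 * om ^+ 2 - 8 * (2 * (m + 1) ^+ 2 + (m + 1) * tt)
      + 4 * (m + 1) * om) (2 : rat).
    by rewrite sO; ring: omE ttE.
Qed.

Lemma tower_5mod32_or_21 (r b' : int) (q0 : bool) : b' = (if q0 then 8 * r + 5 else 8 * r + 1) ->
  tower_steps (4 * b' + 1) Inert Split Ram.
Proof.
move=> b'E K1 K2 s t v [fK1 fK2 K1s K2t K12 sE tE vv].
have aE : (4 * b' + 1)%:~R = 4 * b'%:~R + 1 :> algC by rewrite intrD intrM.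
have b'C : b'%:~R = 8 * r%:~R + (if q0 then 5 else 1) :> algC.
  by rewrite b'E; case: q0 {b'E}; rewrite intrD intrM.
rewrite aE in sE tE *; move: r%:~R (vge_int vv r) b'%:~R (vge_int vv b') b'C sE tE => m vm b vb bE sE tE.
have vb4 : veq v 2 (4 * b + 1 - 1).
  rewrite bE; case: q0 {b'E bE}; last by veq_main vv (4 : algC) (4 * 8 * m) (4 : rat); ring.
  by veq_main vv (4 : algC) (8 * (4 * m + 2)) (3 : rat); ring.
have [vs1 vs] : veq v 1 (s - 1) /\ veq v 1 (s + 1).
  by apply: unit_two => //; rewrite (_ : _ * _ = 4 * b + 1 - 1) //; ring: sE.
have vs0 : veq v 0 s by veq_main vv (1 : algC) (s - 1) (1 : rat); ring.
split=> /=.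
- apply: (inertI1 (q := 1) (rq := 0) rational_subfield); try num_tac.
  + exact: (rational_int 1).
  + by veq_tac vv.
  + by rewrite expr1n; apply: veq_eq vb4 _; lra.
(* When [b'] is 5 modulo 8 it is no square of an integer modulo 8, but [s ^+ 2 = 4 b' + 1] is again
   5 modulo 8, so [s] takes the place of 1. *)
- apply: (splitI (P := 2) (d' := b) (q := if q0 then s else 1) (rq := 0) fK1); try num_tac.
  + by solve_mem fK1.
  + by rewrite pnatr_eq0.
  + by ring.
  + by case: q0 {b'E bE} => //; solve_mem fK1.
  + by case: q0 {b'E bE}; veq_tac vv.
  + case: q0 {b'E} bE => bE; rewrite ?sE bE.
      rewrite (_ : _ - _ = - 8 * (3 * m + 2)); last by ring.
      by vgt_tac vv (3 : rat).
    rewrite (_ : _ - _ = 8 * m); last by ring.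
    by vgt_tac vv (3 : rat).
- apply: (ramifiedI_val _ (r := 1) (n := 1)); try num_tac.
  by veq_tac vv.
Qed.

(** * Powers of 4 as squares, and the choice of the sign of [s] *)

Lemma four_pow j : (4 ^+ j)%:~R = (2 ^+ j) ^+ 2 :> algC.
Proof. by rewrite rmorphXn /= -exprM mulnC exprM -natrX. Qed.

Lemma veq_pow2 v j : valuation v -> veq v j%:R (2 ^+ j).
Proof. by move=> vv; apply: veq_eq; [apply: (veqX vv); exact: (veq_2 vv)|lra]. Qed.

Lemma rational_pow2 j : rational (2 ^+ j).
Proof. by apply: rpredX; exact: (rational_int 2). Qed.

Lemma subfield_pow2 K j : subfieldP K -> K (2 ^+ j).
Proof. by move=> fK; apply: (subringX (subfield_subring fK)); apply: (subring_nat (subfield_subring fK)). Qed.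

(** For [y = - s] the quotient of the radicands is [(s + 1) / (s - 1)], the square of
    [(s + 1) / t]. *)
Lemma tower_sign a K1 K2 s t v y : tower_context a K1 K2 s t v -> y = s \/ y = - s ->
  a%:~R - 1 != 0 :> algC ->
  exists R, [/\ K2 R, R != 0 & s * (s + 1) = R ^+ 2 * (y * (y + 1))].
Proof.
move=> [fK1 fK2 K1s K2t K12 sE tE vv] ys b0; have K2s := K12 _ K1s.
case: ys => ->; first by exists 1; rewrite oner_neq0 expr1n mul1r; split=> //; solve_mem fK2.
have bs : a%:~R - 1 = (s - 1) * (s + 1) by rewrite -sE; ring.
move: (b0); rewrite bs mulf_eq0 negb_or => /andP[s1 s2].
have t0 : t != 0 by rewrite -sqrf_eq0 tE.
exists ((s + 1) / t); split; first by solve_mem fK2.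
  by rewrite mulf_neq0 ?invr_eq0.
by rewrite exprMn exprVn tE bs; field; rewrite s1 s2.
Qed.

(* Choice of the sign of [s] for which [s = m] modulo a high power of 2. *)
Lemma tower_sign_split a K1 K2 s t v (m : int) r : tower_context a K1 K2 s t v -> ~~ (2 %| m)%Z ->
  vge v r (a%:~R - m%:~R ^+ 2) -> 2 < r -> a%:~R - 1 != 0 :> algC ->
  exists y R, [/\ K2 y, K2 R, R != 0, y ^+ 2 = a%:~R & s * (s + 1) = R ^+ 2 * (y * (y + 1))] /\
    (veq v 1 (y + m%:~R) /\ vge v (r - 1) (y - m%:~R)).
Proof.
move=> ctx odd_m vD r2 b0; have [fK1 fK2 K1s K2t K12 sE tE vv] := ctx.
have [|y [ys y1 ym]] := unit_split vv (x := s) (veq_odd vv odd_m) _ r2.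
  by rewrite (_ : _ * _ = a%:~R - m%:~R ^+ 2) //; ring: sE.
have [R [K2R R0 RE]] := tower_sign ctx ys b0; exists y, R; split; last by split.
have K2s := K12 _ K1s.
by split=> //; case: ys => ->; rewrite ?sqrrN //; apply: (subringN (subfield_subring fK2)).
Qed.

(** * Classes with [a - 1] divisible by 8 *)

Section OneModEight.
Variables (j : nat) (n : int) (j2 : (2 <= j)%N).

Let a := 4 ^+ j * n + 1.

Let aE : a%:~R = (2 ^+ j) ^+ 2 * n%:~R + 1 :> algC.
Proof. by rewrite intrD intrM four_pow. Qed.

Let P0 : 2 ^+ j != 0 :> algC.
Proof. by rewrite expf_neq0 ?pnatr_eq0. Qed.

Let vP v : valuation v -> vge v 2 (2 ^+ j).
Proof. by move=> vv; apply: vge_mono (veq_vge (veq_pow2 j vv)) _; rewrite ler_nat. Qed.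

Let step1 v : valuation v -> split_at rational v a%:~R.
Proof.
move=> vv; have vPv := vP vv; apply: (splitI1 (q := 1) (rq := 0) rational_subfield).
- exact: (rational_int 1).
- by veq_tac vv.
- rewrite aE expr1n addrK; move: (2 ^+ j) vPv => P vPv; by vgt_tac vv (4 : rat).
Qed.

Let b0 : n != 0 -> a%:~R - 1 != 0 :> algC.
Proof. by move=> n0; rewrite aE addrK; apply: mulf_neq0; [exact: expf_neq0|rewrite intr_eq0]. Qed.

Let sign K1 K2 s t v : n != 0 -> tower_context a K1 K2 s t v ->
  exists y R, [/\ K2 y, K2 R, R != 0, y ^+ 2 = a%:~R & s * (s + 1) = R ^+ 2 * (y * (y + 1))] /\
    (veq v 1 (y + 1) /\ vge v 3 (y - 1)).
Proof.
move=> n0 ctx; have vv := ctx_val ctx; apply: (@tower_sign_split a K1 K2 s t v 1 4 ctx) => //; last exact: b0.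
have vPv := vP vv; rewrite expr1n aE addrK; move: (2 ^+ j) vPv => P vPv; by vge_tac vv.
Qed.

Let step3 K1 K2 s t v : n != 0 -> tower_context a K1 K2 s t v -> ramified_at K2 v 1 (s * (s + 1)).
Proof.
move=> n0 ctx; have [y [R [[K2y K2R R0 _ RE] [y1 ym]]]] := sign n0 ctx.
have [fK1 fK2 K1s K2t K12 sE tE vv] := ctx.
have vy : veq v 0 y by veq_main vv (1 : algC) (y - 1) (3 : rat); ring.
(* The value 1 of [y (y + 1)] is odd, which already decides. The criterion with a square factor asks
   for an approximation all the same, and [q = 2] leaves this value unchanged. *)
apply: (ramifiedI (P := R) (d' := y * (y + 1)) (q := 2) (rq := 1) (r := 1) (n := -1) fK2); try first [num_tac | assumption].
- by solve_mem fK2.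
- by veq_tac vv.
- by veq_main vv (y * (y + 1)) (- (2 ^+ 2) : algC) (2 : rat).
Qed.

Lemma tower_four_split r : n = 8 * r + 1 -> tower_steps a Split Split Ram.
Proof.
move=> nE K1 K2 s t v ctx; have [fK1 fK2 K1s K2t K12 sE tE vv] := ctx.
split=> /=; [exact: step1| |by apply: (step3 _ ctx); lia].
apply: (splitI (P := 2 ^+ j) (d' := n%:~R) (q := 1) (rq := 0) fK1) => //.
- exact: subfield_pow2.
- by rewrite aE addrK.
- by solve_mem fK1.
- by veq_tac vv.
rewrite nE !(intrD, intrM) (_ : _ - _ = 8 * r%:~R); last by ring.
by vgt_tac vv (3 : rat).
Qed.

Lemma tower_four_inert r : n = 8 * r + 5 -> tower_steps a Split Inert Ram.
Proof.
move=> nE K1 K2 s t v ctx; have [fK1 fK2 K1s K2t K12 sE tE vv] := ctx.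
split=> /=; [exact: step1| |by apply: (step3 _ ctx); lia].
apply: (inertI (P := 2 ^+ j) (d' := n%:~R) (q := 1) (rq := 0) fK1) => //.
- exact: subfield_pow2.
- by rewrite aE addrK.
- by solve_mem fK1.
- by veq_tac vv.
by rewrite nE !(intrD, intrM); veq_main vv (4 : algC) (8 * r%:~R : algC) (3 : rat); ring.
Qed.

Lemma tower_four_ram r : n = 4 * r + 3 -> tower_steps a Split Ram Ram.
Proof.
move=> nE K1 K2 s t v ctx; have [fK1 fK2 K1s K2t K12 sE tE vv] := ctx.
have [|y [R [[K2y K2R R0 _ RE] [y1 ym]]]] := sign _ ctx; first lia.
have nC : n%:~R = 4 * r%:~R + 3 :> algC by rewrite nE intrD intrM.
have vr := vge_int vv r.
have [tt ttD] : exists tt, tt = t / 2 ^+ j by exists (t / 2 ^+ j).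
have K2P := subfield_pow2 j fK2.
have K2tt : K2 tt by rewrite ttD; solve_mem fK2.
have ttE : tt ^+ 2 = 4 * r%:~R + 3.
  by rewrite ttD exprMn tE aE addrK nC exprVn mulrAC mulfV ?mul1r // expf_neq0.
have [vt1 vt] : veq v (1 / 2) (tt - 1) /\ veq v (1 / 2) (tt + 1).
  apply: half_unit => //; rewrite (_ : _ * _ = 4 * r%:~R + 2); last by ring: ttE.
  by veq_main vv (2 : algC) (4 * r%:~R : algC) (2 : rat); ring.
split=> /=; first exact: step1.
- apply: (ramifiedI (P := 2 ^+ j) (d' := n%:~R) (q := 1) (rq := 0) (r := 1) (n := 1) fK1); try num_tac.
  + exact: subfield_pow2.
  + by rewrite aE addrK.
  + by solve_mem fK1.
  + by veq_tac vv.
  + by rewrite nC; veq_main vv (2 : algC) (4 * r%:~R : algC) (2 : rat); ring.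
(* Modulo 4, [y (y + 1)] is 2 and [(tt + 1)^2] is [2 tt]; the difference [- 2 (tt - 1)] has value
   3/2. *)
- apply: (ramifiedI (P := R) (d' := y * (y + 1)) (q := tt + 1) (rq := 1 / 2) (r := 3 / 2) (n := 1) fK2); try first [num_tac | assumption].
  + by solve_mem fK2.
  + veq_main vv (- (2 * (tt - 1))) (3 * (y - 1) + (y - 1) ^+ 2 - 4 * (r%:~R + 1)) (2 : rat).
    by ring: ttE.
Qed.

End OneModEight.

Section TwiceFour.
(* [a - 1 = 2 4^j n]: then [t / 2^j] is a uniformizer. *)
Variables (j : nat) (n : int) (j1 : (1 <= j)%N) (odd_n : ~~ (2 %| n)%Z).

Let a := 2 * 4 ^+ j * n + 1.

Let aE : a%:~R = (2 ^+ j) ^+ 2 * (2 * n%:~R) + 1 :> algC.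
Proof. by rewrite intrD !intrM four_pow; ring. Qed.

Let P0 : 2 ^+ j != 0 :> algC.
Proof. by rewrite expf_neq0 ?pnatr_eq0. Qed.

Let vP v : valuation v -> vge v 1 (2 ^+ j).
Proof. by move=> vv; apply: vge_mono (veq_vge (veq_pow2 j vv)) _; rewrite ler1n. Qed.

Let step1 v : valuation v -> split_at rational v a%:~R.
Proof.
move=> vv; have vPv := vP vv; apply: (splitI1 (q := 1) (rq := 0) rational_subfield).
- exact: (rational_int 1).
- by veq_tac vv.
- rewrite aE expr1n addrK; move: (2 ^+ j) vPv => P vPv; by vgt_tac vv (3 : rat).
Qed.

Let b0 : a%:~R - 1 != 0 :> algC.
Proof.
have n0 : n != 0 by apply: contraNneq odd_n => ->.
rewrite aE addrK; apply: mulf_neq0; first exact: expf_neq0.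
by apply: mulf_neq0; rewrite ?pnatr_eq0 ?intr_eq0.
Qed.

Let step2 K v : valuation v -> ramified_at K v 1 (a%:~R - 1).
Proof.
move=> vv; have vn := veq_odd vv odd_n; have vPj := veq_pow2 j vv.
apply: (ramifiedI_val _ (r := 2 * j%:R + 1) (n := 2 * j%:Z + 1)); last 2 first.
- lia.
- by rewrite intrD intrM; lra.
rewrite aE addrK; move: (2 ^+ j) vPj => P vPj.
by apply: veq_eq; [veq_prod vv|lra].
Qed.

Let uniformizer K1 K2 s t v : tower_context a K1 K2 s t v ->
  exists tt, [/\ K2 tt, tt ^+ 2 = 2 * n%:~R & veq v (1 / 2) tt].
Proof.
move=> ctx; have [fK1 fK2 K1s K2t K12 sE tE vv] := ctx.
have K2P := subfield_pow2 j fK2; have vn := veq_odd vv odd_n.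
have ttE : (t / 2 ^+ j) ^+ 2 = 2 * n%:~R.
  by rewrite exprMn tE aE addrK exprVn mulrAC mulfV ?mul1r // expf_neq0.
exists (t / 2 ^+ j); split=> //; first by solve_mem fK2.
by apply: (veq_sqrt vv); rewrite ttE; veq_tac vv.
Qed.

Section LargeExponent.
Hypothesis j2 : (2 <= j)%N.

Let sign K1 K2 s t v : tower_context a K1 K2 s t v ->
  exists y R, [/\ K2 y, K2 R, R != 0, y ^+ 2 = a%:~R & s * (s + 1) = R ^+ 2 * (y * (y + 1))] /\
    (veq v 1 (y + 1) /\ vge v 4 (y - 1)).
Proof.
move=> ctx; have vv := ctx_val ctx.
have [|y [R H]] := @tower_sign_split a K1 K2 s t v 1 5 ctx isT _ isT b0.
  have vPv : vge v 2 (2 ^+ j) by apply: vge_mono (veq_vge (veq_pow2 j vv)) _; rewrite ler_nat.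
  by rewrite expr1n aE addrK; move: (2 ^+ j) vPv => P vPv; vge_tac vv.
by exists y, R.
Qed.

Lemma tower_twice_four_ram r : n = 4 * r + 3 -> tower_steps a Split Ram Ram.
Proof.
move=> nE K1 K2 s t v ctx; have [y [R [[K2y K2R R0 _ RE] [y1 ym]]]] := sign ctx.
have [tt [K2tt ttE vt]] := uniformizer ctx.
have [fK1 fK2 K1s K2t K12 sE tE vv] := ctx; have vn := veq_odd vv odd_n.
have nC : n%:~R = 4 * r%:~R + 3 :> algC by rewrite nE intrD intrM.
have vr := vge_int vv r.
have v1t : veq v 0 (1 + tt) by veq_main vv (1 : algC) tt (1 / 2 : rat); ring.
split=> /=; [exact: step1|exact: step2|].
(* The square of [tt (1 + tt)] is [2 n + 4 n ^ 2 + 4 n tt]. For [n] congruent to 3 modulo 4,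
   [2 - 2 n - 4 n ^ 2] is divisible by 8, which leaves [- 4 n tt] of value 5/2. *)
apply: (ramifiedI (P := R) (d' := y * (y + 1)) (q := tt * (1 + tt)) (rq := 1 / 2) (r := 5 / 2) (n := 3) fK2); try first [num_tac | assumption].
- by solve_mem fK2.
- by veq_tac vv.
- veq_main vv (- (4 * n%:~R * tt)) (3 * (y - 1) + (y - 1) ^+ 2 - 8 * (8 * r%:~R ^+ 2 + 13 * r%:~R + 5)) (3 : rat).
  have -> : tt * (1 + tt) = tt + 2 * n%:~R by ring: ttE.
  by move: ttE; rewrite nC => ttE; ring: ttE.
Qed.

(** [y (y + 1)] is 2 modulo 16 and [tt ^+ 2 = 2 n], so the decisive number is [2 (1 - n)]: its value
    is exactly 3 for [n = 5] modulo 8, and at least 4 for [n = 1]. *)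
Lemma tower_twice_four_inert r : n = 8 * r + 5 -> tower_steps a Split Ram Inert.
Proof.
move=> nE K1 K2 s t v ctx; have [y [R [[K2y K2R R0 _ RE] [y1 ym]]]] := sign ctx.
have [tt [K2tt ttE vt]] := uniformizer ctx.
have [fK1 fK2 K1s K2t K12 sE tE vv] := ctx.
have nC : n%:~R = 8 * r%:~R + 5 :> algC by rewrite nE intrD intrM.
split=> /=; [exact: step1|exact: step2|].
apply: (inertI (P := R) (d' := y * (y + 1)) (q := tt) (rq := 1 / 2) fK2) => //.
veq_main vv (- 8 : algC) (3 * (y - 1) + (y - 1) ^+ 2 - 2 * 8 * r%:~R) (4 : rat).
by rewrite ttE nC; ring.
Qed.

Lemma tower_twice_four_split r : n = 8 * r + 1 -> tower_steps a Split Ram Split.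
Proof.
move=> nE K1 K2 s t v ctx; have [y [R [[K2y K2R R0 _ RE] [y1 ym]]]] := sign ctx.
have [tt [K2tt ttE vt]] := uniformizer ctx.
have [fK1 fK2 K1s K2t K12 sE tE vv] := ctx.
have nC : n%:~R = 8 * r%:~R + 1 :> algC by rewrite nE intrD intrM.
split=> /=; [exact: step1|exact: step2|].
apply: (splitI (P := R) (d' := y * (y + 1)) (q := tt) (rq := 1 / 2) fK2) => //.
rewrite ttE nC (_ : _ - _ = 3 * (y - 1) + (y - 1) ^+ 2 - 2 * 8 * r%:~R); last by ring.
by vgt_tac vv (4 : rat).
Qed.

End LargeExponent.

Hypothesis j1E : j = 1%N.

Let a8 : a%:~R = 8 * n%:~R + 1 :> algC.
Proof. by rewrite aE j1E expr1; ring. Qed.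

Lemma tower_eight_ram r : n = 4 * r + 1 -> tower_steps a Split Ram Ram.
Proof.
move=> nE K1 K2 s t v ctx; have [fK1 fK2 K1s K2t K12 sE tE vv] := ctx.
have nC : n%:~R = 4 * r%:~R + 1 :> algC by rewrite nE intrD intrM.
have [|y [R [[K2y K2R R0 _ RE] [y1 ym]]]] := @tower_sign_split a K1 K2 s t v 3 5 ctx isT _ isT b0.
  rewrite a8 nC (_ : _ - _ = 4 * 8 * r%:~R); first by vge_tac vv.
  by ring.
have [tt [K2tt ttE vt]] := uniformizer ctx.
have v1t : veq v 0 (1 + tt) by veq_main vv (1 : algC) tt (1 / 2 : rat); ring.
split=> /=; [exact: step1|exact: step2|].
(* As [a = 32 r + 9], the root [y] is 3 modulo 16 and [y (y + 1)] is 12. The square of [2 (1 + tt)]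
   is [4 + 8 n + 8 tt], and [12 - 4 - 8 n = - 32 r], so [- 8 tt] of value 7/2 remains. *)
apply: (ramifiedI (P := R) (d' := y * (y + 1)) (q := 2 * (1 + tt)) (rq := 1) (r := 7 / 2) (n := 3) fK2); try first [num_tac | assumption].
- by solve_mem fK2.
- by veq_tac vv.
- veq_main vv (- (8 * tt)) (7 * (y - 3%:~R) + (y - 3%:~R) ^+ 2 - 4 * 8 * r%:~R) (4 : rat).
  by move: ttE; rewrite nC => ttE; ring: ttE.
Qed.

Lemma tower_eight_inert r : n = 8 * r + 3 -> tower_steps a Split Ram Inert.
Proof.
move=> nE K1 K2 s t v ctx; have [fK1 fK2 K1s K2t K12 sE tE vv] := ctx.
have nC : n%:~R = 8 * r%:~R + 3 :> algC by rewrite nE intrD intrM.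
(* Here [a = 64 r + 25], and the root near -5 is taken because then [y (y + 1)] is near
   [20 = 2 ^ 2 + 16]. *)
have [|y [R [[K2y K2R R0 _ RE] [y1 ym]]]] := @tower_sign_split a K1 K2 s t v (-5) 6 ctx isT _ isT b0.
  rewrite a8 nC (_ : _ - _ = 8 * 8 * r%:~R); first by vge_tac vv.
  by ring.
split=> /=; [exact: step1|exact: step2|].
apply: (inertI (P := R) (d' := y * (y + 1)) (q := 2) (rq := 1) fK2) => //.
- by solve_mem fK2.
- by veq_tac vv.
- veq_main vv (4 * 4 : algC) (- (9 * (y - (-5)%:~R)) + (y - (-5)%:~R) ^+ 2) (5 : rat).
  by ring.
Qed.

Lemma tower_eight_split r : n = 8 * r + 7 -> tower_steps a Split Ram Split.
Proof.
move=> nE K1 K2 s t v ctx; have [fK1 fK2 K1s K2t K12 sE tE vv] := ctx.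
have nC : n%:~R = 8 * r%:~R + 7 :> algC by rewrite nE intrD intrM.
(* Here [a = 64 r + 57] and [11 ^ 2 = 57 + 64]; near 11 the radicand is [132 = 2 ^ 2 + 128]. *)
have [|y [R [[K2y K2R R0 _ RE] [y1 ym]]]] := @tower_sign_split a K1 K2 s t v 11 6 ctx isT _ isT b0.
  rewrite a8 nC (_ : _ - _ = 8 * 8 * (r%:~R - 1)); first by vge_tac vv.
  by ring.
split=> /=; [exact: step1|exact: step2|].
apply: (splitI (P := R) (d' := y * (y + 1)) (q := 2) (rq := 1) fK2) => //.
- by solve_mem fK2.
- by veq_tac vv.
- rewrite (_ : _ - _ = 23 * (y - 11%:~R) + (y - 11%:~R) ^+ 2 + 2 * 8 * 8); last by ring.
  by vgt_tac vv (5 : rat).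
Qed.

End TwiceFour.

(** * Classes with [a = 4 ^+ k * a'], [a'] odd and [k >= 1] *)

Lemma odd_int_add (m r : int) : ~~ (2 %| m)%Z -> ~~ (2 %| m + 2 * r)%Z.
Proof. lia. Qed.

Lemma even_gt1 k j : (1 <= k)%N -> k = (2 * j)%N -> (2 <= k)%N.
Proof. lia. Qed.

Section FourTimesOdd.
Variables (k : nat) (a' : int) (k1 : (1 <= k)%N) (odd_a' : ~~ (2 %| a')%Z).

Let a := 4 ^+ k * a'.

Let aE : a%:~R = (2 ^+ k) ^+ 2 * a'%:~R :> algC.
Proof. by rewrite intrM four_pow. Qed.

Let P0 : 2 ^+ k != 0 :> algC.
Proof. by rewrite expf_neq0 ?pnatr_eq0. Qed.

Let vP v : valuation v -> vge v 1 (2 ^+ k).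
Proof. by move=> vv; apply: vge_mono (veq_vge (veq_pow2 k vv)) _; rewrite ler1n. Qed.

Let vP2 v : (2 <= k)%N -> valuation v -> vge v 2 (2 ^+ k).
Proof. by move=> k2 vv; apply: vge_mono (veq_vge (veq_pow2 k vv)) _; rewrite ler_nat. Qed.

Let vP3 v : (3 <= k)%N -> valuation v -> vge v 3 (2 ^+ k).
Proof. by move=> k3 vv; apply: vge_mono (veq_vge (veq_pow2 k vv)) _; rewrite ler_nat. Qed.

Let reduced_s K1 K2 s t v : tower_context a K1 K2 s t v ->
  exists sp, [/\ K1 sp, K2 sp, sp ^+ 2 = a'%:~R, s = 2 ^+ k * sp & veq v 0 sp].
Proof.
move=> ctx; have [fK1 fK2 K1s K2t K12 sE tE vv] := ctx.
have K1P := subfield_pow2 k fK1.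
have spE : (s / 2 ^+ k) ^+ 2 = a'%:~R.
  by rewrite exprMn sE aE exprVn mulrAC mulfV ?mul1r // expf_neq0.
have K1sp : K1 (s / 2 ^+ k) by solve_mem fK1.
exists (s / 2 ^+ k); split=> //; [exact: K12|by rewrite mulrC divfK|].
apply: veq_eq; first by apply: (veq_sqrt vv); rewrite spE; exact: (veq_odd vv odd_a').
lra.
Qed.

Let d_even j (sp s : algC) : k = (2 * j)%N -> s = 2 ^+ k * sp ->
  s * (s + 1) = (2 ^+ j) ^+ 2 * (sp * (2 ^+ k * sp + 1)).
Proof. by move=> kE ->; rewrite {1}kE mulnC exprM; ring. Qed.

Let d_odd j (sp s : algC) : k = (2 * j).+1 -> s = 2 ^+ k * sp ->
  s * (s + 1) = (2 ^+ j) ^+ 2 * (2 * sp * (2 ^+ k * sp + 1)).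
Proof. by move=> kE ->; rewrite {1}kE exprS mulnC exprM; ring. Qed.

Section ThreeModFour.
Hypothesis a'3 : (a' %% 4)%Z = 3.

Let a'C : exists m : int, a' = 4 * m + 3.
Proof. by exists (a' %/ 4)%Z; lia. Qed.

Let step1 v : valuation v -> ramified_at rational v 1 a%:~R.
Proof.
move=> vv; have [m mE] := a'C; have vm := vge_int vv m.
apply: (ramifiedI (P := 2 ^+ k) (d' := a'%:~R) (q := 1) (rq := 0) (r := 1) (n := 1) rational_subfield); try num_tac.
- exact: rational_pow2.
- exact: aE.
- exact: (rational_int 1).
- by veq_tac vv.
- by rewrite mE intrD intrM; veq_main vv (2 : algC) (4 * m%:~R : algC) (2 : rat); ring.
Qed.

Let half sp v : valuation v -> sp ^+ 2 = a'%:~R -> veq v (1 / 2) (sp - 1) /\ veq v (1 / 2) (sp + 1).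
Proof.
move=> vv spE; have [m mE] := a'C; have vm := vge_int vv m.
apply: half_unit => //; rewrite (_ : _ * _ = 4 * m%:~R + 2).
  by veq_main vv (2 : algC) (4 * m%:~R : algC) (2 : rat); ring.
by move: spE; rewrite mE intrD intrM => spE; ring: spE.
Qed.

(** Modulo 4, [a - 1] is -1, that is [a' = sp ^+ 2], so [sp] is the approximation. The error is
    [3 a' - 1] for [k = 1] and [- a' - 1] modulo 16 for larger [k]; whether 8 divides it separates
    split from inert. *)
Let step2_inert K1 K2 s t v : (k = 1%N /\ (a' %% 8)%Z = 7) \/ ((2 <= k)%N /\ (a' %% 8)%Z = 3) ->
  tower_context a K1 K2 s t v -> inert_at K1 v (a%:~R - 1).
Proof.
move=> ka ctx; have [sp [K1sp K2sp spE _ vsp]] := reduced_s ctx.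
have [fK1 fK2 K1s K2t K12 sE tE vv] := ctx.
apply: (inertI1 (q := sp) (rq := 0) fK1) => //; rewrite spE aE.
case: ka => -[kE a8].
  have [r ->] : exists r : int, a' = 8 * r + 7 by exists (a' %/ 8)%Z; lia.
  rewrite kE expr1 intrD intrM; have vr := vge_int vv r.
  by veq_main vv (4 : algC) (8 * (3 * r%:~R + 2) : algC) (3 : rat); ring.
have [r ->] : exists r : int, a' = 8 * r + 3 by exists (a' %/ 8)%Z; lia.
have vr := vge_int vv r; rewrite intrD intrM; move: (2 ^+ k) (vP2 kE vv) => P vPv.
by veq_main vv (- 4 : algC) (P ^+ 2 * (8 * r%:~R + 3) - 8 * r%:~R) (3 : rat); ring.
Qed.

Let step2_split K1 K2 s t v : (k = 1%N /\ (a' %% 8)%Z = 3) \/ ((2 <= k)%N /\ (a' %% 8)%Z = 7) ->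
  tower_context a K1 K2 s t v -> split_at K1 v (a%:~R - 1).
Proof.
move=> ka ctx; have [sp [K1sp K2sp spE _ vsp]] := reduced_s ctx.
have [fK1 fK2 K1s K2t K12 sE tE vv] := ctx.
apply: (splitI1 (q := sp) (rq := 0) fK1) => //; rewrite spE aE.
case: ka => -[kE a8].
  have [r ->] : exists r : int, a' = 8 * r + 3 by exists (a' %/ 8)%Z; lia.
  rewrite kE expr1 intrD intrM; have vr := vge_int vv r.
  rewrite (_ : _ - _ = 8 * (3 * r%:~R + 1)); last by ring.
  by vgt_tac vv (3 : rat).
have [r ->] : exists r : int, a' = 8 * r + 7 by exists (a' %/ 8)%Z; lia.
have vr := vge_int vv r; rewrite intrD intrM; move: (2 ^+ k) (vP2 kE vv) => P vPv.
rewrite (_ : _ - _ = P ^+ 2 * (8 * r%:~R + 7) - 8 * (r%:~R + 1)); last by ring.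
by vgt_tac vv (3 : rat).
Qed.

Let step3_even j K1 K2 s t v : k = (2 * j)%N -> tower_context a K1 K2 s t v ->
  ramified_at K2 v 2 (s * (s + 1)).
Proof.
move=> kE ctx; have [sp [K1sp K2sp spE sD vsp]] := reduced_s ctx.
have [fK1 fK2 K1s K2t K12 sE tE vv] := ctx; have [vs1 vs] := half vv spE.
apply: (ramifiedI (P := 2 ^+ j) (d' := sp * (2 ^+ k * sp + 1)) (q := 1) (rq := 0) (r := 1 / 2) (n := 1) fK2); try num_tac.
- exact: subfield_pow2.
- by rewrite expf_neq0 ?pnatr_eq0.
- exact: d_even.
- by solve_mem fK2.
- by veq_tac vv.
- have vPv := vP vv; move: (2 ^+ k) vPv => P vPv.
  by veq_main vv (sp - 1) (P * sp ^+ 2) (1 : rat); ring.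
Qed.

Let step3_odd_inert j K1 K2 s t v : k = (2 * j).+1 ->
  (k = 1%N /\ (a' %% 8)%Z = 7) \/ ((3 <= k)%N /\ (a' %% 8)%Z = 3) ->
  tower_context a K1 K2 s t v -> ramified_at K2 v 2 (s * (s + 1)).
Proof.
move=> kE ka ctx; have [sp [K1sp K2sp spE sD vsp]] := reduced_s ctx.
have [fK1 fK2 K1s K2t K12 sE tE vv] := ctx; have [vs1 vs] := half vv spE.
have vs2 : veq v 0 (sp + 2) by veq_main vv sp (2 : algC) (1 : rat).
(* With [sp + 1] alone the difference would have value 2, an integral multiple of 1/2 after
   normalisation and so inconclusive; the unit [sp + 2] raises it to 5/2. *)
apply: (ramifiedI (P := 2 ^+ j) (d' := 2 * sp * (2 ^+ k * sp + 1)) (q := (sp + 1) * (sp + 2)) (rq := 1 / 2)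
   (r := 5 / 2) (n := 3) fK2); try num_tac.
- exact: subfield_pow2.
- by rewrite expf_neq0 ?pnatr_eq0.
- exact: d_odd.
- by solve_mem fK2.
- by veq_tac vv.
case: ka => -[k1E a8].
  have [r rE] : exists r : int, a' = 8 * r + 7 by exists (a' %/ 8)%Z; lia.
  have vr := vge_int vv r; have vodd : veq v 0 (13 + 2 * (6 * r))%:~R by apply: (veq_odd vv); exact: odd_int_add.
  rewrite k1E expr1; move: spE; rewrite rE intrD intrM => spE.
  veq_main vv (- (4 * (13 + 2 * (6 * r))%:~R * (sp - 1))) (- (8 * (r%:~R + 1) * (8 * r%:~R + 21))) (3 : rat).
  by rewrite intrD !intrM; ring: spE.
have [r rE] : exists r : int, a' = 8 * r + 3 by exists (a' %/ 8)%Z; lia.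
have vr := vge_int vv r; have vodd : veq v 0 (7 + 2 * (6 * r))%:~R by apply: (veq_odd vv); exact: odd_int_add.
move: spE; rewrite rE intrD intrM => spE; move: (2 ^+ k) (vP3 k1E vv) => P vPv.
veq_main vv (- (4 * (7 + 2 * (6 * r))%:~R * (sp - 1)))
  (P * (2 * (8 * r%:~R + 3)) - 8 * (8 * r%:~R ^+ 2 + 25 * r%:~R + 10)) (3 : rat).
by rewrite intrD !intrM; ring: spE.
Qed.

(** Since [(sp + 1)^2 = 2 sp + a' + 1], the difference is [2 ^+ k.+1 * a' - a' - 1]; it has value
    exactly 3 here and at least 4 in the next lemma. In both names the first [split] refers to the
    second step of the tower. *)
Let step3_odd_split j K1 K2 s t v : k = (2 * j).+1 ->
  (k = 1%N /\ (a' %% 16)%Z = 3) \/ ((3 <= k)%N /\ (a' %% 16)%Z = 7) ->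
  tower_context a K1 K2 s t v -> inert_at K2 v (s * (s + 1)).
Proof.
move=> kE ka ctx; have [sp [K1sp K2sp spE sD vsp]] := reduced_s ctx.
have [fK1 fK2 K1s K2t K12 sE tE vv] := ctx; have [vs1 vs] := half vv spE.
apply: (inertI (P := 2 ^+ j) (d' := 2 * sp * (2 ^+ k * sp + 1)) (q := sp + 1) (rq := 1 / 2) fK2) => //.
- exact: subfield_pow2.
- by rewrite expf_neq0 ?pnatr_eq0.
- exact: d_odd.
- by solve_mem fK2.
case: ka => -[k1E a8].
  have [r rE] : exists r : int, a' = 16 * r + 3 by exists (a' %/ 16)%Z; lia.
  have vr := vge_int vv r; rewrite k1E expr1; move: spE; rewrite rE intrD intrM => spE.
  by veq_main vv (8 : algC) (2 * 8 * 3 * r%:~R : algC) (4 : rat); ring: spE.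
have [r rE] : exists r : int, a' = 16 * r + 7 by exists (a' %/ 16)%Z; lia.
have vr := vge_int vv r; move: spE; rewrite rE intrD intrM => spE; move: (2 ^+ k) (vP3 k1E vv) => P vPv.
by veq_main vv (- 8 : algC) (P * 2 * (16 * r%:~R + 7) - 2 * 8 * r%:~R : algC) (4 : rat); ring: spE.
Qed.

Let step3_odd_split2 j K1 K2 s t v : k = (2 * j).+1 ->
  (k = 1%N /\ (a' %% 16)%Z = 11) \/ ((3 <= k)%N /\ (a' %% 16)%Z = 15) ->
  tower_context a K1 K2 s t v -> split_at K2 v (s * (s + 1)).
Proof.
move=> kE ka ctx; have [sp [K1sp K2sp spE sD vsp]] := reduced_s ctx.
have [fK1 fK2 K1s K2t K12 sE tE vv] := ctx; have [vs1 vs] := half vv spE.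
apply: (splitI (P := 2 ^+ j) (d' := 2 * sp * (2 ^+ k * sp + 1)) (q := sp + 1) (rq := 1 / 2) fK2) => //.
- exact: subfield_pow2.
- by rewrite expf_neq0 ?pnatr_eq0.
- exact: d_odd.
- by solve_mem fK2.
case: ka => -[k1E a8].
  have [r rE] : exists r : int, a' = 16 * r + 11 by exists (a' %/ 16)%Z; lia.
  have vr := vge_int vv r; rewrite k1E expr1; move: spE; rewrite rE intrD intrM => spE.
  rewrite (_ : _ - _ = 2 * 8 * (3 * r%:~R + 2)); last by ring: spE.
  by vgt_tac vv (4 : rat).
have [r rE] : exists r : int, a' = 16 * r + 15 by exists (a' %/ 16)%Z; lia.
have vr := vge_int vv r; move: spE; rewrite rE intrD intrM => spE; move: (2 ^+ k) (vP3 k1E vv) => P vPv.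
rewrite (_ : _ - _ = P * 2 * (16 * r%:~R + 15) - 2 * 8 * (r%:~R + 1)); last by ring: spE.
by vgt_tac vv (4 : rat).
Qed.

Lemma tower_four3_inert : (k = 1%N /\ (a' %% 8)%Z = 7) \/ ((2 <= k)%N /\ (a' %% 8)%Z = 3) ->
  tower_steps a Ram Inert Ram.
Proof.
move=> ka K1 K2 s t v ctx; have vv := ctx_val ctx.
split; [exact: step1|exact: (step2_inert ka ctx)|].
have := odd_double_half k; case: (odd k) => /= kE.
  apply: (step3_odd_inert (j := k./2) _ _ ctx); first by lia.
  by case: ka => -[? ?]; [left|right]; split=> //; lia.
by apply: (step3_even (j := k./2) _ ctx); lia.
Qed.

Lemma tower_four3_split_ram j : k = (2 * j)%N -> (a' %% 8)%Z = 7 -> tower_steps a Ram Split Ram.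
Proof.
move=> kE a8 K1 K2 s t v ctx; have vv := ctx_val ctx.
by split; [exact: step1|apply: (step2_split _ ctx); right; split=> //; lia|exact: (step3_even kE ctx)].
Qed.

Lemma tower_four3_split_inert j : k = (2 * j).+1 ->
  (k = 1%N /\ (a' %% 16)%Z = 3) \/ ((3 <= k)%N /\ (a' %% 16)%Z = 7) -> tower_steps a Ram Split Inert.
Proof.
move=> kE ka K1 K2 s t v ctx; have vv := ctx_val ctx.
split; [exact: step1| |exact: (step3_odd_split kE ka ctx)].
by apply: (step2_split _ ctx); case: ka => -[? ?]; [left|right]; split; lia.
Qed.

Lemma tower_four3_split_split j : k = (2 * j).+1 ->
  (k = 1%N /\ (a' %% 16)%Z = 11) \/ ((3 <= k)%N /\ (a' %% 16)%Z = 15) -> tower_steps a Ram Split Split.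
Proof.
move=> kE ka K1 K2 s t v ctx; have vv := ctx_val ctx.
split; [exact: step1| |exact: (step3_odd_split2 kE ka ctx)].
by apply: (step2_split _ ctx); case: ka => -[? ?]; [left|right]; split; lia.
Qed.

End ThreeModFour.

Section OneModFour.
Hypothesis a'1 : (a' %% 4)%Z = 1.

Let vb v : valuation v -> veq v 1 (a%:~R - 2).
Proof.
move=> vv; have vPv := vP vv; have va' := vge_int vv a'; rewrite aE; move: (2 ^+ k) vPv => P vPv.
by veq_main vv (- 2 : algC) (P ^+ 2 * a'%:~R) (2 : rat); ring.
Qed.

Let step2 K v : subfieldP K -> valuation v -> ramified_at K v 1 (a%:~R - 1).
Proof.
move=> fK vv; apply: (ramifiedI1 (q := 1) (rq := 0) (r := 1) (n := 1) fK); try num_tac.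
- by solve_mem fK.
- by veq_tac vv.
- by rewrite (_ : _ - _ = a%:~R - 2); [exact: vb|ring].
Qed.

Let half t v : valuation v -> t ^+ 2 = a%:~R - 1 -> veq v (1 / 2) (t - 1) /\ veq v (1 / 2) (t + 1).
Proof.
move=> vv tE; apply: half_unit => //; rewrite (_ : _ * _ = a%:~R - 2); first exact: vb.
by ring: tE.
Qed.

Let step3_odd j K1 K2 s t v : k = (2 * j).+1 -> tower_context a K1 K2 s t v ->
  (forall sp, sp ^+ 2 = a'%:~R -> vge v 1 (sp - 1)) -> ramified_at K2 v 2 (s * (s + 1)).
Proof.
move=> kE ctx vs1; have [sp [K1sp K2sp spE sD vsp]] := reduced_s ctx.
have [fK1 fK2 K1s K2t K12 sE tE vv] := ctx; have [vt1 vt] := half vv tE; have {}vs1 := vs1 _ spE.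
(* Modulo 4 the reduced radicand is [2 sp], itself 2, and [(t + 1)^2 = a + 2 t] is [2 t]; the main
   term is [- 2 (t - 1)]. *)
apply: (ramifiedI (P := 2 ^+ j) (d' := 2 * sp * (2 ^+ k * sp + 1)) (q := t + 1) (rq := 1 / 2) (r := 3 / 2) (n := 1) fK2); try num_tac.
- exact: subfield_pow2.
- by rewrite expf_neq0 ?pnatr_eq0.
- exact: d_odd.
- by solve_mem fK2.
- by [].
- move: tE; rewrite aE => tE; have va' := vge_int vv a'; move: (2 ^+ k) (vP vv) tE => P vPv tE.
  veq_main vv (- (2 * (t - 1))) (2 * (sp - 1) + 2 * P * a'%:~R - P ^+ 2 * a'%:~R) (2 : rat).
  by ring: tE spE.
Qed.

Lemma tower_four5 : (a' %% 8)%Z = 5 -> tower_steps a Inert Ram Ram.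
Proof.
move=> a8 K1 K2 s t v ctx; have [fK1 fK2 K1s K2t K12 sE tE vv] := ctx.
have [r rE] : exists r : int, a' = 8 * r + 5 by exists (a' %/ 8)%Z; lia.
have vr := vge_int vv r; have a'C : a'%:~R = 8 * r%:~R + 5 :> algC by rewrite rE intrD intrM.
have unit sp : sp ^+ 2 = a'%:~R -> veq v 1 (sp - 1) /\ veq v 1 (sp + 1).
  move=> spE; apply: unit_two => //; rewrite (_ : _ * _ = 8 * r%:~R + 4).
    by veq_main vv (4 : algC) (8 * r%:~R) (3 : rat); ring.
  by move: spE; rewrite a'C => spE; ring: spE.
split=> /=.
- apply: (inertI (P := 2 ^+ k) (d' := a'%:~R) (q := 1) (rq := 0) rational_subfield) => //.
  + exact: rational_pow2.
  + exact: (rational_int 1).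
  + by veq_tac vv.
  + by rewrite a'C; veq_main vv (4 : algC) (8 * r%:~R) (3 : rat); ring.
- exact: step2.
have := odd_double_half k; case: (odd k) => /= kE.
  apply: (step3_odd (j := k./2) _ ctx); first by lia.
  by move=> sp /unit[/veq_vge].
have {}kE : k = (2 * k./2)%N by lia.
have [sp [K1sp K2sp spE sD vsp]] := reduced_s ctx; have [vs1 vs] := unit _ spE.
have [vt1 vt] := half vv tE.
have [om omD] : exists om, om = (sp + 1) / 2 by exists ((sp + 1) / 2).
have K2om : K2 om by rewrite omD; solve_mem fK2.
have sO : sp = 2 * om - 1 by rewrite omD; field.
have omE : om ^+ 2 = om + (2 * r%:~R + 1).
  rewrite omD (_ : ((sp + 1) / 2) ^+ 2 = (sp ^+ 2 + 2 * sp + 1) / 4); last by field.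
  by rewrite spE a'C; field.
have vom : veq v 0 om by rewrite omD; veq_tac vv.
have vodd : veq v 0 (1 + 2 * r)%:~R by apply: (veq_odd vv); exact: odd_int_add.
have vq : veq v 0 (1 + (t - 1) * om) by veq_main vv (1 : algC) ((t - 1) * om) (1 / 2 : rat).
(* Against [q = 1] the difference starts with [sp - 1 = 2 (om - 1)], of value 1 like [(t - 1)^2].
   The residue of their quotient is [om + 1 = om ^+ 2], a square in F_4, so [(t - 1) * om] is added
   to [q] to cancel it. *)
apply: (ramifiedI (P := 2 ^+ k./2) (d' := sp * (2 ^+ k * sp + 1)) (q := 1 + (t - 1) * om) (rq := 0) (r := 3 / 2) (n := 3) fK2); try num_tac.
- exact: subfield_pow2.
- by rewrite expf_neq0 ?pnatr_eq0.
- exact: d_even.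
- by solve_mem fK2.
- by [].
have vPv : vge v 2 (2 ^+ k) by apply: vP2 vv; exact: even_gt1 kE.
move: tE; rewrite aE a'C => tE; move: (2 ^+ k) vPv tE => P vPv tE.
veq_main vv (2 * (t - 1) * (1 + 2 * r)%:~R)
  (4 * om + 4 * r%:~R + P * (8 * r%:~R + 5) - P ^+ 2 * (8 * r%:~R + 5) * (om + (2 * r%:~R + 1))) (2 : rat).
rewrite intrD intrM sO; ring: omE tE.
Qed.

Section OneModEight.
Hypothesis a'8 : (a' %% 8)%Z = 1.

Let a'C : exists m : int, a' = 8 * m + 1.
Proof. by exists (a' %/ 8)%Z; lia. Qed.

Let step1 v : valuation v -> split_at rational v a%:~R.
Proof.
move=> vv; have [m mE] := a'C; have vm := vge_int vv m.
apply: (splitI (P := 2 ^+ k) (d' := a'%:~R) (q := 1) (rq := 0) rational_subfield) => //.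
- exact: rational_pow2.
- exact: (rational_int 1).
- by veq_tac vv.
- rewrite mE intrD intrM (_ : _ - _ = 8 * m%:~R); last by ring.
  by vgt_tac vv (3 : rat).
Qed.

Lemma tower_four1_odd j : k = (2 * j).+1 -> tower_steps a Split Ram Ram.
Proof.
move=> kE K1 K2 s t v ctx; have [fK1 fK2 K1s K2t K12 sE tE vv] := ctx.
split=> /=; [exact: step1|exact: step2|apply: (step3_odd kE ctx)] => sp spE.
have [m mE] := a'C; have vm := vge_int vv m; move: spE; rewrite mE intrD intrM => spE.
have [|y [ys y1 ym]] := unit_split vv (x := sp) (r := 3) (veq1 vv) _ isT.
  by rewrite (_ : _ * _ = 8 * m%:~R); [vge_tac vv|ring: spE].
case: ys y1 ym => -> y1 ym; first by vge_tac vv.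
by rewrite (_ : sp - 1 = - (- sp + 1)); [vge_tac vv|ring].
Qed.

Let sign j K1 K2 s t v (m : int) r : k = (2 * j)%N -> tower_context a K1 K2 s t v -> ~~ (2 %| m)%Z ->
  vge v r (a'%:~R - m%:~R ^+ 2) -> 2 < r ->
  exists y R, [/\ K2 R, R != 0, y ^+ 2 = a'%:~R & s * (s + 1) = R ^+ 2 * (y * (2 ^+ k * y + 1))] /\
    (veq v 1 (y + m%:~R) /\ vge v (r - 1) (y - m%:~R)).
Proof.
move=> kE ctx odd_m vD r2; have [sp [K1sp K2sp spE sD vsp]] := reduced_s ctx.
have [fK1 fK2 K1s K2t K12 sE tE vv] := ctx.
have [|y [ys y1 ym]] := unit_split vv (x := sp) (veq_odd vv odd_m) _ r2.
  by rewrite (_ : _ * _ = a'%:~R - m%:~R ^+ 2) //; ring: spE.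
have b0 : a%:~R - 1 != 0 :> algC.
  have vPv := vP vv; have va' := vge_int vv a'.
  suff /veqP[] : veq v 0 (a%:~R - 1) by [].
  rewrite aE; move: (2 ^+ k) vPv => P vPv.
  by veq_main vv (- 1 : algC) (P ^+ 2 * a'%:~R) (2 : rat); ring.
have [|R [K2R R0 RE]] := @tower_sign a K1 K2 s t v (2 ^+ k * y) ctx _ b0.
  by case: ys => ->; [left|right]; rewrite sD // mulrN.
exists y, (R * 2 ^+ j); split; last by split.
split.
- by apply: (subringM (subfield_subring fK2)) => //; exact: subfield_pow2.
- by rewrite mulf_neq0 ?expf_neq0 ?pnatr_eq0.
- by case: ys => ->; rewrite ?sqrrN.
- by rewrite RE (d_even kE (erefl (2 ^+ k * y))); ring.
Qed.

(** As [y (2 ^+ k * y + 1) = y + 2 ^+ k * a'], the difference from [q = 1] is [y - 1 + 2 ^+ k * a'].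
    Its value is 2 because of [4 a'] when [k = 2], and because of [y - 1 = (a' - 1) / (y + 1)] when
    [k >= 4]. *)
Lemma tower_four1_even_inert j : k = (2 * j)%N ->
  (k = 2%N /\ (a' %% 16)%Z = 1) \/ ((4 <= k)%N /\ (a' %% 16)%Z = 9) -> tower_steps a Split Ram Inert.
Proof.
move=> kE ka K1 K2 s t v ctx; have [fK1 fK2 K1s K2t K12 sE tE vv] := ctx.
split=> /=; [exact: step1|exact: step2|].
case: ka => -[k2 a16].
  have [r rE] : exists r : int, a' = 16 * r + 1 by exists (a' %/ 16)%Z; lia.
  have vr := vge_int vv r; have a'R : a'%:~R = 16 * r%:~R + 1 :> algC by rewrite rE intrD intrM.
  have [|y [R [[K2R R0 yE RE] [y1 ym]]]] := sign (m := 1) (r := 4) kE ctx isT _ isT.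
    by rewrite a'R (_ : _ - _ = 2 * 8 * r%:~R); [vge_tac vv|ring].
  apply: (inertI (P := R) (d' := y * (2 ^+ k * y + 1)) (q := 1) (rq := 0) fK2) => //.
  + by solve_mem fK2.
  + by veq_tac vv.
  + rewrite k2; veq_main vv (4 : algC) (y - 1%:~R + 4 * 2 * 8 * r%:~R) (3 : rat).
    by move: yE; rewrite a'R => yE; ring: yE.
have [r rE] : exists r : int, a' = 16 * r + 9 by exists (a' %/ 16)%Z; lia.
have vr := vge_int vv r; have a'R : a'%:~R = 16 * r%:~R + 9 :> algC by rewrite rE intrD intrM.
have [|y [R [[K2R R0 yE RE] [y1 ym]]]] := sign (m := 1) (r := 3) kE ctx isT _ isT.
  by rewrite a'R (_ : _ - _ = 8 * (2 * r%:~R + 1)); [vge_tac vv|ring].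
have vD : veq v 3 (y ^+ 2 - 1).
  by rewrite yE a'R; veq_main vv (8 : algC) (2 * 8 * r%:~R) (4 : rat); ring.
have vy : veq v 2 (y - 1).
  have [y10 _] := veqP _ _ _ y1.
  rewrite (_ : y - 1 = (y ^+ 2 - 1) / (y + 1%:~R)); first by veq_tac vv.
  by field.
have vP4 : vge v 4 (2 ^+ k) by apply: vge_mono (veq_vge (veq_pow2 k vv)) _; rewrite ler_nat.
apply: (inertI (P := R) (d' := y * (2 ^+ k * y + 1)) (q := 1) (rq := 0) fK2) => //.
- by solve_mem fK2.
- by veq_tac vv.
- have va' := vge_int vv a'; move: (2 ^+ k) vP4 => P vPv.
  by veq_main vv (y - 1) (P * a'%:~R) (4 : rat); ring: yE.
Qed.

Lemma tower_four1_even_split j : k = (2 * j)%N ->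
  (k = 2%N /\ (a' %% 16)%Z = 9) \/ ((4 <= k)%N /\ (a' %% 16)%Z = 1) -> tower_steps a Split Ram Split.
Proof.
move=> kE ka K1 K2 s t v ctx; have [fK1 fK2 K1s K2t K12 sE tE vv] := ctx.
split=> /=; [exact: step1|exact: step2|].
case: ka => -[k2 a16].
  have [r rE] : exists r : int, a' = 16 * r + 9 by exists (a' %/ 16)%Z; lia.
  have vr := vge_int vv r; have a'R : a'%:~R = 16 * r%:~R + 9 :> algC by rewrite rE intrD intrM.
  (* [5 ^ 2 = 9 + 16] matches [a'] modulo 16; with [y] equal to 5 modulo 8, [y + 4 a'] is [5 + 36],
     which is 1 modulo 8. *)
  have [|y [R [[K2R R0 yE RE] [y1 ym]]]] := sign (m := 5) (r := 4) kE ctx isT _ isT.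
    by rewrite a'R (_ : _ - _ = 2 * 8 * (r%:~R - 1)); [vge_tac vv|ring].
  apply: (splitI (P := R) (d' := y * (2 ^+ k * y + 1)) (q := 1) (rq := 0) fK2) => //.
  + by solve_mem fK2.
  + by veq_tac vv.
  + rewrite k2 (_ : _ - _ = (y - 5%:~R) + 8 * (8 * r%:~R + 5)); first by vgt_tac vv (3 : rat).
    by move: yE; rewrite a'R => yE; ring: yE.
have [r rE] : exists r : int, a' = 16 * r + 1 by exists (a' %/ 16)%Z; lia.
have vr := vge_int vv r; have a'R : a'%:~R = 16 * r%:~R + 1 :> algC by rewrite rE intrD intrM.
have [|y [R [[K2R R0 yE RE] [y1 ym]]]] := sign (m := 1) (r := 4) kE ctx isT _ isT.
  by rewrite a'R (_ : _ - _ = 2 * 8 * r%:~R); [vge_tac vv|ring].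
have vP4 : vge v 4 (2 ^+ k) by apply: vge_mono (veq_vge (veq_pow2 k vv)) _; rewrite ler_nat.
apply: (splitI (P := R) (d' := y * (2 ^+ k * y + 1)) (q := 1) (rq := 0) fK2) => //.
- by solve_mem fK2.
- by veq_tac vv.
- have va' := vge_int vv a'; move: (2 ^+ k) vP4 => P vPv.
  rewrite (_ : _ - _ = (y - 1%:~R) + P * a'%:~R); first by vgt_tac vv (3 : rat).
  by ring: yE.
Qed.

End OneModEight.
End OneModFour.
End FourTimesOdd.

(** * Classes with [a = 2 ^+ (2 k + 1) * m], [m] odd and [k >= 1] *)

Lemma odd_val_int (m : int) : ~~ (2 %| m)%Z -> exists h, m = 2 * h - 1.
Proof. by move=> odd_m; exists ((m + 1) %/ 2)%Z; lia. Qed.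

Lemma nat_parity k : exists j, k = (2 * j)%N \/ k = (2 * j).+1.
Proof. by exists k./2; lia. Qed.

Lemma tower_odd_val k (m : int) : (1 <= k)%N -> ~~ (2 %| m)%Z ->
  tower_steps (2 ^+ (2 * k + 1) * m) Ram Ram Ram.
Proof.
move=> k1 odd_m K1 K2 s t v [fK1 fK2 K1s K2t K12 sE tE vv].
have aE : (2 ^+ (2 * k + 1) * m)%:~R = (2 ^+ k) ^+ 2 * (2 * m%:~R) :> algC.
  by rewrite intrM rmorphXn /= exprD expr1 mulnC exprM mulrA.
have vm := veq_odd vv odd_m.
have [h hE] : exists h : algC, m%:~R = 2 * h - 1 /\ vge v 0 h.
  have [h ->] := odd_val_int odd_m; exists h%:~R; rewrite intrB intrM; split=> //; exact: vge_int.
have [mE vh] := hE.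
have K1X := subfield_pow2 k fK1; have K2X := subfield_pow2 k fK2.
have X0 : 2 ^+ k != 0 :> algC by rewrite expf_neq0 ?pnatr_eq0.
have vXk := veq_pow2 k vv.
have vX : vge v 1 (2 ^+ k) by apply: vge_mono (veq_vge vXk) _; rewrite ler1n.
have [pi piD] : exists pi, pi = s / 2 ^+ k by exists (s / 2 ^+ k).
have piE : pi ^+ 2 = 2 * m%:~R by rewrite piD exprMn sE aE exprVn mulrAC mulfV ?mul1r // expf_neq0.
have K1pi : K1 pi by rewrite piD; solve_mem fK1.
have K2pi := K12 _ K1pi.
have vpi : veq v (1 / 2) pi by apply: (veq_sqrt vv); rewrite piE; veq_tac vv.
have sD : s = 2 ^+ k * pi by rewrite piD mulrC divfK.
have [u uE] : exists u, u = 1 + pi by exists (1 + pi).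
have vu : veq v 0 u by rewrite uE; veq_main vv 1 pi (1 / 2); ring.
have K1u : K1 u by rewrite uE; solve_mem fK1.
have K2u := K12 _ K1u.
have [z zE] : exists z, z = t - u by exists (t - u).
have K2z : K2 z by rewrite zE; solve_mem fK2.
have vD : veq v (3 / 2) ((2 ^+ k) ^+ 2 * (2 * m%:~R) - 1 - u ^+ 2).
  move: piE; rewrite mE uE; move: (2 ^+ k) vX => X vX piE.
  by veq_main vv (- (2 * pi)) (X ^+ 2 * 2 * (2 * h - 1) - 4 * h) 2; ring: piE.
have vz : veq v (3 / 4) z.
  apply: (veq_eq (r' := 3 / 2 / 2)); last lra.
  apply: (half_val vv (w := 2 * u) (r' := 1)); [|vge_tac vv|lra].
  rewrite (_ : _ * _ = (2 ^+ k) ^+ 2 * (2 * m%:~R) - 1 - u ^+ 2) //.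
  by move: tE; rewrite aE zE => tE; ring: tE.
have [u0 _] := veqP _ _ _ vu; have [pi0 _] := veqP _ _ _ vpi.
split=> /=.
- apply: (ramifiedI_val _ (r := 2 * k%:R + 1) (n := 1 + 2 * k%:Z)).
  + rewrite aE; move: (2 ^+ k) vXk => X vXk; apply: veq_eq; [veq_prod vv|lra].
  + exact: odd_int_add.
  + by rewrite intrD intrM; lra.
- rewrite aE; apply: (ramifiedI1 (q := u) (rq := 0) (r := 3 / 2) (n := 3) fK1); try first [num_tac | assumption].
have [j [kE|kE]] := nat_parity k; last first.
  (* The square factor is chosen to give the reduced radicand the value 3/2 of [z ^+ 2]: it starts
     with [2 pi] for odd [k] and, below, with [pi ^+ 3 = 2 m pi] for even [k]. Both cancel the
     [- 2 pi] in [z ^+ 2] up to value 2, leaving [2 u z] of value 7/4. *)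
  apply: (ramifiedI (P := 2 ^+ j / u) (d' := 2 * pi * u ^+ 2 * (1 + 2 ^+ k * pi)) (q := z) (rq := 3 / 4) (r := 7 / 4) (n := 1) fK2); try first [num_tac | assumption].
  + by apply: (subfield_div fK2) => //; exact: subfield_pow2.
  + by rewrite mulf_neq0 ?invr_eq0 // expf_neq0 ?pnatr_eq0.
  + have XE : 2 ^+ k = 2 * (2 ^+ j) ^+ 2 :> algC by rewrite kE exprS mulnC exprM.
    by rewrite sD XE; move: (2 ^+ j) => Q; field.
  + move: tE piE; rewrite aE mE; move: (2 ^+ k) vX => X vX tE piE.
    veq_main vv (2 * u * z) (4 * pi + 8 * (2 * h - 1) + 4 * (2 * h - 1) * pi + 4 * X * (2 * h - 1) * u ^+ 2
       + 4 * h - 2 * X ^+ 2 * (2 * h - 1)) 2.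
    by rewrite zE uE; ring: tE piE.
apply: (ramifiedI (P := 2 ^+ j / (pi * u)) (d' := pi ^+ 3 * u ^+ 2 * (1 + 2 ^+ k * pi)) (q := z) (rq := 3 / 4) (r := 7 / 4) (n := 1) fK2); try first [num_tac | assumption].
- apply: (subfield_div fK2); [exact: subfield_pow2|by solve_mem fK2].
- by apply: mulf_neq0; [rewrite expf_neq0 ?pnatr_eq0|rewrite invr_eq0 mulf_neq0].
- have XE : 2 ^+ k = (2 ^+ j) ^+ 2 :> algC by rewrite kE mulnC exprM.
  by rewrite sD XE; move: (2 ^+ j) => Q; field; rewrite u0 pi0.
- move: tE piE; rewrite aE mE; move: (2 ^+ k) vX => X vX tE piE.
  veq_main vv (2 * u * z) (4 * h * pi + 4 * (2 * h - 1) ^+ 2 * pi + 8 * (2 * h - 1) ^+ 2 + 4 * X * (2 * h - 1) ^+ 2 * u ^+ 2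
     + 4 * h - 2 * X ^+ 2 * (2 * h - 1)) 2.
  by rewrite zE uE; ring: tE piE.
Qed.

(** * Exhaustion of the classes *)

(** These predicates repeat the right-hand sides of the theorem, so conversion alone identifies them
    there. *)
Definition class811 (c : int) : Prop :=
  (c == 1 %[mod 4])%Z \/
  (exists (k : nat) (m : int), (1 <= k)%N /\ ~~ (2 %| m)%Z /\ c = 2 ^+ (2 * k + 1) * m).

Definition class421 (c : int) : Prop :=
  (c == 2 %[mod 8])%Z \/ (c == 3 %[mod 16])%Z \/
  (c == 4 %[mod 32])%Z \/ (c == 12 %[mod 32])%Z \/
  (exists (k : nat) (r : int), (2 <= k)%N /\
    (c = 4 ^+ k * (8 * r + 3) \/ c = 4 ^+ k * (8 * r - 3))).

Definition class412 (c : int) : Prop :=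
  (c == 6 %[mod 8])%Z \/ (c == 23 %[mod 32])%Z \/ (c == 28 %[mod 32])%Z \/
  (c == 16 %[mod 128])%Z \/
  (exists (k : nat) (r : int), (2 <= k)%N /\ c = 4 ^+ (2 * k) * (8 * r + 1)) \/
  (exists (k : nat) (r : int), (2 <= k)%N /\ c = 4 ^+ (2 * k - 1) * (8 * r + 7)) \/
  (exists (k : nat) (r : int), (4 <= k)%N /\ c = -1 + 2 ^+ k * (4 * r + 1)).

Definition class222 (c : int) : Prop :=
  (c == 11 %[mod 16])%Z \/ (c == 39 %[mod 64])%Z \/ (c == 52 %[mod 64])%Z \/
  (c == 240 %[mod 256])%Z \/
  (exists (k : nat) (r : int), (1 <= k)%N /\ c = -1 + 4 ^+ k * (64 * r + 24)) \/
  (exists (k : nat) (r : int), (2 <= k)%N /\ c = -1 + 4 ^+ k * (8 * r + 3)) \/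
  (exists (k : nat) (r : int), (2 <= k)%N /\ c = 4 ^+ (2 * k - 1) * (16 * r + 9)) \/
  (exists (k : nat) (r : int), (2 <= k)%N /\ c = 4 ^+ (2 * k) * (16 * r + 7)).

Definition class214 (c : int) : Prop :=
  (c == 7 %[mod 64])%Z \/ (c == 20 %[mod 64])%Z \/ (c == 112 %[mod 256])%Z \/
  (exists (k : nat) (r : int), (1 <= k)%N /\ c = -1 + 4 ^+ k * (64 * r - 8)) \/
  (exists (k : nat) (r : int), (2 <= k)%N /\ c = -1 + 4 ^+ k * (8 * r + 7)) \/
  (exists (k : nat) (r : int), (2 <= k)%N /\ c = 4 ^+ (2 * k - 1) * (16 * r + 1)) \/
  (exists (k : nat) (r : int), (2 <= k)%N /\ c = 4 ^+ (2 * k) * (16 * r + 15)).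

Lemma tower_steps_eq a a' k1 k2 k3 : a = a' -> tower_steps a' k1 k2 k3 -> tower_steps a k1 k2 k3.
Proof. by move=> ->. Qed.

Lemma eq_modzP (c m d : int) : (c == m %[mod d])%Z -> exists q, c = d * q + m.
Proof.
rewrite eqz_mod_dvd => /dvdzP[q qE]; exists q.
by rewrite mulrC -qE subrK.
Qed.

(** * From the classes of [c] to the kinds of the three steps *)

Section Families.
Variable c : int.

Lemma steps811 : class811 c -> tower_steps (- c) Ram Ram Ram.
Proof.
move=> [/eq_modzP[q ->]|[k [m [k1 [odd_m ->]]]]].
  by apply: (@tower_steps_eq _ (4 * (- q - 1) + 3)); [ring|exact: tower_3mod4].
by rewrite -mulrN; apply: tower_odd_val => //; lia.
Qed.

Lemma steps421 : class421 c -> exists k1 k2 k3,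
  [/\ tower_steps (- c) k1 k2 k3, at_most_one_inert k1 k2 k3 & decomp_type k1 k2 k3 = (4, 2, 1)%N].
Proof.
move=> [/eq_modzP[q ->]|[/eq_modzP[q ->]|[/eq_modzP[q ->]|[/eq_modzP[q ->]|]]]].
- exists Ram, Inert, Ram; split=> //.
  by apply: (@tower_steps_eq _ (8 * (- q - 1) + 6)); [ring|exact: tower_6mod8].
- exists Inert, Ram, Ram; split=> //.
  by apply: (@tower_steps_eq _ (16 * (- q - 1) + 13)); [ring|exact: tower_13mod16].
- exists Ram, Inert, Ram; split=> //.
  have E : - (32 * q + 4) = 4 ^+ 1 * (- (8 * q) - 1) by ring.
  by apply: (tower_steps_eq E); apply: tower_four3_inert; lia.
- exists Inert, Ram, Ram; split=> //.
  have E : - (32 * q + 12) = 4 ^+ 1 * (- (8 * q) - 3) by ring.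
  by apply: (tower_steps_eq E); apply: tower_four5; lia.
move=> [k [r [k2 [->|->]]]]; rewrite -mulrN.
- by exists Inert, Ram, Ram; split=> //; apply: tower_four5; lia.
- by exists Ram, Inert, Ram; split=> //; apply: tower_four3_inert; lia.
Qed.

Lemma steps412 : class412 c -> exists k1 k2 k3,
  [/\ tower_steps (- c) k1 k2 k3, at_most_one_inert k1 k2 k3 & decomp_type k1 k2 k3 = (4, 1, 2)%N].
Proof.
move=> [/eq_modzP[q ->]|[/eq_modzP[q ->]|[/eq_modzP[q ->]|[/eq_modzP[q ->]|]]]].
- exists Ram, Split, Ram; split=> //.
  by apply: (@tower_steps_eq _ (8 * (- q - 1) + 2)); [ring|exact: tower_2mod8].
- exists Split, Ram, Ram; split=> //.
  have E : - (32 * q + 23) = 2 * 4 ^+ 1 * (4 * (- q - 1) + 1) + 1 by ring.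
  by apply: (tower_steps_eq E); apply: tower_eight_ram => //; lia.
- exists Split, Ram, Ram; split=> //.
  have E : - (32 * q + 28) = 4 ^+ 1 * (8 * (- q - 1) + 1) by ring.
  by apply: (tower_steps_eq E); apply: (@tower_four1_odd 1 _ _ _ _ _ 0) => //; lia.
- exists Ram, Split, Ram; split=> //.
  have E : - (128 * q + 16) = 4 ^+ 2 * (8 * (- q - 1) + 7) by ring.
  by apply: (tower_steps_eq E); apply: (@tower_four3_split_ram 2 _ _ _ _ 1) => //; lia.
move=> [[k [r [k2 ->]]]|[[k [r [k2 ->]]]|[k [r [k4 ->]]]]].
- exists Ram, Split, Ram; split=> //; rewrite -mulrN.
  by apply: (@tower_four3_split_ram _ _ _ _ _ k) => //; lia.
- exists Split, Ram, Ram; split=> //; rewrite -mulrN.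
  by apply: (@tower_four1_odd _ _ _ _ _ _ k.-1) => //; lia.
exists Split, Ram, Ram; split=> //; have [j [kE|kE]] := nat_parity k.
  have E : - (-1 + 2 ^+ k * (4 * r + 1)) = 4 ^+ j * (4 * (- r - 1) + 3) + 1.
    by rewrite kE exprM (_ : 2 ^+ 2 = 4) //; ring.
  by apply: (tower_steps_eq E); apply: tower_four_ram => //; lia.
have E : - (-1 + 2 ^+ k * (4 * r + 1)) = 2 * 4 ^+ j * (4 * (- r - 1) + 3) + 1.
  by rewrite kE exprS exprM (_ : 2 ^+ 2 = 4) //; ring.
by apply: (tower_steps_eq E); apply: tower_twice_four_ram => //; lia.
Qed.

Lemma steps222 : class222 c -> exists k1 k2 k3,
  [/\ tower_steps (- c) k1 k2 k3, at_most_one_inert k1 k2 k3 & decomp_type k1 k2 k3 = (2, 2, 2)%N].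
Proof.
move=> [/eq_modzP[q ->]|[/eq_modzP[q ->]|[/eq_modzP[q ->]|[/eq_modzP[q ->]|]]]].
- exists Inert, Split, Ram; split=> //.
  have E : - (16 * q + 11) = 4 * (- (4 * q) - 3) + 1 by ring.
  apply: (tower_steps_eq E).
  (* [- c] is 5 modulo 16; its two classes 21 and 5 modulo 32 need different approximations in the
     second step. *)
  have [j [qE|qE]] : exists j, q = 2 * j \/ q = 2 * j + 1 by exists (q %/ 2)%Z; lia.
    by apply: (@tower_5mod32_or_21 (- j - 1) _ true); rewrite qE; ring.
  by apply: (@tower_5mod32_or_21 (- j - 1) _ false); rewrite qE; ring.
- exists Split, Ram, Inert; split=> //.
  have E : - (64 * q + 39) = 2 * 4 ^+ 1 * (8 * (- q - 1) + 3) + 1 by ring.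
  by apply: (tower_steps_eq E); apply: tower_eight_inert => //; lia.
- exists Ram, Split, Inert; split=> //.
  have E : - (64 * q + 52) = 4 ^+ 1 * (16 * (- q - 1) + 3) by ring.
  by apply: (tower_steps_eq E); apply: (@tower_four3_split_inert 1 _ _ _ _ 0) => //; lia.
- exists Split, Ram, Inert; split=> //.
  have E : - (256 * q + 240) = 4 ^+ 2 * (16 * (- q - 1) + 1) by ring.
  by apply: (tower_steps_eq E); apply: (@tower_four1_even_inert 2 _ _ _ _ _ 1) => //; lia.
move=> [[k [r [k1 ->]]]|[[k [r [k2 ->]]]|[[k [r [k2 ->]]]|[k [r [k2 ->]]]]]].
- exists Split, Ram, Inert; split=> //.
  (* [64 r + 24 = 8 (8 r + 3)] and [4 ^+ k * 8 = 2 * 4 ^+ k.+1]; the shift turns [k >= 1] into an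
     exponent of at least 2. *)
  have E : - (-1 + 4 ^+ k * (64 * r + 24)) = 2 * 4 ^+ k.+1 * (8 * (- r - 1) + 5) + 1.
    by rewrite exprS; ring.
  by apply: (tower_steps_eq E); apply: tower_twice_four_inert => //; lia.
- exists Split, Inert, Ram; split=> //.
  have E : - (-1 + 4 ^+ k * (8 * r + 3)) = 4 ^+ k * (8 * (- r - 1) + 5) + 1 by ring.
  by apply: (tower_steps_eq E); apply: tower_four_inert.
- exists Ram, Split, Inert; split=> //; rewrite -mulrN.
  by apply: (@tower_four3_split_inert _ _ _ _ _ k.-1) => //; lia.
- exists Split, Ram, Inert; split=> //; rewrite -mulrN.
  by apply: (@tower_four1_even_inert _ _ _ _ _ _ k) => //; lia.
Qed.

Lemma steps214 : class214 c -> exists k1 k2 k3,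
  [/\ tower_steps (- c) k1 k2 k3, at_most_one_inert k1 k2 k3 & decomp_type k1 k2 k3 = (2, 1, 4)%N].
Proof.
move=> [/eq_modzP[q ->]|[/eq_modzP[q ->]|[/eq_modzP[q ->]|]]].
- exists Split, Ram, Split; split=> //.
  have E : - (64 * q + 7) = 2 * 4 ^+ 1 * (8 * (- q - 1) + 7) + 1 by ring.
  by apply: (tower_steps_eq E); apply: tower_eight_split => //; lia.
- exists Ram, Split, Split; split=> //.
  have E : - (64 * q + 20) = 4 ^+ 1 * (16 * (- q - 1) + 11) by ring.
  by apply: (tower_steps_eq E); apply: (@tower_four3_split_split 1 _ _ _ _ 0) => //; lia.
- exists Split, Ram, Split; split=> //.
  have E : - (256 * q + 112) = 4 ^+ 2 * (16 * (- q - 1) + 9) by ring.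
  by apply: (tower_steps_eq E); apply: (@tower_four1_even_split 2 _ _ _ _ _ 1) => //; lia.
move=> [[k [r [k1 ->]]]|[[k [r [k2 ->]]]|[[k [r [k2 ->]]]|[k [r [k2 ->]]]]]].
- exists Split, Ram, Split; split=> //.
  have E : - (-1 + 4 ^+ k * (64 * r - 8)) = 2 * 4 ^+ k.+1 * (8 * (- r) + 1) + 1.
    by rewrite exprS; ring.
  by apply: (tower_steps_eq E); apply: tower_twice_four_split => //; lia.
- exists Split, Split, Ram; split=> //.
  have E : - (-1 + 4 ^+ k * (8 * r + 7)) = 4 ^+ k * (8 * (- r - 1) + 1) + 1 by ring.
  by apply: (tower_steps_eq E); apply: tower_four_split.
- exists Ram, Split, Split; split=> //; rewrite -mulrN.
  by apply: (@tower_four3_split_split _ _ _ _ _ k.-1) => //; lia.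
- exists Split, Ram, Split; split=> //; rewrite -mulrN.
  by apply: (@tower_four1_even_split _ _ _ _ _ _ k) => //; lia.
Qed.

(** The power of 2 and the odd part of [c + 1] for odd [c], of [c] for even [c], determine the
    class; the hypotheses keep that number nonzero. Small exponents are treated apart, since there
    the classes are given as congruences. *)
Lemma classes_exhaustive : c != 0 -> c != -1 ->
  [\/ class811 c, class421 c, class412 c | class222 c \/ class214 c].
Proof.
move=> c0 c1; have [odd_c|even_c] := boolP (~~ (2 %| c)%Z).
  have [i [n [odd_n cE]]] : exists (i : nat) (n : int), ~~ (2 %| n)%Z /\ c + 1 = 2 ^+ i * n.
    by apply: int_odd_part; lia.
  have {}cE : c = -1 + 2 ^+ i * n by rewrite -cE; ring.
  have [i4|i4] := leqP 4 i; last first.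
    case: i i4 cE => [|[|[|[|//]]]] _ cE.
    - by move: odd_c; rewrite cE expr0; lia.
    - by constructor 1; left; rewrite cE expr1; lia.
    - have [] : ((n %% 4)%Z = 1) \/ ((n %% 4)%Z = 3) by lia.
        by constructor 2; right; left; rewrite cE (_ : 2 ^+ 2 = 4) //; lia.
      by constructor 4; left; left; rewrite cE (_ : 2 ^+ 2 = 4) //; lia.
    - have : c = 8 * n - 1 by rewrite cE (_ : 2 ^+ 3 = 8) //; ring.
      move=> {}cE; have [n3|[n1|n5]] : ((n %% 4)%Z = 3) \/ ((n %% 8)%Z = 1) \/ ((n %% 8)%Z = 5) by lia.
      + by constructor 3; right; left; lia.
      + by constructor 4; right; left; lia.
      + by constructor 4; left; right; left; lia.
  have [n1|[n3|n7]] : ((n %% 4)%Z = 1) \/ ((n %% 8)%Z = 3) \/ ((n %% 8)%Z = 7) by lia.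
  - constructor 3; do 6 right; exists i, (n %/ 4)%Z; split=> //; rewrite cE; congr (_ + _ * _); lia.
  - constructor 4; left; have [j [iE|iE]] := nat_parity i.
      do 5 right; left; exists j, (n %/ 8)%Z; split; first lia.
      by rewrite cE iE exprM (_ : 2 ^+ 2 = 4) //; congr (_ + _ * _); lia.
    (* For the odd exponent [2 j + 3] the power of 2 is [4 ^+ j * 8], and [8 n] is the [64 r + 24]
       of the class. *)
    case: j iE => [|j] iE; first lia.
    do 4 right; left; exists j, (n %/ 8)%Z; split; first lia.
    rewrite cE iE.
    rewrite exprS exprM (_ : 2 ^+ 2 = 4) // exprS (_ : 64 * _ + 24 = 8 * n); [ring|lia].
  - constructor 4; right; have [j [iE|iE]] := nat_parity i.
      do 4 right; left; exists j, (n %/ 8)%Z; split; first lia.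
      by rewrite cE iE exprM (_ : 2 ^+ 2 = 4) //; congr (_ + _ * _); lia.
    case: j iE => [|j] iE; first lia.
    do 3 right; left; exists j, ((n %/ 8)%Z + 1); split; first lia.
    rewrite cE iE.
    rewrite exprS exprM (_ : 2 ^+ 2 = 4) // exprS (_ : 64 * _ - 8 = 8 * n); [ring|lia].
have [i [n [odd_n cE]]] := int_odd_part c0.
have [j [iE|iE]] := nat_parity i; last first.
  case: j iE => [|j] iE.
    have : c = 2 * n by rewrite cE iE expr1.
    move=> {}cE; have [n1|n3] : ((n %% 4)%Z = 1) \/ ((n %% 4)%Z = 3) by lia.
      by constructor 2; left; lia.
    by constructor 3; left; lia.
  by constructor 1; right; exists j.+1, n; rewrite cE iE addn1.
have {}cE : c = 4 ^+ j * n by rewrite cE iE exprM.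
have [j1|j2] := leqP j 1.
  case: j j1 cE {iE} => [|[|//]] _ cE; first by move: even_c; rewrite cE expr0 mul1r; lia.
  have {}cE : c = 4 * n by rewrite cE expr1.
  have [n8|[n8|[n8|[n16|n16]]]] : ((n %% 8)%Z = 1) \/ ((n %% 8)%Z = 3) \/ ((n %% 8)%Z = 7) \/
    ((n %% 16)%Z = 5) \/ ((n %% 16)%Z = 13) by lia.
  - by constructor 2; do 2 right; left; lia.
  - by constructor 2; do 3 right; left; lia.
  - by constructor 3; do 2 right; left; lia.
  - by constructor 4; right; right; left; lia.
  - by constructor 4; left; do 2 right; left; lia.
have [n8|[n8|n8]] : ((n %% 8)%Z = 3) \/ ((n %% 8)%Z = 5) \/ ((n %% 8)%Z = 1 \/ (n %% 8)%Z = 7) by lia.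
- constructor 2; do 4 right; exists j, (n %/ 8)%Z; split=> //; left; rewrite cE; congr (_ * _); lia.
- constructor 2; do 4 right; exists j, ((n %/ 8)%Z + 1); split=> //; right; rewrite cE; congr (_ * _); lia.
have [j2E|j3] : j = 2%N \/ (3 <= j)%N by lia.
  have {}cE : c = 16 * n by rewrite cE j2E.
  case: n8 => n8; first by constructor 3; do 3 right; left; lia.
  have [n16|n16] : ((n %% 16)%Z = 7) \/ ((n %% 16)%Z = 15) by lia.
    by constructor 4; right; do 2 right; left; lia.
  by constructor 4; left; do 3 right; left; lia.
have [l [jE|jE]] := nat_parity j; case: n8 => n8.
- constructor 3; do 4 right; left; exists l, (n %/ 8)%Z; split; first lia.
  by rewrite cE jE; congr (_ * _); lia.
- constructor 4; have [n16|n16] : ((n %% 16)%Z = 7) \/ ((n %% 16)%Z = 15) by lia.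
    left; do 7 right; exists l, (n %/ 16)%Z; split; first lia.
    by rewrite cE jE; congr (_ * _); lia.
  right; do 6 right; exists l, (n %/ 16)%Z; split; first lia.
  by rewrite cE jE; congr (_ * _); lia.
- have jE' : j = (2 * l.+1 - 1)%N by lia.
  constructor 4; have [n16|n16] : ((n %% 16)%Z = 1) \/ ((n %% 16)%Z = 9) by lia.
    right; do 5 right; left; exists l.+1, (n %/ 16)%Z; split; first lia.
    by rewrite cE jE'; congr (_ * _); lia.
  left; do 6 right; left; exists l.+1, (n %/ 16)%Z; split; first lia.
  by rewrite cE jE'; congr (_ * _); lia.
- have jE' : j = (2 * l.+1 - 1)%N by lia.
  constructor 3; do 5 right; left; exists l.+1, (n %/ 8)%Z; split; first lia.
  by rewrite cE jE'; congr (_ * _); lia.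
Qed.

End Families.

Theorem theorem1p2 (c : int)
  (hc1 : ~ exists z : int, - c = z ^+ 2)
  (hc2 : ~ exists z : int, - (c + 1) = z ^+ 2) :
  (decomp2 c 8 1 1 <->
     (c == 1 %[mod 4])%Z \/
     (exists (k : nat) (m : int), (1 <= k)%N /\ ~~ (2 %| m)%Z /\
        c = 2 ^+ (2 * k + 1) * m)) /\
  (decomp2 c 4 2 1 <->
     (c == 2 %[mod 8])%Z \/ (c == 3 %[mod 16])%Z \/
     (c == 4 %[mod 32])%Z \/ (c == 12 %[mod 32])%Z \/
     (exists (k : nat) (r : int), (2 <= k)%N /\
        (c = 4 ^+ k * (8 * r + 3) \/ c = 4 ^+ k * (8 * r - 3)))) /\
  (decomp2 c 4 1 2 <->
     (c == 6 %[mod 8])%Z \/ (c == 23 %[mod 32])%Z \/ (c == 28 %[mod 32])%Z \/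
     (c == 16 %[mod 128])%Z \/
     (exists (k : nat) (r : int), (2 <= k)%N /\ c = 4 ^+ (2 * k) * (8 * r + 1)) \/
     (exists (k : nat) (r : int), (2 <= k)%N /\ c = 4 ^+ (2 * k - 1) * (8 * r + 7)) \/
     (exists (k : nat) (r : int), (4 <= k)%N /\ c = -1 + 2 ^+ k * (4 * r + 1))) /\
  (decomp2 c 2 2 2 <->
     (c == 11 %[mod 16])%Z \/ (c == 39 %[mod 64])%Z \/ (c == 52 %[mod 64])%Z \/
     (c == 240 %[mod 256])%Z \/
     (exists (k : nat) (r : int), (1 <= k)%N /\ c = -1 + 4 ^+ k * (64 * r + 24)) \/
     (exists (k : nat) (r : int), (2 <= k)%N /\ c = -1 + 4 ^+ k * (8 * r + 3)) \/
     (exists (k : nat) (r : int), (2 <= k)%N /\ c = 4 ^+ (2 * k - 1) * (16 * r + 9)) \/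
     (exists (k : nat) (r : int), (2 <= k)%N /\ c = 4 ^+ (2 * k) * (16 * r + 7))) /\
  (decomp2 c 2 1 4 <->
     (c == 7 %[mod 64])%Z \/ (c == 20 %[mod 64])%Z \/ (c == 112 %[mod 256])%Z \/
     (exists (k : nat) (r : int), (1 <= k)%N /\ c = -1 + 4 ^+ k * (64 * r - 8)) \/
     (exists (k : nat) (r : int), (2 <= k)%N /\ c = -1 + 4 ^+ k * (8 * r + 7)) \/
     (exists (k : nat) (r : int), (2 <= k)%N /\ c = 4 ^+ (2 * k - 1) * (16 * r + 1)) \/
     (exists (k : nat) (r : int), (2 <= k)%N /\ c = 4 ^+ (2 * k) * (16 * r + 15))) /\
  (exists e f g : nat, decomp2 c e f g) /\
  (forall e f g : nat, decomp2 c e f g ->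
     (e, f, g) \in [:: (8, 1, 1); (4, 2, 1); (4, 1, 2); (2, 2, 2); (2, 1, 4)]%N).

Proof.
have dec e f g : (exists k1 k2 k3, [/\ tower_steps (- c) k1 k2 k3, at_most_one_inert k1 k2 k3 &
    decomp_type k1 k2 k3 = (e, f, g)]) -> decomp2 c e f g.
  by move=> [k1 [k2 [k3 [st ok TE]]]]; have := decomp2_of_steps hc1 hc2 ok st; rewrite TE.
have d811 : class811 c -> decomp2 c 8 1 1.
  by move=> /steps811 st; apply: dec; exists Ram, Ram, Ram.
have d421 : class421 c -> decomp2 c 4 2 1 by move/steps421/dec.
have d412 : class412 c -> decomp2 c 4 1 2 by move/steps412/dec.
have d222 : class222 c -> decomp2 c 2 2 2 by move/steps222/dec.
have d214 : class214 c -> decomp2 c 2 1 4 by move/steps214/dec.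
have c0 : c != 0 by apply/eqP => cE; apply: hc1; exists 0; rewrite cE.
have c1 : c != -1 by apply/eqP => cE; apply: hc2; exists 0; rewrite cE.
(* The triple is kept together with its class, so that each converse only has to compare
   numerals. *)
have ex : exists T : nat * nat * nat, [/\ decomp2 c T.1.1 T.1.2 T.2, (0 < T.2)%N &
    (T = (8, 1, 1)%N /\ class811 c) \/ (T = (4, 2, 1)%N /\ class421 c) \/
    (T = (4, 1, 2)%N /\ class412 c) \/ (T = (2, 2, 2)%N /\ class222 c) \/
    (T = (2, 1, 4)%N /\ class214 c)].
  case: (classes_exhaustive c0 c1) => [C|C|C|[C|C]].
  - by exists (8, 1, 1)%N; split; [exact: d811| |left].
  - by exists (4, 2, 1)%N; split; [exact: d421| |right; left].
  - by exists (4, 1, 2)%N; split; [exact: d412| |do 2 right; left].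
  - by exists (2, 2, 2)%N; split; [exact: d222| |do 3 right; left].
  - by exists (2, 1, 4)%N; split; [exact: d214| |do 4 right].
have [T [dT T0 TC]] := ex.
have uniq e f g : decomp2 c e f g -> T = (e, f, g).
  move=> /(decomp2_uniq T0 dT)[]; by case: (T) => [[? ?] ?] /= -> -> ->.
split; [|split; [|split; [|split; [|split; [|split]]]]].
- by split; [move=> /uniq TE; case: TC => [[]|[[]|[[]|[[]|[]]]]]; rewrite TE|exact: d811].
- by split; [move=> /uniq TE; case: TC => [[]|[[]|[[]|[[]|[]]]]]; rewrite TE|exact: d421].
- by split; [move=> /uniq TE; case: TC => [[]|[[]|[[]|[[]|[]]]]]; rewrite TE|exact: d412].
- by split; [move=> /uniq TE; case: TC => [[]|[[]|[[]|[[]|[]]]]]; rewrite TE|exact: d222].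
- by split; [move=> /uniq TE; case: TC => [[]|[[]|[[]|[[]|[]]]]]; rewrite TE|exact: d214].
- by exists T.1.1, T.1.2, T.2.
- move=> e f g /uniq <-; case: TC => [[-> _]|[[-> _]|[[-> _]|[[-> _]|[-> _]]]]];
    by rewrite !inE eqxx ?orbT.
Qed.
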